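(* Let $N\ge1$, $\chi$ a Dirichlet character mod $N$, and $f$ a Maass form of level $N$ and character $\chi$ with $W_f(g)=\prod_vW_v(g_v)$ for all $g\in GL(2,\mathbb A)$. Fix $\gamma=\begin{pmatrix}a&b\\c&d\end{pmatrix}\in SL(2,\mathbb Z)$ and set $M=\gcd(N,2cd)$. Assume that $\alpha\mapsto B_{f,N_1}(\gamma,\alpha)$ is multiplicative on $\mathbb Q^\times$. Then $N/M$ divides $24$. In particular, $N_1$ is not divisible by any prime greater than $3$.
   Context: With $(F|_k\gamma)(z)=(\frac{cz+d}{|cz+d|})^{-k}F(\frac{az+b}{cz+d})$, $f$ satisfies $f|_k\gamma=\chi(d)f$ for $\gamma\in\Gamma_0(N)$ and is an eigenfunction of the weight-$k$ Laplacian; level $N$ means $N$ is the smallest positive integer such that $f|_k\gamma_1=\xi(\gamma_1)f$ for all $\gamma_1\in\Gamma_0(N)$ with $\xi$ a character trivial on $\Gamma_1(N)$. $W_f$ is the Whittaker function of the adelic lift of $f$, assumed to factor into local functions $W_v$ on $GL(2,\mathbb Q_v)$. $N_1=\prod q^{v_q(N)-v_q(c)}$ over primes $q\mid N$ satisfying none of: $v_q(c)=v_q(N)$; $v_q(d)=v_q(N)$; $q=2$ and $v_2(c)=v_2(N)-1$ ($v_q$ the $q$-adic valuation). $B_{f,N_1}(\gamma,\alpha)=\prod_{q\mid N_1}W_q\!\left(\begin{pmatrix}\alpha&0\\0&1\end{pmatrix}\gamma^{-1}\right)$. Multiplicative: $h(\epsilon\prod_pp^{e_p})=h_\infty(\epsilon)\prod_ph_p(e_p)$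 for some $h_\infty:\{\pm1\}\to\mathbb C$, $h_p:\mathbb Z\to\mathbb C$ with $h_p(0)=1$ for almost all $p$.
   Formalization: In the definition of N_1, v_q(c) and v_q(d) are replaced by min(v_q(c), v_q(N)) and min(v_q(d), v_q(N)); with plain valuations N_1 is undefined for c=0 and the last claim fails, e.g. N=5, (c,d)=(1,25). *)

(* Defs.v *)
From HB Require Import structures.
From mathcomp Require Import all_boot all_order all_algebra.
From mathcomp Require Import complex.
From mathcomp Require Import all_classical all_reals all_analysis.

Set Implicit Arguments.
Unset Strict Implicit.
Unset Printing Implicit Defensive.

Import Order.TTheory GRing.Theory Num.Theory.
Import numFieldNormedType.Exports.

Local Open Scope classical_set_scope.
Local Open Scope ring_scope.
Local Open Scope complex_scope.

Definition prime_num : Type := {p : nat | prime p}.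
HB.instance Definition _ := Choice.on prime_num.
Definition prime_val (p : prime_num) : nat := val p.
Coercion prime_val : prime_num >-> nat.

Lemma prime_numP (p : prime_num) : prime p. Proof. exact: (valP p). Qed.

(* Product of an arbitrary family of rings, with pointwise operations. *)
Definition dprod (I : Type) (T : I -> comPzRingType) : Type := forall i, T i.

Section DprodRing.
Variables (I : Type) (T : I -> comPzRingType).
Implicit Types x y z : dprod T.

HB.instance Definition _ := Choice.copy (dprod T) (forall i, T i).

Let add x y : dprod T := fun i => x i + y i.
Let opp x : dprod T := fun i => - x i.
Let mul x y : dprod T := fun i => x i * y i.

Let ext x y : (forall i, x i = y i) -> x = y.
Proof. exact: functional_extensionality_dep. Qed.

Let addA : associative add. Proof. by move=> *; apply: ext => i; apply: addrA. Qed.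
Let addC : commutative add. Proof. by move=> *; apply: ext => i; apply: addrC. Qed.
Let add0 : left_id (fun=> 0) add. Proof. by move=> *; apply: ext => i; apply: add0r. Qed.
Let addN : left_inverse (fun=> 0) opp add.
Proof. by move=> *; apply: ext => i; apply: addNr. Qed.
HB.instance Definition _ := GRing.isZmodule.Build (dprod T) addA addC add0 addN.

Let mulA : associative mul. Proof. by move=> *; apply: ext => i; apply: mulrA. Qed.
Let mulC : commutative mul. Proof. by move=> *; apply: ext => i; apply: mulrC. Qed.
Let mul1 : left_id (fun=> 1) mul. Proof. by move=> *; apply: ext => i; apply: mul1r. Qed.
Let mulr1' : right_id (fun=> 1) mul.
Proof. by move=> *; apply: ext => i; apply: mulr1. Qed.
Let mulDl : left_distributive mul add.
Proof. by move=> *; apply: ext => i; apply: mulrDl. Qed.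
Let mulDr : right_distributive mul add.
Proof. by move=> *; apply: ext => i; apply: mulrDr. Qed.
HB.instance Definition _ :=
  GRing.Zmodule_isPzRing.Build (dprod T) mulA mul1 mulr1' mulDl mulDr.
HB.instance Definition _ := GRing.PzRing_hasCommutativeMul.Build (dprod T) mulC.
End DprodRing.

Section ClassicalUnits.
Variable A : comNzRingType.
Definition is_unit : pred A := fun x => `[< exists y, y * x = 1 >].
Definition unit_inv (x : A) : A := if is_unit x then xget 0 [set y | y * x = 1] else x.
Lemma unit_invVl : {in is_unit, left_inverse 1 unit_inv *%R}.
Proof.
move=> x ux; rewrite /unit_inv ifT //.
by move/asboolP: ux => [y yx]; apply: (xgetPex 0 (P := [set y | y * x = 1])); exists y.
Qed.
Lemma unit_invP x y : y * x = 1 -> is_unit x.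
Proof. by move=> yx; apply/asboolP; exists y. Qed.
Lemma unit_inv_out : {in [predC is_unit], unit_inv =1 id}.
Proof. by move=> x ux; rewrite /unit_inv ifF //; apply/negbTE. Qed.
End ClassicalUnits.

Lemma val_ZmodM m (x y : 'Z_m) : (1 < m)%N ->
  nat_of_ord (x * y) = ((nat_of_ord x * nat_of_ord y) %% m)%N.
Proof. by case: m x y => [|[|m]]. Qed.

Section PadicIntegers.
Variable p : prime_num.

Definition Zp_level (n : nat) : comPzRingType := 'Z_(p ^ n.+1).

(* Z_p = lim Z/p^(n+1): sequences such that x_(n+1) reduces to x_n. *)
Definition padic_compat : pred (dprod Zp_level) :=
  fun x => `[< forall n, (nat_of_ord (x n.+1 : 'Z_(p ^ n.+2)))%:R = x n :> 'Z_(p ^ n.+1) >].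

Lemma pow_gt1 n : (1 < p ^ n.+1)%N.
Proof. by rewrite -{1}(exp1n n.+1) ltn_exp2r // prime_gt1 // prime_numP. Qed.

Lemma red_modn n m : (m %% (Zp_trunc (p ^ n.+2)).+2)%:R = m%:R :> 'Z_(p ^ n.+1).
Proof.
apply: ord_inj; rewrite !val_Zp_nat ?pow_gt1 // Zp_cast ?pow_gt1 //.
by rewrite modn_dvdm // dvdn_exp2l.
Qed.

Lemma redD n (x y : 'Z_(p ^ n.+2)) :
  (nat_of_ord (x + y))%:R = (nat_of_ord x)%:R + (nat_of_ord y)%:R :> 'Z_(p ^ n.+1).
Proof. by rewrite -natrD /= red_modn. Qed.

Lemma redM n (x y : 'Z_(p ^ n.+2)) :
  (nat_of_ord (x * y))%:R = (nat_of_ord x)%:R * (nat_of_ord y)%:R :> 'Z_(p ^ n.+1).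
Proof. by rewrite -natrM /= red_modn. Qed.

Lemma red1 n : (nat_of_ord (1 : 'Z_(p ^ n.+2)))%:R = 1 :> 'Z_(p ^ n.+1).
Proof. by rewrite /= modn_small. Qed.

Lemma padic_compat_subring : subring_closed padic_compat.
Proof.
split=> [|x y /asboolP cx /asboolP cy|x y /asboolP cx /asboolP cy];
  apply/asboolP => n.
- exact: red1.
- have -> : (x - y) n = x n - y n by [].
  have -> : (x - y) n.+1 = x n.+1 - y n.+1 by [].
  by apply/(addIr (y n)); rewrite subrK -{1}(cy n) -redD subrK cx.
- have -> : (x * y) n = x n * y n by [].
  have -> : (x * y) n.+1 = x n.+1 * y n.+1 by [].
  by rewrite -[RHS]/((x n : 'Z_(p ^ n.+1)) * y n) -(cx n) -(cy n) -redM.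
Qed.

Definition padic_int : Type := {x : dprod Zp_level | padic_compat x}.
HB.instance Definition _ := Choice.on padic_int.
HB.instance Definition _ := SubType.on padic_int.
HB.instance Definition _ := GRing.SubChoice_isSubComPzRing.Build
  (dprod Zp_level) padic_compat padic_int padic_compat_subring.

Lemma Zp_nontrivial : (1 : padic_int) != 0.
Proof.
apply/eqP => /(congr1 val)/(congr1 (fun x : dprod Zp_level => x 0%N)).
by move/eqP; rewrite (oner_eq0 'Z_(p ^ 1)).
Qed.
HB.instance Definition _ := GRing.PzSemiRing_isNonZero.Build padic_int Zp_nontrivial.
HB.instance Definition _ := GRing.ComNzRing_hasMulInverse.Build padic_int
  (@unit_invVl padic_int) (@unit_invP padic_int) (@unit_inv_out padic_int).

Definition zcoef (x : padic_int) (n : nat) : nat := nat_of_ord (val x n : 'Z_(p ^ n.+1)).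

Lemma zcoef_lt x n : (zcoef x n < p ^ n.+1)%N.
Proof. by rewrite /zcoef -[X in (_ < X)%N](Zp_cast (pow_gt1 n)) ltn_ord. Qed.

Lemma zcoef_mod x n m : (zcoef x (n + m) %% p ^ n.+1)%N = zcoef x n.
Proof.
elim: m => [|m IH]; first by rewrite addn0 modn_small // zcoef_lt.
rewrite -IH addnS; have /asboolP/(_ (n + m)%N)/(congr1 (@nat_of_ord _)) := valP x.
rewrite val_Zp_nat ?pow_gt1 // -!/(zcoef x _) => <-.
by rewrite modn_dvdm // dvdn_exp2l // ltnS leq_addr.
Qed.

Lemma zcoef_neq0 x : x != 0 -> exists n, zcoef x n != 0%N.
Proof.
move=> x0; apply: contrapT => /forallNP nx; move/eqP: x0; apply.
apply: val_inj; apply: functional_extensionality_dep => n.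
apply: ord_inj; rewrite -[LHS]/(zcoef x n) -[RHS]/0%N.
by apply: contrapT => /eqP; exact: nx.
Qed.

Lemma Zp_domain : GRing.integral_domain_axiom padic_int.
Proof.
move=> x y xy0; apply: contrapT => /negP.
rewrite negb_or => /andP[/zcoef_neq0[i xi] /zcoef_neq0[j yj]].
pose n := (i + j).+1.
have /(congr1 (fun z : padic_int => zcoef z n)) := xy0.
have ppr := prime_numP p.
have -> : zcoef (x * y) n = ((zcoef x n * zcoef y n) %% p ^ n.+1)%N.
  exact/val_ZmodM/pow_gt1.
have -> : zcoef 0 n = 0%N by [].
move/eqP => dv.
have lg (z : padic_int) l m : zcoef z l != 0%N -> (l <= m)%N ->
    (0 < zcoef z m)%N /\ (logn p (zcoef z m) <= l)%N.
  move=> zl lm; have e := zcoef_mod z l (m - l); rewrite subnKC // in e.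
  have pos : (0 < zcoef z m)%N.
    by rewrite lt0n; apply: contraNneq zl => z0; rewrite -e z0 mod0n.
  split=> //; rewrite leqNgt -pfactor_dvdn //.
  by apply: contraNN zl => /eqP h; rewrite -e h.
have [x0 xl] := lg x i n xi (leq_trans (leq_addr j i) (leqnSn _)).
have [y0 yl] := lg y j n yj (leq_trans (leq_addl i j) (leqnSn _)).
move: dv; rewrite -/(dvdn _ _) pfactor_dvdn ?muln_gt0 ?x0 // lognM //.
by rewrite leqNgt ltnS (leq_trans (leq_add xl yl)).
Qed.
HB.instance Definition _ := GRing.ComUnitRing_isIntegral.Build padic_int Zp_domain.

Definition padic : fieldType := {fraction padic_int}.
Definition Zint : set padic := range (@tofrac padic_int).

End PadicIntegers.
Arguments Zint p _ : clear implicits.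

Section Adeles.
Variable R : realType.

Definition adele_raw : comPzRingType :=
  (R * dprod (fun p : prime_num => padic p : comPzRingType))%type.

Definition is_adele : pred adele_raw :=
  fun x => `[< finite_set [set p : prime_num | ~ Zint p (x.2 p)] >].

Lemma Zint1 p : Zint p 1. Proof. by exists 1; rewrite ?rmorph1. Qed.
Lemma ZintB p x y : Zint p x -> Zint p y -> Zint p (x - y).
Proof. by move=> [a _ <-] [b _ <-]; exists (a - b); rewrite ?rmorphB. Qed.
Lemma ZintM p x y : Zint p x -> Zint p y -> Zint p (x * y).
Proof. by move=> [a _ <-] [b _ <-]; exists (a * b); rewrite ?rmorphM. Qed.

Lemma is_adele_subring : subring_closed is_adele.
Proof.
split=> [|x y /asboolP fx /asboolP fy|x y /asboolP fx /asboolP fy]; apply/asboolP.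
- rewrite (_ : [set p | _] = set0) //.
  by apply/seteqP; split=> p //= np; apply: np; exact: Zint1.
- apply: (sub_finite_set _ (B := [set p : prime_num | ~ Zint p (x.2 p)] `|`
                                [set p : prime_num | ~ Zint p (y.2 p)])).
    move=> p /= np; apply: contrapT => /not_orP[/contrapT xp /contrapT yp].
    by apply: np; exact: ZintB.
  by rewrite finite_setU.
- apply: (sub_finite_set _ (B := [set p : prime_num | ~ Zint p (x.2 p)] `|`
                                [set p : prime_num | ~ Zint p (y.2 p)])).
    move=> p /= np; apply: contrapT => /not_orP[/contrapT xp /contrapT yp].
    by apply: np; exact: ZintM.
  by rewrite finite_setU.
Qed.

Definition adele : Type := {x : adele_raw | is_adele x}.
HB.instance Definition _ := Choice.on adele.
HB.instance Definition _ := SubType.on adele.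
HB.instance Definition _ := GRing.SubChoice_isSubComPzRing.Build
  adele_raw is_adele adele is_adele_subring.

Definition adele_inf (x : adele) : R := (val x).1.
Definition adele_fin (x : adele) (p : prime_num) : padic p := (val x).2 p.

Lemma adele_nontrivial : (1 : adele) != 0.
Proof. by apply/eqP => /(congr1 adele_inf)/eqP; rewrite (oner_eq0 R). Qed.
HB.instance Definition _ := GRing.PzSemiRing_isNonZero.Build adele adele_nontrivial.
HB.instance Definition _ := GRing.ComNzRing_hasMulInverse.Build adele
  (@unit_invVl adele) (@unit_invP adele) (@unit_inv_out adele).
HB.instance Definition _ := isPointed.Build adele 0.

(* Restricted product topology: the sets (-e, e) x n Zhat form a basis of
   neighbourhoods of 0. *)
Definition adele_open : set (set adele) := fun U => forall x, U x ->
  exists (e : R) (n : nat), [/\ 0 < e, (0 < n)%N &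
    forall y, `|adele_inf y - adele_inf x| < e ->
      (forall p, exists2 z, Zint p z & adele_fin y p - adele_fin x p = n%:R * z) ->
      U y].

Definition adeleB := g_sigma_algebraType adele_open.

(* [0, 1) x Zhat, a fundamental domain for the translation action of Q. *)
Definition adele_fdom : set adele :=
  [set x | 0 <= adele_inf x < 1 /\ forall p, Zint p (adele_fin x p)].

(* The Haar measure of A for which A / Q has volume 1. *)
Definition haar_measure (mu : {measure set adeleB -> \bar R}) : Prop :=
  mu adele_fdom = 1%E /\
  forall (a : adele) (B : set adele), measurable (B : set adeleB) ->
    mu [set a + x | x in B] = mu B.

Definition cexp (t : R) : R[i] := cos (2 * pi * t) +i* sin (2 * pi * t).

(* A rational r with x_p - r in Z_p for every p, unique modulo Z: it is the sum
   of the p-adic fractional parts of x. *)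
Definition adele_frac (x : adele) : rat :=
  xget 0 [set r : rat | forall p, Zint p (adele_fin x p - ratr r)].

(* Standard character of A / Q: exp (2 pi i t) at infinity and
   exp (- 2 pi i {t}) at p. *)
Definition adele_char (x : adele) : R[i] := cexp (adele_inf x - ratr (adele_frac x)).

End Adeles.

Definition mx2 (A : pzRingType) (a b c d : A) : 'M[A]_2 :=
  \matrix_(i, j) (if i == 0 then if j == 0 then a else b
                  else if j == 0 then c else d).

Definition mx_inf (R : realType) (g : 'M[adele R]_2) : 'M[R]_2 :=
  map_mx (@adele_inf R) g.
Definition mx_fin (R : realType) (g : 'M[adele R]_2) (p : prime_num) :
    'M[padic p]_2 := map_mx (fun x => adele_fin x p) g.

Definition dirichlet_character (R : realType) (N : nat) (chi : int -> R[i]) : Prop :=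
  [/\ chi 1 = 1,
      forall a b, chi (a * b) = chi a * chi b,
      forall a, chi (a + N%:Z) = chi a
    & forall a, (chi a != 0) = coprimez a N].

Section MaassForms.
Variable R : realType.
Implicit Types (k : int) (N : nat) (chi : int -> R[i]) (f : R[i] -> R[i]).

(* The weight k action of g in GL(2, R)^+. *)
Definition slash k f (g : 'M[R]_2) (z : R[i]) : R[i] :=
  let j := (g 1 0)%:C * z + (g 1 1)%:C in
  (j / `|j|) ^ (- k) * f (((g 0 0)%:C * z + (g 0 1)%:C) / j).

Definition slashZ k f (g : 'M[int]_2) : R[i] -> R[i] := slash k f (map_mx intr g).

Definition Gamma0 N (g : 'M[int]_2) : Prop := \det g = 1 /\ (N%:Z %| g 1%R 0%R)%Z.
Definition Gamma1 N (g : 'M[int]_2) : Prop :=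
  [/\ Gamma0 N g, (g 0%R 0%R = 1 %[mod N])%Z & (g 1%R 1%R = 1 %[mod N])%Z].

Let ex : R * R := (1, 0).
Let ey : R * R := (0, 1).

Fixpoint Ck_upper (n : nat) (u : R * R -> R) : Prop :=
  (forall w, 0 < w.2 -> {for w, continuous u}) /\
  if n is m.+1 then
    [/\ forall w, 0 < w.2 -> derivable u w ex /\ derivable u w ey,
        Ck_upper m (fun w => 'D_ex u w) & Ck_upper m (fun w => 'D_ey u w)]
  else True.

Definition cpartial (v : R * R) (F : R * R -> R[i]) (w : R * R) : R[i] :=
  ('D_v (fun t => complex.Re (F t)) w) +i* ('D_v (fun t => complex.Im (F t)) w).

Definition in_coords f : R * R -> R[i] := fun w => f (w.1 +i* w.2).

Definition smooth_upper f : Prop := forall n,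
  Ck_upper n (fun w => complex.Re (in_coords f w)) /\
  Ck_upper n (fun w => complex.Im (in_coords f w)).

(* - y^2 (d^2/dx^2 + d^2/dy^2) + i k y d/dx, which commutes with [slash k]. *)
Definition laplacian k (F : R * R -> R[i]) (w : R * R) : R[i] :=
  - (w.2 ^+ 2)%:C * (cpartial ex (cpartial ex F) w + cpartial ey (cpartial ey F) w)
  + (0 +i* 1) * k%:~R * w.2%:C * cpartial ex F w.

Definition maass_form k N chi f : Prop :=
  [/\ smooth_upper f,
      forall (g : 'M[int]_2) (z : R[i]), Gamma0 N g -> 0 < complex.Im z ->
        slashZ k f g z = chi (g 1 1) * f z
    & exists lambda : R[i], forall w : R * R, 0 < w.2 ->
        laplacian k (in_coords f) w = lambda * in_coords f w].

Definition character_Gamma0 N (xi : 'M[int]_2 -> R[i]) : Prop :=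
  [/\ forall g h, Gamma0 N g -> Gamma0 N h -> xi (g *m h) = xi g * xi h,
      forall g, Gamma0 N g -> xi g != 0
    & forall g, Gamma1 N g -> xi g = 1].

Definition transforms_under_Gamma0 k f N : Prop :=
  exists2 xi, character_Gamma0 N xi &
    forall (g : 'M[int]_2) (z : R[i]), Gamma0 N g -> 0 < complex.Im z ->
      slashZ k f g z = xi g * f z.

Definition has_level k f N : Prop :=
  [/\ (0 < N)%N, transforms_under_Gamma0 k f N
    & forall m, (0 < m)%N -> transforms_under_Gamma0 k f m -> (N <= m)%N].

(* K_0(N) at p, a subgroup of GL(2, Z_p). *)
Definition padic_K0 N (p : prime_num) (g : 'M[padic p]_2) : Prop :=
  [/\ forall i j, Zint p (g i j), exists2 u, Zint p u & \det g * u = 1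
    & exists2 z, Zint p z & g 1 0 = N%:R * z].

(* By strong approximation GL(2, A) = GL(2, Q) GL(2, R)^+ prod_p K_0(N)_p, so this
   determines phi on GL(2, A).  The integer d represents the class modulo N of the
   lower right entries of the finite components; the inverse of chi d is what
   compatibility with the left invariance under Gamma_0(N) imposes. *)
Definition adelic_lift k N chi f (phi : 'M[adele R]_2 -> R[i]) : Prop :=
  forall (gQ : 'M[rat]_2) (g : 'M[adele R]_2) (d : int),
    gQ \in unitmx -> g \in unitmx ->
    0 < \det (mx_inf g) -> (forall p, padic_K0 N (mx_fin g p)) ->
    (forall p, exists2 z, Zint p z & mx_fin g p 1 1 - d%:~R = N%:R * z) ->
    phi (map_mx ratr gQ *m g) = slash k f (mx_inf g) (0 +i* 1) * (chi d)^-1.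

(* Integral over A / Q of phi ((1, u; 0, 1) g) times the conjugate of the standard
   character at u. *)
Definition whittaker (mu : {measure set (adeleB R) -> \bar R})
    (phi : 'M[adele R]_2 -> R[i]) (g : 'M[adele R]_2) : R[i] :=
  let F := fun u : adele R => phi (mx2 1 u 0 1 *m g) * adele_char (- u) in
  (\int[mu]_(u in @adele_fdom R) complex.Re (F u)) +i*
  (\int[mu]_(u in @adele_fdom R) complex.Im (F u)).

(* The product over p is finite: for given g almost all factors are 1. *)
Definition factors_as (W : 'M[adele R]_2 -> R[i]) (Winf : 'M[R]_2 -> R[i])
    (Wp : forall p : prime_num, 'M[padic p]_2 -> R[i]) : Prop :=
  forall g : 'M[adele R]_2, g \in unitmx ->
    finite_set [set p : prime_num | Wp p (mx_fin g p) != 1] /\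
    W g = Winf (mx_inf g) * \big[*%R/1]_(p \in [set: prime_num]) Wp p (mx_fin g p).

End MaassForms.

(* min (v_q x) (v_q N), where v_q 0 = +oo: the valuation of x modulo N.  Without
   this truncation the exponents in N1 could be negative (or undefined when an entry
   is 0), and cusps equivalent to 0 with v_q d > v_q N would not be excluded. *)
Definition valN (N q : nat) (x : int) : nat := logn q (gcdn N `|x|%N).

Definition excluded_prime (N : nat) (g : 'M[int]_2) (q : nat) : bool :=
  [|| valN N q (g 1 0) == logn q N, valN N q (g 1 1) == logn q N
    | (q == 2%N) && (valN N q (g 1 0) == (logn q N).-1)].

Definition N1 (N : nat) (g : 'M[int]_2) : nat :=
  (\prod_(q <- primes N | ~~ excluded_prime N g q)
     q ^ (logn q N - valN N q (g 1%R 0%R)))%N.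

Definition cuspB (R : realType) (Wp : forall p : prime_num, 'M[padic p]_2 -> R[i])
    (n : nat) (g : 'M[int]_2) (alpha : rat) : R[i] :=
  \big[*%R/1]_(q \in [set q : prime_num | (q %| n)%N])
     Wp q (mx2 (ratr alpha) 0 0 1 *m map_mx intr (invmx g)).

Definition rat_val (p : nat) (r : rat) : int :=
  (logn p `|numq r|%N)%:Z - (logn p `|denq r|%N)%:Z.

(* The sign of alpha is encoded by the boolean 0 < alpha. *)
Definition multiplicative_rat (R : realType) (h : rat -> R[i]) : Prop :=
  exists (hinf : bool -> R[i]) (hp : prime_num -> int -> R[i]),
    finite_set [set p | hp p 0 != 1] /\
    forall alpha : rat, alpha != 0 ->
      h alpha = hinf (0 < alpha) *
        \big[*%R/1]_(p \in [set: prime_num]) hp p (rat_val (prime_val p) alpha).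

(* Main.v *)
Require Import Defs.
From HB Require Import structures.
From mathcomp Require Import all_boot all_order all_algebra.
From mathcomp Require Import complex ring lra zify.
From mathcomp Require Import all_classical all_reals all_analysis.
From mathcomp Require Import measurable_realfun.

Set Implicit Arguments.
Unset Strict Implicit.
Unset Printing Implicit Defensive.

Import Order.TTheory GRing.Theory Num.Theory.
Import numFieldNormedType.Exports.

Local Open Scope classical_set_scope.
Local Open Scope ring_scope.

(* Write F|g for the slash action, n(x) and n'(y) for the upper and lower unipotent
   matrices.  If the conclusion fails, there is a prime q dividing N1 with
   v_q(24) + v_q(2cd) < v_q(N).  Take an integer u > 1 prime to N which is 1 modulo
   the prime-to-q part of N and 2 (3 if q = 2) modulo the q-part.  Evaluating the
   Whittaker function at diag(alpha e, 1) gamma^-1 for the primes dividing N1 and at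
   diag(alpha, 1) gamma^-1 elsewhere gives, for e = 1 and e = u, the Fourier
   coefficients of f|gamma and of f|tau gamma with tau = n'(y) n(x) for suitable
   integers x and y; multiplicativity of B makes these two sequences of nonconstant
   coefficients proportional.  Hence a combination D = a f|tau gamma + b f|gamma is
   invariant under all n(t), t real; as it is also invariant under n'(N), it is
   invariant under SL(2, R), and a f|n'(y) + b f is invariant under SL(2, Z).
   Conjugating by the element of Gamma_0(N) with lower right entry u turns this into
   f|n'((u^2 - 1) y) = f.  The choice of u and y makes q^v_q(N) not divide
   (u^2 - 1) y, so that f transforms under Gamma_0(N / q), against the minimality of
   the level. *)

(** * Integral p-adic numbers *)

(** Two obstacles shape the argument. Multiplicativity relates B(alpha u) to B(alpha) uniformly only
    for alpha prime to u, whereas alpha = j / N is arbitrary. But the Fourier coefficients see the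
    scaling e only through its class modulo N, so alpha may first be multiplied by some t that is 1
    modulo N and clears the primes of u. Secondly, only coefficients with j != 0 are compared, so D
    is never shown to vanish: identities for f hold modulo SL(2, Z)-invariant functions, and the
    action of lower (u^2 y), computed once by conjugation and once by iteration, removes the
    ambiguity. Origin of 24: y is (u - 1) c d times a unit at q, so (u^2 - 1) y carries the factor
    (u^2 - 1)(u - 1), which is 3 for u = 2 and 16 for u = 3. Both divide 48, and 48 c d = 24 (2 c
    d). At primes not dividing N1 no diagonal matrix compensates tau, which must itself lie in
    K_0(N); taking u = 1 modulo the prime-to-q part of N makes both requirements compatible. *)

Section PadicIntegers.
Variable p : prime_num.
Implicit Types (x y : padic_int p).

Lemma zcoefD x y n : zcoef (x + y) n = ((zcoef x n + zcoef y n) %% p ^ n.+1)%N.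
Proof.
rewrite /zcoef.
have -> : val (x + y) n = (val x n : 'Z_(p ^ n.+1)) + (val y n : 'Z_(p ^ n.+1)) by [].
by rewrite -[X in (_ %% X)%N](Zp_cast (pow_gt1 p n)).
Qed.

Lemma zcoefM x y n : zcoef (x * y) n = ((zcoef x n * zcoef y n) %% p ^ n.+1)%N.
Proof. exact: val_ZmodM (pow_gt1 p n). Qed.

Lemma zcoef_nat m n : zcoef (m%:R : padic_int p) n = (m %% p ^ n.+1)%N.
Proof.
elim: m => [|m IH]; first by rewrite mod0n.
rewrite mulrSr zcoefD IH modnDml.
have -> : zcoef (1 : padic_int p) n = 1%N by [].
by rewrite addn1.
Qed.

Lemma padic_int_ext x y : (forall n, zcoef x n = zcoef y n) -> x = y.
Proof.
move=> h; apply: val_inj; apply: functional_extensionality_dep => n.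
exact: ord_inj (h n).
Qed.

(** Only s n modulo p^(n+1) counts, so s may be any choice of representatives. *)
Lemma padic_int_lim (s : nat -> nat) :
  (forall n, s n.+1 = s n %[mod p ^ n.+1]) ->
  exists x, forall n, zcoef x n = (s n %% p ^ n.+1)%N.
Proof.
move=> hs; pose X : dprod (Zp_level p) := fun n => (s n)%:R : 'Z_(p ^ n.+1).
have cX : padic_compat X.
  apply/asboolP => n; apply: ord_inj.
  rewrite [nat_of_ord (X n.+1)]val_Zp_nat ?pow_gt1// !val_Zp_nat ?pow_gt1//.
  by rewrite modn_dvdm ?dvdn_exp2l.
exists (exist _ X cX) => n.
by rewrite /zcoef /= val_Zp_nat ?pow_gt1.
Qed.

Lemma padic_int_char0 m : (m%:R : padic_int p) = 0 -> m = 0%N.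
Proof.
move=> /(congr1 (fun x => zcoef x m)); rewrite zcoef_nat => h.
have -> // : m = (m %% p ^ m.+1)%N.
rewrite modn_small// (ltn_trans (ltnSn m))// ltn_expl// prime_gt1//.
exact: prime_numP.
Qed.

Lemma padic_int_nat_inv m : coprime m p -> exists x, m%:R * x = 1.
Proof.
move=> cmp; have pp := prime_numP p.
have m0 : (0 < m)%N.
  by rewrite lt0n; apply: contraTneq cmp => ->; rewrite /coprime gcd0n gtn_eqF ?prime_gt1.
pose s n := (egcdn m (p ^ n.+1)).1.
have sP n : (m * s n = 1 %[mod p ^ n.+1])%N.
  rewrite /s; case: egcdnP => // u v /= e _.
  have /eqP g1 : coprime m (p ^ n.+1) by rewrite coprimeXr.
  by rewrite mulnC e g1 modnMDl.
have sS n : (s n.+1 = s n %[mod p ^ n.+1])%N.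
  have e : (m * s n.+1 = 1 %[mod p ^ n.+1])%N.
    have := congr1 (fun k => k %% p ^ n.+1)%N (sP n.+1).
    by rewrite !modn_dvdm // dvdn_exp2l.
  (* Uniqueness of inverses: s(n+1) = s(n+1) m s(n) = s(n) modulo p^(n+1). *)
  rewrite -[s n.+1 in LHS]muln1 -modnMmr -(sP n) modnMmr mulnCA mulnA -modnMml e.
  by rewrite modnMml mul1n.
have [x hx] := padic_int_lim sS.
exists x; apply: padic_int_ext => n.
rewrite zcoefM zcoef_nat hx modnMm sP -(zcoef_nat 1) //.
Qed.

Lemma padic_int_divp x : zcoef x 0 = 0%N -> exists y, x = p%:R * y.
Proof.
move=> x0; have pp := prime_numP p; have p0 := prime_gt0 pp.
(* Division by p loses one digit, hence the coefficient of index n + 1. *)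
pose s n := (zcoef x n.+1 %/ p)%N.
have sS n : (s n.+1 = s n %[mod p ^ n.+1])%N.
  have := zcoef_mod x n.+1 1; rewrite addn1 => h.
  by rewrite /s modn_divl -expnSr h modn_divl -expnSr modn_small ?zcoef_lt.
have [y hy] := padic_int_lim sS.
exists y; apply: padic_int_ext => n.
rewrite zcoefM zcoef_nat hy modnMm /s mulnC divnK.
  by rewrite -(zcoef_mod x n 1) addn1.
by rewrite /dvdn -[X in (_ %% X)%N]expn1 -[n.+1]add0n zcoef_mod x0.
Qed.

End PadicIntegers.

Section PadicNumbers.
Variable p : prime_num.
Implicit Types (x y : padic p).
Local Notation Zp := (Zint p).

Lemma Zint0 : Zp 0. Proof. by exists 0; rewrite ?rmorph0. Qed.

Lemma ZintN x : Zp x -> Zp (- x).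
Proof. by move=> hx; rewrite -sub0r; exact: ZintB Zint0 hx. Qed.

Lemma ZintD x y : Zp x -> Zp y -> Zp (x + y).
Proof. by move=> hx hy; rewrite -[y]opprK; apply: ZintB => //; exact: ZintN. Qed.

Lemma Zint_nat n : Zp n%:R.
Proof. by exists n%:R; rewrite ?rmorph_nat. Qed.

Lemma Zint_int (n : int) : Zp n%:~R.
Proof. by exists n%:~R; rewrite ?rmorph_int. Qed.

Lemma padic_natr_eq0 m : ((m%:R : padic p) == 0) = (m == 0%N).
Proof.
apply/eqP/eqP => [|->]; last by [].
rewrite -(rmorph_nat (@tofrac (padic_int p))) => /eqP.
by rewrite tofrac_eq0 => /eqP/padic_int_char0.
Qed.

Lemma padic_intr_eq0 (m : int) : ((m%:~R : padic p) == 0) = (m == 0).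
Proof.
case: m => m; first by rewrite -pmulrn padic_natr_eq0.
by rewrite NegzE mulrNz oppr_eq0 -pmulrn padic_natr_eq0.
Qed.

Lemma Zint_nat_inv m : coprime m p -> Zp (m%:R)^-1.
Proof.
move=> /padic_int_nat_inv[x hx]; exists x => //.
have : (m%:R : padic p) * tofrac x = 1.
  by rewrite -(rmorph_nat (@tofrac (padic_int p))) -rmorphM hx rmorph1.
move=> h; have m0 : (m%:R : padic p) != 0.
  by apply/eqP => m0; move/eqP: h; rewrite m0 mul0r eq_sym oner_eq0.
by apply: (mulfI m0); rewrite h mulfV.
Qed.

Lemma Zint_residue x : Zp x ->
  exists2 i, (i < p)%N & exists2 z, Zp z & x - i%:R = p%:R * z.
Proof.
have pp := prime_numP p.
move=> [u _ <-]; exists (zcoef u 0); first by have := zcoef_lt u 0; rewrite expn1.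
have [|y hy] := @padic_int_divp p (u - (zcoef u 0)%:R).
  have := zcoefD (u - (zcoef u 0)%:R) (zcoef u 0)%:R 0.
  rewrite subrK zcoef_nat expn1 modnDmr => h.
  have := zcoef_lt (u - (zcoef u 0)%:R) 0; rewrite expn1.
  have := zcoef_lt u 0; rewrite expn1.
  move: h; set a := zcoef _ 0; set b := zcoef _ 0 => h ap bp.
  case: (ltnP (b + a) p) => [l|l].
    by move: h; rewrite modn_small //; lia.
  have e : (b + a = (b + a - p) + p)%N by rewrite subnK.
  move: h; rewrite e modnDr modn_small; first by move: ap bp l; clear; lia.
  by move: ap bp l; clear; lia.
exists (tofrac y); first by exists y.
by rewrite -!(rmorph_nat (@tofrac (padic_int p))) -rmorphB hy rmorphM.
Qed.

Lemma Zint_dvdn J n z : (0 < J)%N -> Zp z -> n%:R = J%:R * z ->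
  (p ^ logn p J %| n)%N.
Proof.
move=> J0 [u _ <-]; have pp := prime_numP p.
rewrite -!(rmorph_nat (@tofrac (padic_int p))) -rmorphM => /eqP.
rewrite tofrac_eq => /eqP h.
case e : (logn p J) => [|v]; first by rewrite expn0 dvd1n.
(* Here the valuation of J is v + 1, and [zcoef] at index v is reduction modulo p^(v+1). *)
have := congr1 (fun y : padic_int p => zcoef y v) h; rewrite zcoefM !zcoef_nat modnMml.
have := pfactor_dvdnn p J; rewrite e => /dvdnP[k ->].
by rewrite mulnAC modnMl => /eqP.
Qed.

End PadicNumbers.

Lemma dvdn_padic J n : (0 < J)%N ->
  (forall p, exists2 z, Zint p z & (n%:R : padic p) = J%:R * z) -> (J %| n)%N.
Proof.
move=> J0 h; case: (posnP n) => [->|n0]; first exact: dvdn0.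
apply/dvdn_partP => // q; rewrite mem_primes => /and3P[pq _ _].
have [z Zz e] := h (exist (fun p => prime p) q pq : prime_num).
by rewrite p_part; exact: (Zint_dvdn J0 Zz e).
Qed.

Lemma dvdz_padic J (n : int) : (0 < J)%N ->
  (forall p, exists2 z, Zint p z & (n%:~R : padic p) = J%:R * z) -> (J%:Z %| n)%Z.
Proof.
move=> J0 h; rewrite /dvdz /=; apply: dvdn_padic => // p.
have [z Zz e] := h p; case: n e {h} => n; first by exists z.
rewrite NegzE mulrNz => e; exists (- z); first exact: ZintN.
by rewrite mulrN -e opprK.
Qed.

Lemma rat_Zint (r : rat) : (forall p, Zint p (ratr r)) -> exists m : int, r = m%:~R.
Proof.
move=> h; have d0 : (0 < `|denq r|)%N by rewrite absz_gt0 denq_neq0.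
have : (`|denq r|%N%:Z %| numq r)%Z.
  apply: dvdz_padic => // p; exists (ratr r) => //.
  rewrite /ratr -(gez0_abs (m := denq r)) //.
  by rewrite -pmulrn mulrC divfK // padic_natr_eq0 -lt0n.
rewrite -[(_ %| _)%Z]/(`|denq r| %| `|numq r|)%N => dv.
have /eqP c := coprime_num_den r.
have d1 : `|denq r|%N = 1%N.
  by have := dvdn_gcd `|denq r| `|numq r| `|denq r|; rewrite dv dvdnn c dvdn1 => /eqP.
exists (numq r); rewrite -[LHS]divq_num_den -(gez0_abs (m := denq r)) // d1.
by rewrite divr1.
Qed.

Lemma Zint_prime_inv (p q : prime_num) : q != p -> Zint p (q%:R)^-1.
Proof.
move=> qp; apply: Zint_nat_inv; rewrite prime_coprime ?prime_numP //.
rewrite dvdn_prime2 ?prime_numP // eq_sym.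
Qed.

(** Induction on J, one prime factor q at a time: the residue modulo J / q is corrected by a digit
    at the single prime q, since q is a unit at every other prime. *)
Lemma Zhat_residue (J : nat) (v : forall p, padic p) : (0 < J)%N ->
  (forall p, Zint p (v p)) ->
  exists2 i, (i < J)%N & forall p, exists2 z, Zint p z & v p - i%:R = J%:R * z.
Proof.
elim/(@ltn_ind) : J v => J IH v J0 hv.
case: (leqP J 1) => J1.
  have -> : J = 1%N by apply/eqP; rewrite eqn_leq J1.
  by exists 0%N => // p; exists (v p) => //; rewrite subr0 mul1r.
pose q : prime_num := exist (fun p => prime p) (pdiv J) (pdiv_prime J1).
have qJ : (q %| J)%N by exact: pdiv_dvd.
have q0 : (0 < q)%N by apply: prime_gt0; exact: prime_numP.
have e : J = (J %/ q * q)%N by rewrite divnK.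
have J'0 : (0 < J %/ q)%N by rewrite divn_gt0// dvdn_leq.
have [|i iJ hi] := IH (J %/ q)%N _ v J'0 hv.
  by rewrite ltn_Pdiv// prime_gt1// prime_numP.
have [Zw ew] : (forall p, Zint p ((v p - i%:R) / (J %/ q)%:R)) /\
    forall p, v p - i%:R = (J %/ q)%:R * ((v p - i%:R) / (J %/ q)%:R).
  have nz p : ((J %/ q)%:R : padic p) != 0 by rewrite padic_natr_eq0 -lt0n.
  by split=> p; have [z Zz ez] := hi p; rewrite ez mulrAC mulfV ?mul1r.
move: Zw ew; set w := fun p => (v p - i%:R) / (J %/ q)%:R => Zw ew.
have [j jq [z Zz ez]] := Zint_residue (Zw q).
exists (i + J %/ q * j)%N.
  rewrite [X in (_ < X)%N]e (@leq_trans (J %/ q * j.+1)%N) ?leq_mul2l ?jq ?orbT//.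
  by rewrite mulnS ltn_add2r.
move=> p; have [y Zy ey] : exists2 y, Zint p y & w p - j%:R = q%:R * y.
  have [->|pq] := eqVneq p q; first by exists z.
  have nq : (q%:R : padic p) != 0 by rewrite padic_natr_eq0 -lt0n.
  exists ((w p - j%:R) / q%:R); last by rewrite mulrC divfK.
  apply: ZintM; last by apply: Zint_prime_inv; rewrite eq_sym.
  by apply: ZintB; [exact: Zw | exact: Zint_nat].
exists y => //; rewrite natrD natrM opprD addrA ew -mulrBr ey.
by rewrite mulrA -natrM -e.
Qed.

(** * Components of adeles *)

Section RatrMorphism.
Variable A : comUnitRingType.
Hypothesis intr_unit : forall d : int, d != 0 -> (d%:~R : A) \is a GRing.unit.

(** The adeles do not form a field, but nonzero integers are units there, and this suffices for
    [ratr] to be a ring morphism. *)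
Lemma ratr_div (a b : int) : b != 0 -> ratr (a%:~R / b%:~R : rat) = a%:~R / b%:~R :> A.
Proof.
move=> b0; set r : rat := _ / _.
have e : numq r * b = a * denq r.
  apply: (@intr_inj rat); rewrite !intrM numqE mulrAC /r divfK //.
  by rewrite intr_eq0.
rewrite /ratr; apply: (mulIr (intr_unit b0)); rewrite divrK ?intr_unit//.
apply: (mulIr (intr_unit (denq_neq0 r))).
by rewrite mulrAC divrK ?intr_unit ?denq_neq0// -!intrM e.
Qed.

Lemma rat_intP (r : rat) : exists a b : int, b != 0 /\ r = a%:~R / b%:~R.
Proof. by exists (numq r), (denq r); rewrite denq_neq0 divq_num_den. Qed.

Lemma ratrM_unit (r s : rat) : ratr (r * s) = ratr r * ratr s :> A.
Proof.
have [a [b [b0 ->]]] := rat_intP r; have [c [d [d0 ->]]] := rat_intP s.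
rewrite mulf_div -!intrM !ratr_div ?mulf_neq0// !intrM invrM ?intr_unit//.
by rewrite [_^-1 * _]mulrC mulrACA.
Qed.

Lemma ratrD_unit (r s : rat) : ratr (r + s) = ratr r + ratr s :> A.
Proof.
have [a [b [b0 ->]]] := rat_intP r; have [c [d [d0 ->]]] := rat_intP s.
rewrite addf_div ?intr_eq0// -!intrM -intrD !ratr_div ?mulf_neq0//.
apply: (mulIr (intr_unit (mulf_neq0 b0 d0))).
rewrite divrK ?intr_unit ?mulf_neq0// mulrDl intrD !intrM.
rewrite mulrA divrK ?intr_unit// [b%:~R * _]mulrC mulrA divrK ?intr_unit//.
Qed.

Lemma map_ratr_mulmx m n k (M : 'M[rat]_(m, n)) (K : 'M[rat]_(n, k)) :
  map_mx (ratr : rat -> A) (M *m K) = map_mx ratr M *m map_mx ratr K.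
Proof.
apply/matrixP => i j; rewrite !mxE.
have r0 : ratr 0 = 0 :> A by rewrite (ratr_int _ 0).
elim/big_rec2: _ => // l x y _ <-.
by rewrite ratrD_unit ratrM_unit !mxE.
Qed.

Lemma rmorph_ratr (B : comUnitRingType) (f : {rmorphism A -> B}) (r : rat) :
  f (ratr r) = ratr r.
Proof. by rewrite /ratr rmorphM (rmorphV f) ?intr_unit ?denq_neq0// !(rmorph_int f). Qed.

End RatrMorphism.

Lemma padic_intr_unit p (d : int) : d != 0 -> (d%:~R : padic p) \is a GRing.unit.
Proof. by move=> d0; rewrite unitfE padic_intr_eq0. Qed.

Section AdeleComponents.
Variable R : realType.

Lemma adele_inf_zmod : zmod_morphism (@adele_inf R). Proof. by []. Qed.
Lemma adele_inf_monoid : monoid_morphism (@adele_inf R). Proof. by []. Qed.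
HB.instance Definition _ :=
  GRing.isZmodMorphism.Build (adele R) R (@adele_inf R) adele_inf_zmod.
HB.instance Definition _ :=
  GRing.isMonoidMorphism.Build (adele R) R (@adele_inf R) adele_inf_monoid.

(** [adele_fin] with the prime first, so that each partial application can be declared a ring
    morphism. *)
Definition adele_at p (x : adele R) : padic p := adele_fin x p.
Lemma adele_at_zmod p : zmod_morphism (@adele_at p). Proof. by []. Qed.
Lemma adele_at_monoid p : monoid_morphism (@adele_at p). Proof. by []. Qed.
HB.instance Definition _ p :=
  GRing.isZmodMorphism.Build (adele R) (padic p) (@adele_at p) (adele_at_zmod p).
HB.instance Definition _ p :=
  GRing.isMonoidMorphism.Build (adele R) (padic p) (@adele_at p) (adele_at_monoid p).

Lemma adele_ext (x y : adele R) : adele_inf x = adele_inf y ->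
  (forall p, adele_at p x = adele_at p y) -> x = y.
Proof.
move=> h1 h2; apply: val_inj; rewrite [val x]surjective_pairing [val y]surjective_pairing.
by congr (_, _) => //; apply: functional_extensionality_dep.
Qed.

Lemma adele_of (r : R) (x : forall p, padic p) :
  finite_set [set p : prime_num | ~ Zint p (x p)] ->
  exists a : adele R, adele_inf a = r /\ forall p, adele_at p a = x p.
Proof.
move=> h; have ha : is_adele ((r, x) : adele_raw R) by apply/asboolP.
by exists (Sub _ ha : adele R).
Qed.

Lemma finite_prime_num (P : prime_num -> Prop) n :
  (forall p, P p -> (p <= n)%N) -> finite_set [set p | P p].
Proof.
move=> h; apply: (sub_finite_set (B := prime_val @^-1` `I_n.+1)).
  by move=> p /h.
apply: finite_preimage; last exact: finite_II.
by move=> p q _ _ e; apply: val_inj.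
Qed.

Lemma adele_unit (a : adele R) : adele_inf a != 0 -> (forall p, adele_at p a != 0) ->
  finite_set [set p : prime_num | ~ Zint p (adele_at p a)^-1] ->
  a \is a GRing.unit.
Proof.
move=> a0 ap fa; have [b [b0 bp]] := adele_of (adele_inf a)^-1 fa.
apply/unitrPr; exists b; apply: adele_ext; first by rewrite (rmorphM (@adele_inf R)) /= b0 mulfV ?rmorph1.
by move=> p; rewrite (rmorphM (@adele_at p)) /= bp mulfV ?rmorph1.
Qed.

Lemma adele_intr_unit (d : int) : d != 0 -> (d%:~R : adele R) \is a GRing.unit.
Proof.
move=> d0; apply: adele_unit; first by rewrite rmorph_int intr_eq0.
  by move=> p; rewrite rmorph_int padic_intr_eq0.
apply: (@finite_prime_num _ `|d|%N) => p np; apply: dvdn_leq; first by rewrite absz_gt0.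
apply: contrapT => /negP pd; apply: np; rewrite rmorph_int.
have := @Zint_nat_inv p `|d|%N; rewrite coprime_sym prime_coprime ?prime_numP// => /(_ pd).
case: (d) => //= n; rewrite NegzE mulrNz invrN => h; exact: ZintN.
Qed.

End AdeleComponents.

(** * Integration over the fundamental domain *)

(** Cauchy's equation for monotone functions. With k the integer part of n x, both n phi(x) and n x
    phi(1) lie between k phi(1) and (k + 1) phi(1), so phi(x) and x phi(1) differ by at most phi(1)
    / n. *)
Lemma additive_linear (R : realType) (phi : R -> R) :
  (forall x y, 0 <= x -> 0 <= y -> phi (x + y) = phi x + phi y) ->
  (forall x y, 0 <= x -> x <= y -> phi x <= phi y) ->
  forall x, 0 <= x -> phi x = x * phi 1.
Proof.
move=> add mono x x0.
have phi0 : phi 0 = 0 by have := add 0 0 (lexx _) (lexx _); rewrite addr0; lra.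
have muln n y : 0 <= y -> phi (n%:R * y) = n%:R * phi y.
  move=> y0; elim: n => [|n IH]; first by rewrite !mul0r.
  by rewrite !mulrSr !mulrDl !mul1r add ?mulr_ge0// IH.
have phi1 : 0 <= phi 1 by rewrite -phi0; exact: mono.
apply/eqP; rewrite -subr_eq0 -normr_le0; apply/ler_addgt0Pl => e e0; rewrite addr0.
pose n := (Num.truncn (phi 1 / e)).+1.
have n0 : 0 < n%:R :> R by rewrite ltr0n.
have ne : phi 1 < n%:R * e.
  by rewrite -ltr_pdivrMr//; exact: truncnS_gt.
pose k := Num.truncn (n%:R * x).
have nx0 : 0 <= n%:R * x by rewrite mulr_ge0.
have k1 : k%:R <= n%:R * x by have /andP[] := truncn_itv nx0.
have k2 : n%:R * x <= k.+1%:R by apply/ltW/truncnS_gt.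
have a1 : k%:R * phi 1 <= n%:R * phi x.
  by rewrite -!muln// mono// mulr1.
have a2 : n%:R * phi x <= k.+1%:R * phi 1.
  by rewrite -!muln// mono// mulr1.
have b1 : k%:R * phi 1 <= n%:R * x * phi 1 by rewrite ler_wpM2r.
have b2 : n%:R * x * phi 1 <= k.+1%:R * phi 1 by rewrite ler_wpM2r.
rewrite -(ler_pM2l n0) -[X in X * `|_|](gtr0_norm n0) -normrM ler_norml.
have k3 : k.+1%:R = k%:R + 1 :> R by rewrite mulrSr.
rewrite k3 mulrDl mul1r in a2; rewrite k3 mulrDl mul1r in b2.
rewrite mulrBr mulrA; move: a1 a2 b1 b2 ne; clear.
move: (n%:R * phi x) (k%:R * _) (n%:R * x * _) (n%:R * e) => *.
by apply/andP; split; lra.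
Qed.

Lemma integral_mscale d (T : measurableType d) (R : realType)
    (m : {measure set T -> \bar R}) (D : set T) (k : {nonneg R}) (f : T -> \bar R) :
  measurable D -> m.-integrable D f ->
  (\int[mscale k m]_(x in D) f x = k%:num%:E * \int[m]_(x in D) f x)%E.
Proof.
move=> mD intf; have mf := measurable_int m intf.
rewrite [in RHS]integralE muleBr//; last first.
  by rewrite fin_num_adde_defl// fin_numN integrable_neg_fin_num.
rewrite [LHS]integralE !ge0_integral_mscale//; [exact: measurable_funeneg|exact: measurable_funepos].
Qed.

Lemma continuous_itv_bounded (R : realType) (phi : R -> R) (a b : R) :
  continuous phi -> exists M, forall t, t \in `[a, b] -> `|phi t| <= M.
Proof.
move=> cphi; have [ab|ba] := leP a b; last first.
  by exists 0 => t; rewrite in_itv /= => /andP[h1 h2]; lra.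
have [|c _ hc] := @EVT_max R (fun t => `|phi t|) a b ab.
  apply: continuous_subspaceT => t; apply: continuous_comp; first exact: cphi.
  exact: norm_continuous.
by exists `|phi c|.
Qed.

Lemma continuous_itv_integrable (R : realType) (phi : R -> R) (b0 b1 : bool) (a b : R) :
  continuous phi ->
  (@lebesgue_measure R).-integrable [set` Interval (BSide b0 a) (BSide b1 b)] (EFin \o phi).
Proof.
move=> cphi; have h : (@lebesgue_measure R).-integrable `[a, b] (EFin \o phi).
  apply: continuous_compact_integrable; first exact: segment_compact.
  exact: continuous_subspaceT.
apply: integrableS h => //; try exact: measurable_itv.
move=> t /=; rewrite !in_itv /=.
by case: b0; case: b1 => /= /andP[h1 h2]; rewrite ?h1 ?h2 ?(ltW h1) ?(ltW h2).
Qed.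

Lemma Rintegral_subdivision (R : realType) (phi : R -> R) (delta : R) n :
  continuous phi -> 0 <= delta ->
  \sum_(i < n) \int[lebesgue_measure]_(t in `[i%:R * delta, i.+1%:R * delta]) phi t =
  \int[lebesgue_measure]_(t in `[0, n%:R * delta]) phi t.
Proof.
move=> cphi d0; elim: n => [|n IH].
  by rewrite big_ord0 mul0r set_itv1 Rintegral_set1.
have le1 : n%:R * delta <= n.+1%:R * delta by rewrite ler_wpM2r// ler_nat.
have n0 : 0 <= n%:R * delta by rewrite mulr_ge0.
rewrite big_ord_recr /= IH.
rewrite -(Rintegral_itv_obnd_cbnd (r := n%:R * delta)); last exact: continuous_itv_integrable.
rewrite -(@Rintegral_itvB R phi (BLeft 0) (BRight (n.+1%:R * delta)) (n%:R * delta)).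
- by rewrite addrC subrK.
- exact: continuous_itv_integrable.
- by rewrite bnd_simp.
- by rewrite bnd_simp.
Qed.

(** * Haar measure of boxes, and reduction to Lebesgue integrals *)

Section HaarMeasure.
Variable R : realType.
Implicit Types (J : nat) (I : set R).

Definition residue_class J (i : int) : set (adele R) :=
  [set v | forall p, exists2 z, Zint p z & adele_at p v - i%:~R = J%:R * z].

(** The box I x (i + J Zhat). Translation invariance and the normalisation of the fundamental domain
    determine its measure, |I| / J. *)
Definition slab J i I : set (adele R) := residue_class J i `&` (@adele_inf R @^-1` I).

Lemma measurable_adele_inf : measurable_fun [set: adeleB R] (@adele_inf R : adeleB R -> R).
Proof.
move=> mD; apply: (measurability _ (RGenOInfty.measurableE R)) => //.
move=> _ [_ [x ->] <-]; rewrite setTI; apply: sub_sigma_algebra.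
move=> v /=; rewrite in_itv /= andbT => xv.
exists (adele_inf v - x), 1%N; split=> //; first by rewrite subr_gt0.
move=> y yv _; rewrite /= in_itv /= andbT.
by move: yv; rewrite ltr_norml => /andP[h _]; lra.
Qed.

Lemma measurable_residue_class J i : (0 < J)%N ->
  measurable (residue_class J i : set (adeleB R)).
Proof.
move=> J0; apply: sub_sigma_algebra => v vi; exists 1, J; split=> // y _ yv p.
have [z Zz ez] := vi p; have [w Zw ew] := yv p.
exists (w + z); first exact: ZintD.
by rewrite mulrDr -ez -ew addrA subrK.
Qed.

Lemma measurable_slab J i I : (0 < J)%N -> measurable I ->
  measurable (slab J i I : set (adeleB R)).
Proof.
move=> J0 mI; apply: measurableI; first exact: measurable_residue_class.
by rewrite -[X in measurable X]setTI; exact: measurable_adele_inf.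
Qed.

Lemma adele_const (r : R) (k : int) :
  exists a : adele R, adele_inf a = r /\ forall p, adele_at p a = k%:~R.
Proof.
apply: (@adele_of R r (fun p => k%:~R)); rewrite (_ : [set p | _] = set0) //.
by apply/seteqP; split=> p //= h; apply: h; exact: Zint_int.
Qed.

Variable mu : {measure set (adeleB R) -> \bar R}.
Hypothesis hmu : haar_measure mu.

(** The translating adele has real component r and component k at every prime, so the interval and
    the class move independently. *)
Lemma slab_translate J i k I (r : R) : (0 < J)%N -> measurable I ->
  mu (slab J (i + k) [set t | I (t - r)]) = mu (slab J i I).
Proof.
move=> J0 mI; have [a [ar ak]] := adele_const r k.
rewrite -[in RHS](hmu.2 a); last exact: measurable_slab.
congr (mu _); apply/seteqP; split=> [v [vi vI]|_ [v [vi vI] <-]].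
  exists (v - a); last by rewrite addrC subrK.
  split=> [p|] /=; last by rewrite (rmorphB (@adele_inf R)) /= ar.
  rewrite (rmorphB (@adele_at R p)) /= ak.
  by have [z Zz ez] := vi p; exists z => //; rewrite -ez intrD opprD addrA addrAC.
split=> [p|] /=.
  rewrite (rmorphD (@adele_at R p)) /= ak.
  by have [z Zz ez] := vi p; exists z => //; rewrite -ez intrD opprD addrA addrAC [k%:~R + _]addrC addrK.
by rewrite (rmorphD (@adele_inf R)) /= ar addrAC subrr add0r.
Qed.

Lemma residue_class_inj J i1 i2 v : (0 < J)%N ->
  residue_class J i1 v -> residue_class J i2 v -> (J%:Z %| i1 - i2)%Z.
Proof.
move=> J0 h1 h2; apply: dvdz_padic => // p.
have [z1 Z1 e1] := h1 p; have [z2 Z2 e2] := h2 p.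
exists (z2 - z1); first exact: ZintB.
by rewrite mulrBr -e1 -e2 intrB; ring.
Qed.

Lemma slab_trivIset J (i0 : int) I : (0 < J)%N ->
  trivIset [set: 'I_J] (fun i : 'I_J => slab J (i%:Z + i0) I).
Proof.
move=> J0; apply/trivIsetP => i j _ _ ij; apply/seteqP; split=> // v [[vi _] [vj _]].
exfalso; move/eqP: ij; apply; apply/val_inj.
have := residue_class_inj J0 vi vj; rewrite opprD addrACA subrr addr0 -eqz_mod_dvd.
by move=> /eqP; rewrite !modz_nat !modn_small// => -[].
Qed.

(** The offset lets any J consecutive integers represent the classes; [integral_adele_fdom] chooses
    it according to the sign of j. *)
Lemma fdom_slabs J (i0 : int) : (0 < J)%N ->
  @adele_fdom R = \big[setU/set0]_(i < J) slab J (i%:Z + i0) `[0, 1[%classic.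
Proof.
move=> J0; rewrite -(bigcup_mkord J (fun i : nat => slab J (i%:Z + i0)%R _)); apply/seteqP; split=> [v [v01 vZ]|v].
  have Zv p : Zint p (adele_at p v - i0%:~R) by apply: ZintB; [exact: vZ | exact: Zint_int].
  have [i iJ hi] := @Zhat_residue J (fun p => adele_at p v - i0%:~R) J0 Zv.
  exists i => //; split=> [p|]; last by rewrite /= in_itv.
  have [z Zz ez] := hi p; exists z => //; rewrite -ez intrD -pmulrn opprD addrA addrAC //.
move=> [i /= iJ [vi]]; rewrite /= in_itv /= => v01; split=> // p.
have [z Zz ez] := vi p; rewrite -[adele_fin v p](subrK (i%:Z + i0)%:~R).
apply: ZintD; last exact: Zint_int.
by rewrite -[adele_fin v p]/(adele_at p v) ez; apply: ZintM => //; exact: Zint_nat.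
Qed.

Lemma slab_shift J i (a b r : R) : (0 < J)%N ->
  mu (slab J i `[a, b[%classic) = mu (slab J 0 `[a + r, b + r[%classic).
Proof.
move=> J0; rewrite -(@slab_translate J 0 i _ (- r))//; congr (mu (slab _ _ _)).
  by rewrite add0r.
apply/seteqP; split=> t /=; rewrite !in_itv /= opprK => /andP[h1 h2]; apply/andP; split; lra.
Qed.

Lemma slab_itv_unit J : (0 < J)%N -> mu (slab J 0 `[0, 1[%classic) = (J%:R^-1)%:E.
Proof.
move=> J0; have Jr : (J%:R : R) != 0 by rewrite pnatr_eq0 -lt0n.
have h : (\sum_(i < J) mu (slab J (i%:Z + 0) `[0%R, 1%R[%classic) = 1)%E.
  rewrite -hmu.1 (fdom_slabs 0 J0) measure_bigsetU_ord//.
    by move=> i; exact: measurable_slab.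
  exact: slab_trivIset.
have {}h : (\sum_(i < J) mu (slab J 0 `[0%R, 1%R[%classic) = 1)%E.
  by rewrite -h; apply: eq_bigr => i _; rewrite [in RHS](@slab_shift J _ 0 1 0 J0) !addr0.
have fin : mu (slab J 0 `[0, 1[%classic) \is a fin_num.
  rewrite ge0_fin_numE ?measure_ge0//; apply: (@le_lt_trans _ _ 1%E); last exact: ltry.
  rewrite -hmu.1; apply: le_measure; rewrite ?inE; first exact: measurable_slab.
    rewrite (fdom_slabs 0 J0); apply: bigsetU_measurable => i _; exact: measurable_slab.
  rewrite (fdom_slabs 0 J0) -(bigcup_mkord J (fun i : nat => slab J (i%:Z + 0)%R _)).
  by move=> v hv; exists 0%N.
move: h; rewrite -(fineK fin) sumEFin sumr_const card_ord => -[] h.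
by congr EFin; apply: (mulfI Jr); rewrite mulfV// mulr_natl.
Qed.

(** As a function of x, the measure of the slab over [0, x[ is additive by translation invariance,
    and monotone, hence linear; its value at 1 is [slab_itv_unit]. *)
Lemma slab_co J i (a b : R) : (0 < J)%N -> a <= b ->
  mu (slab J i `[a, b[%classic) = ((b - a) / J%:R)%:E.
Proof.
move=> J0 ab; have mS I := @measurable_slab J 0 I J0.
pose e x := mu (slab J 0 `[0, x[%classic).
have e1 : e 1 = (J%:R^-1)%:E by exact: slab_itv_unit.
have addE (x y : R) : 0 <= x -> 0 <= y -> e (x + y) = (e x + e y)%E.
  move=> x0 y0; rewrite {3}/e (@slab_shift J 0 0 y x J0) add0r [y + x]addrC.
  rewrite /e -measureU; [|exact: mS|exact: mS|].
    congr (mu _); apply/seteqP; split=> [v [v0]|v [[v0]|[v0]]] /=; rewrite !in_itv /=.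
    - move=> /andP[h1 h2]; case: (ltP (adele_inf v) x) => h; [left|right];
        split=> //=; rewrite in_itv /=; by apply/andP.
    - by move=> /andP[h1 h2]; split=> //=; rewrite in_itv /= h1/=; lra.
    - by move=> /andP[h1 h2]; split=> //=; rewrite in_itv /= h2 andbT; lra.
  apply/seteqP; split=> // v [[_]] /=; rewrite !in_itv /= => /andP[_ h] [_] /=.
  by rewrite !in_itv /= => /andP[h2 _]; lra.
have monoE (x y : R) : x <= y -> (e x <= e y)%E.
  move=> xy; apply: le_measure; rewrite ?inE; [exact: mS|exact: mS|].
  move=> v [v0] /=; rewrite !in_itv /= => /andP[h1 h2]; split=> //=.
  by rewrite in_itv /= h1/=; lra.
have fin (x : R) : e x \is a fin_num.
  rewrite ge0_fin_numE ?measure_ge0//.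
  have [n hn] : exists n : nat, x <= n%:R.
    by exists (Num.truncn x).+1; apply/ltW/truncnS_gt.
  apply: (le_lt_trans (monoE _ _ hn)); elim: n {hn} => [|n IH].
    rewrite /e (_ : slab _ _ _ = set0) ?measure0// ?ltry//.
    by apply/seteqP; split=> // v [_] /=; rewrite in_itv /= => /andP[h1 h2]; lra.
  by rewrite mulrSr addE// e1 lte_add_pinfty// ltry.
pose phi (x : R) := fine (e x).
have lin : phi (b - a) = (b - a) * phi 1.
  apply: additive_linear => [x y x0 y0|x y x0 xy|]; last by rewrite subr_ge0.
    by rewrite /phi addE// fineD.
  by rewrite /phi fine_le// monoE.
have -> : mu (slab J i `[a, b[%classic) = e (b - a).
  by rewrite (@slab_shift J i a b (- a) J0) subrr.
by rewrite -(fineK (fin _)) -/(phi _) lin /phi e1.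
Qed.

(** End points are negligible: compare with [a, b + e J[ from above, and cover [a, b[ by ]a, b] and
    [a, a + e J[ from below. Lebesgue measure is characterised on intervals ]a, b], whose preimages
    under a decreasing affine map are closed on the left; hence both kinds of interval. *)
Lemma slab_oc J i (a b : R) : (0 < J)%N -> a <= b ->
  mu (slab J i `]a, b]%classic) = ((b - a) / J%:R)%:E.
Proof.
move=> J0 ab; have mS I := @measurable_slab J i I J0.
have Jr : (0 : R) < J%:R by rewrite ltr0n.
apply/le_anti/andP; split; apply/lee_addgt0Pr => e e0.
  have e1 : 0 < e * J%:R by rewrite mulr_gt0.
  rewrite -EFinD (_ : _ + e = (b + e * J%:R - a) / J%:R); last first.
    by field; rewrite gt_eqF.
  rewrite -(@slab_co J i a)//; last by lra.
  apply: le_measure; rewrite ?inE; [exact: mS|exact: mS|].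
  move=> v [v0] /=; rewrite !in_itv /= => /andP[h1 h2]; split=> //=.
  by rewrite in_itv /= ltW//=; lra.
have e1 : 0 < e * J%:R by rewrite mulr_gt0.
have ee : ((a + e * J%:R - a) / J%:R)%:E = e%:E.
  by congr EFin; field; rewrite gt_eqF.
rewrite -(@slab_co J i a b J0 ab) -ee -(@slab_co J i a (a + _) J0); last by lra.
apply: (le_trans _ (measureU2 _ _ _)); [|exact: mS|exact: mS].
apply: le_measure; rewrite ?inE; [exact: mS|apply: measurableU; exact: mS|].
move=> v [v0] /=; rewrite !in_itv /= => /andP[h1 h2].
case: (ltP a (adele_inf v)) => h; [left|right]; split=> //=; rewrite in_itv /=.
  by rewrite h ltW.
by apply/andP; split; lra.
Qed.

Section SlabPushforward.
Variables (J : nat) (i : int) (c s : R).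
Hypotheses (J0 : (0 < J)%N) (c0 : c != 0).

Let L : adeleB R -> measurableTypeR R := fun v => c * (adele_inf v + s).

Let mL : measurable_fun [set: adeleB R] L.
Proof.
by apply: measurable_funM => //; apply: measurable_funD => //; exact: measurable_adele_inf.
Qed.

Let mcls : measurable (residue_class J i : set (adeleB R)) := measurable_residue_class i J0.

Let nu : {measure set (measurableTypeR R) -> \bar R} :=
  measure_function_pushforward__canonical__measure_function_Measure (mrestr mu mcls) mL.

Let k : {nonneg R} := NngNum (mulr_ge0 (normr_ge0 c) (ler0n R J)).

Let nuE (B : set R) : nu B = mu (slab J i [set t | B (c * (t + s))]).
Proof. by rewrite /nu /= /pushforward /mrestr setIC. Qed.

(** The affine image of Haar measure on one residue class is Lebesgue measure divided by |c| J; by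
    uniqueness it is enough to test intervals ]a, b]. *)
Let lebesgue_nu (B : set R) : measurable B -> lebesgue_measure B = mscale k nu B.
Proof.
have Jr : 0 < J%:R :> R by rewrite ltr0n.
apply: lebesgue_measure_unique => _ [[a b] /= _ <-].
rewrite /mscale /= -/nu -[pushforward _ _ _]/(nu _) nuE lebesgue_measure_itv /= lte_fin.
have [ab|ba] := ltP a b; last first.
  rewrite (_ : slab _ _ _ = set0) ?measure0 ?mule0//.
  by apply/seteqP; split=> // v [_] /=; rewrite in_itv /= => /andP[h1 h2]; lra.
have [cp|cn] := ltP 0 c.
  rewrite (_ : [set t | _] = `]a / c - s, b / c - s]%classic); last first.
    apply/seteqP; split=> t /=; rewrite !in_itv /=.
      by rewrite ltrBlDr lerBrDr ltr_pdivrMr// ler_pdivlMr// ![_ * c]mulrC.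
    by rewrite ltrBlDr lerBrDr ltr_pdivrMr// ler_pdivlMr// ![_ * c]mulrC.
  rewrite slab_oc//; last by rewrite lerD2r ler_pM2r ?invr_gt0// ltW.
  by rewrite -EFinM -EFinB gtr0_norm//; congr EFin; field; rewrite c0 gt_eqF.
have {}cn : c < 0 by rewrite lt_neqAle c0.
rewrite (_ : [set t | _] = `[b / c - s, a / c - s[%classic); last first.
  apply/seteqP; split=> t /=; rewrite !in_itv /=.
    by rewrite lerBlDr ltrBrDr ler_ndivrMr// ltr_ndivlMr// ![_ * c]mulrC andbC.
  by rewrite lerBlDr ltrBrDr ler_ndivrMr// ltr_ndivlMr// ![_ * c]mulrC andbC.
rewrite slab_co//; last by rewrite lerD2r ler_nM2r ?invr_lt0// ltW.
by rewrite -EFinM -EFinB ltr0_norm//; congr EFin; field; rewrite c0 gt_eqF.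
Qed.

Lemma integral_slab (D : set R) (phi : R -> R) (M : R) :
  measurable D -> (lebesgue_measure D < +oo)%E ->
  measurable_fun [set: R] phi -> (forall t, D t -> `|phi t| <= M) ->
  \int[mu]_(v in slab J i [set t | D (c * (t + s))]) phi (c * (adele_inf v + s)) =
  (`|c| * J%:R)^-1 * \int[lebesgue_measure]_(t in D) phi t.
Proof.
move=> mD finD mphi bphi.
have Jr : 0 < J%:R :> R by rewrite ltr0n.
have k0 : 0 < `|c| * J%:R by rewrite mulr_gt0// normr_gt0.
have nuD : (nu D < +oo)%E.
  have := lebesgue_nu mD; rewrite /mscale => h; move: finD; rewrite h.
  have := measure_ge0 nu D; case: (nu D) => [r _ _||] //; first exact: ltry.
  by move=> _; rewrite gt0_muley.
have bnd (X : Type) (F : X -> R) (S : set X) : (forall x, S x -> D (F x)) ->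
    [bounded phi (F x) | x in S].
  move=> SF; exists M; split; first by rewrite num_real.
  by move=> y My x /SF/bphi h; apply: (le_trans h); exact: ltW.
have intnu : nu.-integrable D (EFin \o phi).
  apply: measurable_bounded_integrable => //; first exact: measurable_funTS.
  exact: (bnd _ id).
have mLD : measurable (L @^-1` D) by rewrite -[X in measurable X]setTI; exact: mL.
have mphiL : measurable_fun [set: adeleB R] (phi \o L) by exact: measurableT_comp.
have intr : (mrestr mu mcls).-integrable (L @^-1` D) (EFin \o (phi \o L)).
  apply: measurable_bounded_integrable => //; first exact: measurable_funTS.
  exact: (bnd _ L).
have e1 : (\int[lebesgue_measure]_(t in D) (phi t)%:E =
           k%:num%:E * \int[nu]_(t in D) (phi t)%:E)%E.
  rewrite -integral_mscale//; apply: eq_measure_integral => B mB _.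
  exact: lebesgue_nu.
have e2 : (\int[nu]_(t in D) (phi t)%:E =
           \int[mu]_(v in slab J i [set t | D (c * (t + s))%R])
             (phi (c * (adele_inf v + s)))%:E)%E.
  rewrite (@integral_pushforward _ _ _ _ R L mL (mrestr mu mcls) D (EFin \o phi))//; last first.
    exact/measurable_EFinP.
  (* The complement of the residue class is null for the restricted measure, so the integral
     localises to the slab. *)
  rewrite (@negligible_integral _ _ _ (mrestr mu mcls) _ (~` (residue_class J i : set (adeleB R))))//.
  - rewrite setDE setCK setIC; apply: eq_measure_integral => B mB Bs.
    rewrite /mrestr; congr (mu _); apply/setIidl => v /Bs [].
    by [].
  - exact: measurableC.
  - by rewrite /= /mrestr setICl measure0.
rewrite /Rintegral e1 e2 fineM//.
  by rewrite mulrA mulVf ?mul1r// gt_eqF.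
rewrite -e2; exact: (integrable_fin_num _ intnu).
Qed.

End SlabPushforward.

(** As i runs through |j| consecutive integers, (v_inf - i) N / j sweeps |j| adjacent intervals of
    length N / |j|, which fill [0, N]. The adelic integral thus becomes an integral over one
    period. *)
Lemma integral_adele_fdom (N : nat) (j : int) (F : adele R -> R) (phi : R -> R) :
  (0 < N)%N -> j != 0 -> continuous phi ->
  (forall v i, 0 <= adele_inf v < 1 -> residue_class `|j| i v ->
     F v = phi ((adele_inf v - i%:~R) * (N%:R / j%:~R))) ->
  \int[mu]_(v in @adele_fdom R) F v =
  N%:R^-1 * \int[lebesgue_measure]_(t in `[0, N%:R]) phi t.
Proof.
move=> N0 j0 cphi hF; pose J := `|j|%N.
have J0 : (0 < J)%N by rewrite absz_gt0.
pose c : R := N%:R / j%:~R; pose delta : R := N%:R / J%:R.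
have Nr : 0 < N%:R :> R by rewrite ltr0n.
have Jr : 0 < J%:R :> R by rewrite ltr0n.
have c0 : c != 0 by rewrite mulf_neq0 ?invr_eq0 ?intr_eq0// gt_eqF.
have d0 : 0 < delta by rewrite divr_gt0.
have [M hM] := @continuous_itv_bounded R phi 0 N%:R cphi.
have mphi : measurable_fun [set: R] phi by exact: continuous_measurable_fun.
have absj : `|j%:~R| = J%:R :> R by rewrite -intr_norm /J natr_absz.
have cJ : `|c| * J%:R = N%:R.
  by rewrite normf_div absj ger0_norm ?ltW// divfK// gt_eqF.
(* i0 is the first representative, D i the image of the i-th slab in [0, N], and a i the position of
   that image. *)
have [i0 [a [D [ba hD]]]] : exists (i0 : int) (a : 'I_J -> 'I_J) (D : 'I_J -> set R),
  bijective a /\ forall i : 'I_J,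
   [/\ measurable (D i), forall t, D i (c * (t - (i%:Z + i0)%:~R)) <-> 0 <= t < 1,
      (D i `<=` `[0, N%:R]%classic) &
      \int[lebesgue_measure]_(t in D i) phi t =
      \int[lebesgue_measure]_(t in `[(a i)%:R * delta, (a i).+1%:R * delta]) phi t].
  have mono (k : 'I_J) : k.+1%:R * delta <= N%:R.
    rewrite /delta mulrA ler_pdivrMr// mulrC ler_pM2l// ler_nat.
    exact: ltn_ord.
  have subI (k : 'I_J) b0 b1 : [set` Interval (BSide b0 (k%:R * delta)) (BSide b1 (k.+1%:R * delta))]
      `<=` `[0, N%:R]%classic.
    move=> t /=; rewrite !in_itv /= => h; have := mono k.
    have : 0 <= k%:R * delta by rewrite mulr_ge0// ltW.
    by case: b0 h; case: b1 => /= /andP[h1 h2] h3 h4; apply/andP; split; lra.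
  (* For j > 0 the representatives are 1 - J, ..., 0 and the images come in reverse order; for j < 0
     they are 1, ..., J and the images are open on the left. *)
  have [jp|jn] := ltP 0 j.
    have jE : j%:~R = J%:R :> R.
      by rewrite -absj ger0_norm// ler0z ltW.
    exists (- (J.-1)%:Z), (@rev_ord J),
      (fun i => `[(rev_ord i)%:R * delta, (rev_ord i).+1%:R * delta[%classic); split.
      exact: (Bijective (@rev_ordK J) (@rev_ordK J)).
    move=> i; split.
    - exact: measurable_itv.
    - move=> t /=; rewrite in_itv /= /c jE -/delta.
      have -> : (i%:Z - J.-1%:Z)%:~R = - (J - i.+1)%:R :> R.
        rewrite natrB// intrB opprB -!pmulrn -[in J%:R](prednK J0).
        by rewrite !mulrSr; ring.
      rewrite opprK [delta * _]mulrC ler_pM2r// ltr_pM2r// mulrSr.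
      by split=> /andP[h1 h2]; apply/andP; split; lra.
    - exact: subI.
    - by rewrite Rintegral_itv_bndo_bndc//; exact: continuous_itv_integrable.
  have {}jn : j < 0 by rewrite lt_neqAle j0.
  have jE : j%:~R = - J%:R :> R.
    by rewrite -absj ltr0_norm ?opprK// ltrz0.
  exists 1, id, (fun i => `](i : 'I_J)%:R * delta, i.+1%:R * delta]%classic); split.
    by exists id.
  move=> i; split.
  - exact: measurable_itv.
  - move=> t /=; rewrite in_itv /= /c jE invrN mulrN -/delta mulNr -mulrN opprB.
    rewrite intrD -pmulrn [delta * _]mulrC ler_pM2r// ltr_pM2r// mulrSr.
    by split=> /andP[h1 h2]; apply/andP; split; lra.
  - exact: subI.
  - by rewrite Rintegral_itv_obnd_cbnd//; exact: continuous_itv_integrable.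
pose S (i : 'I_J) := slab J (i%:Z + i0) `[0, 1[%classic.
have SE i : S i = slab J (i%:Z + i0) [set t | D i (c * (t + - (i%:Z + i0)%:~R))].
  have [_ h _ _] := hD i; apply/seteqP; split=> v [v1 v2]; split=> //.
    by apply/h; move: v2; rewrite /= in_itv.
  by rewrite /= in_itv /=; apply/h.
have mS i : measurable (S i : set (adeleB R)) by exact: measurable_slab.
have FE i v : S i v -> F v = phi (c * (adele_inf v + - (i%:Z + i0)%:~R)).
  by move=> [v1]; rewrite /= in_itv /= => v2; rewrite (hF _ _ v2 v1) mulrC.
have bF v i : S i v -> `|F v| <= M.
  move=> Sv; rewrite (FE _ _ Sv); apply: hM; move: Sv; rewrite SE => -[_ /=].
  by have [_ _ h _] := hD i; exact: h.
have mF i : measurable_fun (S i : set (adeleB R)) (F : adeleB R -> R).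
  apply: (@eq_measurable_fun _ _ _ _ _ (fun v : adeleB R => phi (c * (adele_inf v + - (i%:Z + i0)%:~R)))).
    by move=> v; rewrite inE => /FE.
  apply: measurable_funTS; apply: (measurableT_comp mphi).
  by apply: measurable_funM => //; apply: measurable_funD => //; exact: measurable_adele_inf.
have intF i : mu.-integrable (S i) (EFin \o F).
  apply: measurable_bounded_integrable => //.
    by rewrite /S slab_co// ltry.
  by exists M; split=> [|y My v /bF h]; [rewrite num_real|apply: (le_trans h); exact: ltW].
have piece i : \int[mu]_(v in S i) F v =
    N%:R^-1 * \int[lebesgue_measure]_(t in `[(a i)%:R * delta, (a i).+1%:R * delta]) phi t.
  have [mD _ DN <-] := hD i.
  rewrite -cJ -(@integral_slab J (i%:Z + i0) c (- (i%:Z + i0)%:~R) J0 c0 (D i) phi M)//.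
  - by rewrite -SE; apply: eq_Rintegral => v; rewrite inE => /FE.
  - apply: (@le_lt_trans _ _ (lebesgue_measure `[0, N%:R]%classic)).
      by apply: le_measure; rewrite ?inE//; exact: measurable_itv.
    by rewrite lebesgue_measure_itv /= lte_fin Nr -EFinB ltry.
  - by move=> t /DN; exact: hM.
have -> : \int[mu]_(v in @adele_fdom R) F v = \sum_(i < J) \int[mu]_(v in S i) F v.
  rewrite /Rintegral (fdom_slabs i0 J0) integral_bigsetU_EFin//.
  - under eq_bigr => i _ do rewrite -(fineK (integrable_fin_num (mS i) (intF i))).
    by rewrite sumEFin.
  - exact: index_enum_uniq.
  - have /trivIsetP h := slab_trivIset (i0 := i0) (I := `[0, 1[%classic) J0.
    by apply/trivIsetP => k l _ _; exact: h.
  - apply/measurable_EFinP.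
    suff h s : measurable (\big[setU/set0]_(i <- s) S i : set (adeleB R)) /\
        measurable_fun (\big[setU/set0]_(i <- s) S i : set (adeleB R)) F.
      by have [_] := h (index_enum 'I_J).
    elim: s => [|k s [IH1 IH2]].
      by rewrite big_nil; split; [exact: measurable0|exact: measurable_fun_set0].
    by rewrite big_cons; split; [exact: measurableU|apply/measurable_funU].
rewrite (eq_bigr _ (fun i _ => piece i)) -mulr_sumr; congr (_ * _).
rewrite -[N%:R in RHS](divfK (lt0r_neq0 Jr)) [_ * J%:R]mulrC -/delta.
rewrite -(Rintegral_subdivision J cphi (ltW d0)).
by rewrite [RHS](reindex a)//; exact: onW_bij.
Qed.

End HaarMeasure.

(** * Fourier coefficients of periodic functions *)

Section FourierUniqueness.
Variables (R : realType) (L : R).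
Hypothesis L0 : 0 < L.
Implicit Types (f g : R -> R) (j : int).

Let ang j t : R := 2 * pi * (j%:~R * t / L).
Let I f := \int[lebesgue_measure]_(t in `[0, L]) f t.

Let intC f : continuous f -> (@lebesgue_measure R).-integrable `[0, L] (EFin \o f).
Proof. by move=> cf; exact: continuous_itv_integrable. Qed.

Let ID f g : continuous f -> continuous g -> I (fun t => f t + g t) = I f + I g.
Proof. by move=> cf cg; apply: RintegralD => //; exact: intC. Qed.

Let IZ a f : continuous f -> I (fun t => a * f t) = a * I f.
Proof. by move=> cf; apply: RintegralZl => //; exact: intC. Qed.

Let contM f g : continuous f -> continuous g -> continuous (fun t => f t * g t).
Proof. by move=> cf cg t; apply: cvgM; [exact: cf|exact: cg]. Qed.

Let contD f g : continuous f -> continuous g -> continuous (fun t => f t + g t).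
Proof. by move=> cf cg t; apply: cvgD; [exact: cf|exact: cg]. Qed.

Let contC (c : R) : continuous (fun _ : R => c).
Proof. by move=> t; exact: cvg_cst. Qed.

Let cont_ang j : continuous (ang j).
Proof.
move=> t; rewrite /ang; apply: cvgM; first exact: cvg_cst.
by apply: cvgM; [apply: cvgM; [exact: cvg_cst|exact: cvg_id]|exact: cvg_cst].
Qed.

Let cont_cos j : continuous (fun t => cos (ang j t)).
Proof. by move=> t; apply: continuous_comp; [exact: cont_ang|exact: continuous_cos]. Qed.

Let cont_sin j : continuous (fun t => sin (ang j t)).
Proof. by move=> t; apply: continuous_comp; [exact: cont_ang|exact: continuous_sin]. Qed.

Let cosZ j : cos (2 * pi * j%:~R) = 1 :> R /\ sin (2 * pi * j%:~R) = 0 :> R.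
Proof.
have e : 2 * pi = pi *+ 2 :> R by rewrite mulr_natl.
have hn (n : nat) : cos (2 * pi * n%:R) = 1 :> R /\ sin (2 * pi * n%:R) = 0 :> R.
  elim: n => [|n [IH1 IH2]]; first by rewrite mulr0 cos0 sin0.
  by rewrite -(natr1 n) mulrDr mulr1 cosD sinD IH1 IH2 e cos2pi sin2pi !mul0r !mulr0 mul1r subr0 addr0.
case: j => n; first by rewrite -pmulrn.
by rewrite NegzE mulrNz mulrN cosN sinN -pmulrn; have [-> ->] := hn n.+1; rewrite oppr0.
Qed.

Let Rint_cst (a b x : R) : a <= b ->
  \int[lebesgue_measure]_(t in `[a, b]) x = x * (b - a).
Proof.
move=> ab; rewrite (@Rintegral_cst _ _ _ (@lebesgue_measure R))//; congr (_ * _).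
have := lebesgue_measure_itv `[a, b]; rewrite /= => ->; rewrite lte_fin.
by move: ab; rewrite le_eqVlt => /predU1P[->|->]; rewrite ?ltxx/= ?subrr.
Qed.

Let I_derive (F f : R -> R) : continuous f ->
  (forall t, is_derive t (1 : R) F (f t)) -> I f = F L - F 0.
Proof.
move=> cf dF; have cF : continuous F.
  by move=> t; apply: differentiable_continuous; apply/derivable1_diffP; have [] := dF t.
rewrite /I /Rintegral (@continuous_FTC2 R f F 0 L)//.
- exact: continuous_subspaceT.
- split=> [t _||]; [by have [] := dF t|apply: cvg_at_right_filter; exact: cF|].
  by apply: cvg_at_left_filter; exact: cF.
- by move=> t _; rewrite derive1E; exact: derive_val.
Qed.

Let I_cos_sin j : j != 0 -> I (fun t => cos (ang j t)) = 0 /\ I (fun t => sin (ang j t)) = 0.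
Proof.
move=> j0; pose a : R := 2 * pi * (j%:~R / L).
have a0 : a != 0.
  by rewrite !mulf_neq0 ?invr_eq0 ?intr_eq0// gt_eqF// pi_gt0.
have angE t : ang j t = a * t by rewrite /ang /a; field; rewrite gt_eqF.
have aL : a * L = 2 * pi * j%:~R by rewrite /a; field; rewrite gt_eqF.
have d1 (t : R) : is_derive t (1 : R) (fun x : R => a * x) a.
  by apply: is_derive_eq (is_deriveZ a (is_derive_id t 1)) _; rewrite /GRing.scale /= mulr1.
have dS (t : R) : is_derive t (1 : R) (fun x => a^-1 * sin (ang j x)) (cos (ang j t)).
  rewrite (_ : (fun x => _) = a^-1 \*: (sin \o (fun x => a * x))); last first.
    by apply/funext => x; rewrite /= angE.
  apply: is_derive_eq (is_deriveZ a^-1 (is_derive1_comp (is_derive_sin (a * t)) (d1 t))) _.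
  by rewrite /GRing.scale /= angE mulrC mulfK.
have dC (t : R) : is_derive t (1 : R) (fun x => - a^-1 * cos (ang j x)) (sin (ang j t)).
  rewrite (_ : (fun x => _) = (- a^-1) \*: (cos \o (fun x => a * x))); last first.
    by apply/funext => x; rewrite /= angE.
  apply: is_derive_eq (is_deriveZ (- a^-1) (is_derive1_comp (is_derive_cos (a * t)) (d1 t))) _.
  by rewrite /GRing.scale /= angE mulNr mulNr mulrN opprK mulrC mulfK.
have [cj sj] := cosZ j.
split.
  by rewrite (I_derive (@cont_cos j) dS) !angE aL sj !mulr0 sin0 mulr0 subrr.
by rewrite (I_derive (@cont_sin j) dC) !angE aL cj !mulr0 cos0 subrr.
Qed.

(* The trigonometric polynomial k is at least 1 + rho near s and at most 1 in absolute
   value away from s, so psi s > 0 would make the integral of psi k^n unbounded. *)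
Let conc (psi : R -> R) (s : R) : continuous psi -> (forall j, I (fun t => psi t * cos (ang j t)) = 0) ->
  (forall j, I (fun t => psi t * sin (ang j t)) = 0) -> 0 < s < L -> psi s <= 0.
Proof.
move=> cpsi hc hs /andP[s0 sL]; rewrite leNgt; apply/negP => psi0.
pose eps := psi s / 2.
have eps0 : 0 < eps by rewrite divr_gt0.
have [d [d0 ds dL2 hd]] : exists d, [/\ 0 < d, d < s, d < L - s &
    forall t, `|t - s| <= d -> eps <= psi t].
  have /cvgrPdist_lt/(_ eps eps0) := cpsi s.
  rewrite -nbhs_ballE => -[r /= r0 hr].
  exists (Num.min (r / 2) (Num.min (s / 2) ((L - s) / 2))).
  split.
  - by rewrite !lt_min; apply/and3P; split; lra.
  - by rewrite !gt_min; apply/orP; right; apply/orP; left; lra.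
  - by rewrite !gt_min; apply/orP; right; apply/orP; right; lra.
  - move=> t; rewrite !le_min => /andP[h1 _].
    have : ball s r t by rewrite /ball /= distrC; lra.
    by move/hr; rewrite /eps ltr_norml => /andP[h2 h3]; lra.
pose w := 2 * pi / L.
have w0 : 0 < w by rewrite divr_gt0// mulr_gt0// pi_gt0.
have wL : w * L = 2 * pi by rewrite divfK// gt_eqF.
have ang1 t : ang 1 t = w * t by rewrite /ang /w mul1r; field; rewrite gt_eqF.
(* With this constant k takes the value 1 exactly at distance d from s. *)
pose eta := 1 - cos (w * d).
pose k t := eta + cos (w * (t - s)).
have kE t : k t = eta + (cos (w * s) * cos (ang 1 t) + sin (w * s) * sin (ang 1 t)).
  by rewrite /k ang1 mulrBr cosB ![cos (w * s) * _]mulrC ![sin (w * s) * _]mulrC.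
have angD1 j t : ang (j + 1) t = ang j t + ang 1 t.
  by rewrite /ang intrD; field; rewrite gt_eqF.
have angB1 j t : ang (j - 1) t = ang j t - ang 1 t.
  by rewrite /ang intrB; field; rewrite gt_eqF.
have ck : continuous k.
  rewrite (_ : k = fun t => eta + (cos (w * s) * cos (ang 1 t) + sin (w * s) * sin (ang 1 t))).
    apply: contD; first exact: contC.
    by apply: contD; apply: contM; [exact: contC|exact: cont_cos|exact: contC|exact: cont_sin].
  by apply/funext => t; exact: kE.
have ckn n : continuous (fun t => k t ^+ n).
  elim: n => [|n IH]; first exact: contC.
  rewrite (_ : (fun t => _) = fun t => k t * k t ^+ n); first exact: contM.
  by apply/funext => t; rewrite exprS.
have cpk n : continuous (fun t => psi t * k t ^+ n) by exact: contM.
(* Multiplication by k mixes only the frequencies j - 1, j and j + 1, so orthogonality to all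
   frequencies passes from psi k^n to psi k^(n+1). *)
have ann n : (forall j, I (fun t => psi t * k t ^+ n * cos (ang j t)) = 0) /\
    (forall j, I (fun t => psi t * k t ^+ n * sin (ang j t)) = 0).
  elim: n => [|n [IH1 IH2]].
    by split=> j; [rewrite -[RHS](hc j)|rewrite -[RHS](hs j)];
      apply: eq_Rintegral => t _; rewrite expr0 mulr1.
  pose P t := psi t * k t ^+ n.
  have P0 (g : R -> R) a : continuous g -> I (fun t => P t * g t) = 0 ->
      continuous (fun t => P t * (a * g t)) /\ I (fun t => P t * (a * g t)) = 0.
    move=> cg Pg; split.
      by apply: contM; [exact: (cpk n)|apply: contM; [exact: contC|]].
    rewrite -[RHS](mulr0 a) -Pg -IZ; last by apply: contM; [exact: (cpk n)|].
    by apply: eq_Rintegral => t _; rewrite mulrCA.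
  have PD (g h : R -> R) : continuous (fun t => P t * g t) /\ I (fun t => P t * g t) = 0 ->
      continuous (fun t => P t * h t) /\ I (fun t => P t * h t) = 0 ->
      continuous (fun t => P t * (g t + h t)) /\ I (fun t => P t * (g t + h t)) = 0.
    move=> [c1 i1] [c2 i2].
    rewrite (_ : (fun t => P t * (g t + h t)) = fun t => P t * g t + P t * h t); last first.
      by apply/funext => t; rewrite mulrDr.
    by split; [exact: contD|rewrite ID// i1 i2 addr0].
  have Pc j a := P0 _ a (@cont_cos j) (IH1 j).
  have Ps j a := P0 _ a (@cont_sin j) (IH2 j).
  split=> j.
    rewrite -[RHS](PD _ _ (Pc j eta) (PD _ _
      (PD _ _ (Pc (j + 1) (cos (w * s) / 2)) (Pc (j - 1) (cos (w * s) / 2)))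
      (PD _ _ (Ps (j + 1) (sin (w * s) / 2)) (Ps (j - 1) (- sin (w * s) / 2))))).2.
    apply: eq_Rintegral => t _; rewrite /P exprS angD1 angB1 cosB cosD sinB sinD kE.
    by field.
  rewrite -[RHS](PD _ _ (Ps j eta) (PD _ _
      (PD _ _ (Ps (j + 1) (cos (w * s) / 2)) (Ps (j - 1) (cos (w * s) / 2)))
      (PD _ _ (Pc (j - 1) (sin (w * s) / 2)) (Pc (j + 1) (- sin (w * s) / 2))))).2.
  apply: eq_Rintegral => t _; rewrite /P exprS angD1 angB1 cosB cosD sinB sinD kE.
  by field.
have ann0 n := (ann n).1 0.
have {}ann n : I (fun t => psi t * k t ^+ n) = 0.
  rewrite -(ann0 n); apply: eq_Rintegral => t _.
  by rewrite /ang mulr0z !mul0r mulr0 cos0 mulr1.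
have [M hM] := @continuous_itv_bounded R psi 0 L cpsi.
have M0 : 0 <= M by apply: le_trans (hM s _) => //; rewrite in_itv /= !ltW.
have wd : w * d <= pi.
  have : w * (2 * d) <= w * L by rewrite ler_pM2l//; lra.
  by rewrite wL; lra.
have cosle x y : 0 <= x -> x <= y -> y <= pi -> cos y <= cos x :> R.
  move=> x0 xy yp; rewrite leNgt ltr_cos -?leNgt// in_itv /=; apply/andP; split; lra.
have cosn t : cos (w * (t - s)) = cos (w * `|t - s|).
  by rewrite -[LHS]cos_norm normrM gtr0_norm.
have wle (x y : R) : x <= y -> w * x <= w * y by move=> xy; rewrite ler_pM2l.
have w_ge0 t : 0 <= w * `|t - s| by rewrite mulr_ge0// ltW.
have near t : `|t - s| <= d -> 1 <= k t.
  move=> h; have := cosle _ _ (w_ge0 t) (wle _ _ h) wd.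
  by rewrite /k /eta cosn; lra.
pose rho := cos (w * (d / 2)) - cos (w * d).
have rho0 : 0 < rho.
  have h1 : w * (d / 2) < w * d by rewrite ltr_pM2l//; lra.
  have h2 : 0 <= w * (d / 2) by apply: mulr_ge0; lra.
  by rewrite subr_gt0 ltr_cos// in_itv /=; apply/andP; split; lra.
have nearer t : `|t - s| <= d / 2 -> 1 + rho <= k t.
  move=> h; have h1 : w * (d / 2) < w * d by rewrite ltr_pM2l//; lra.
  have h2 : w * (d / 2) <= pi by lra.
  have := cosle _ _ (w_ge0 t) (wle _ _ h) h2.
  by rewrite /k /eta cosn /rho; lra.
have far t : 0 <= t <= L -> d <= `|t - s| -> `|k t| <= 1.
  move=> /andP[t0 tL] h; have h2 : `|t - s| <= L - d.
    by rewrite ler_norml; apply/andP; split; lra.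
  have h3 : cos (w * `|t - s|) <= cos (w * d).
    have a1 := wle _ _ h; have a2 := wle _ _ h2.
    have a3 : 0 <= w * d by rewrite mulr_ge0// ltW.
    have [pi1|pi1] := leP (w * `|t - s|) pi; first exact: cosle.
    (* Beyond pi the angle is reflected to 2 pi - w |t - s|, which is still at least w d because |t
       - s| <= L - d. *)
    rewrite -[X in X <= _]cosN -[X in X <= _]cosD2pi -[pi *+ 2]mulr_natl.
    by apply: cosle; move: a2; rewrite mulrBr wL; lra.
  rewrite /k /eta cosn ler_norml; have := cos_geN1 (w * `|t - s|); have := cos_le1 (w * d).
  by move=> b1 b2; apply/andP; split; lra.
have bern n : 1 + n%:R * rho <= (1 + rho) ^+ n.
  elim: n => [|n IH]; first by rewrite expr0 mul0r addr0.
  rewrite exprS -(natr1 n); apply: (@le_trans _ _ ((1 + rho) * (1 + n%:R * rho))).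
    have : 0 <= n%:R * rho * rho by rewrite !mulr_ge0// ltW.
    by nra.
  by rewrite ler_pM2l//; lra.
have main n : eps * (1 + n%:R * rho) * d <= M * L.
  (* Adding M makes the integrand nonnegative on [0, L], so its integral M L bounds the part over |t
     - s| <= d / 2. *)
  pose h t := psi t * k t ^+ n + M.
  have ch : continuous h by apply: contD; [exact: cpk|exact: contC].
  have Ih : I h = M * L.
    by rewrite /h (ID (cpk n) (@contC M)) ann add0r /I Rint_cst ?ltW// subr0.
  pose A : set R := `[s - d / 2, s + d / 2]%classic.
  have mA : measurable A by exact: measurable_itv.
  have AE t : A t <-> `|t - s| <= d / 2.
    rewrite /A /= in_itv /= ler_norml; split=> /andP[h1 h2]; apply/andP; split; lra.
  have iA (g : R -> R) : continuous g -> (@lebesgue_measure R).-integrable A (EFin \o g).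
    by move=> cg; exact: continuous_itv_integrable.
  have h0 t : 0 <= t <= L -> 0 <= h t.
    move=> tL; have [tn|tf] := leP `|t - s| d.
      have := hd _ tn; have := near _ tn => k1 p1.
      by apply: addr_ge0 => //; apply: mulr_ge0; [lra|apply: exprn_ge0; lra].
    have kt := far _ tL (ltW tf).
    have : `|psi t * k t ^+ n| <= M.
      rewrite normrM normrX -[M]mulr1; apply: ler_pM => //; first exact: hM.
      exact: exprn_ile1.
    by rewrite ler_norml /h => /andP[]; lra.
  have s1 : \int[lebesgue_measure]_(t in A) (eps * (1 + n%:R * rho)) <=
            \int[lebesgue_measure]_(t in A) h t.
    apply: le_Rintegral => //; [by apply: iA; exact: contC|exact: iA|].
    move=> t /AE ht; rewrite /h.
    have p1 : eps <= psi t by apply: hd; lra.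
    have k1 := nearer _ ht.
    have k2 : 1 + n%:R * rho <= k t ^+ n.
      by apply: (le_trans (bern n)); apply: lerXn2r; rewrite ?nnegrE//; lra.
    have b0 : 0 <= 1 + n%:R * rho by rewrite addr_ge0// mulr_ge0// ltW.
    rewrite -[X in X <= _]addr0; apply: lerD => //.
    by apply: ler_pM => //; exact: ltW.
  have s2 : \int[lebesgue_measure]_(t in A) h t <= I h.
    rewrite /I /Rintegral fine_le//.
    - exact: (integrable_fin_num _ (iA _ ch)).
    - exact: (integrable_fin_num _ (intC ch)).
    apply: ge0_subset_integral => //.
    - by apply/measurable_EFinP; apply: measurable_funTS; exact: continuous_measurable_fun.
    - by move=> t; rewrite /A /= !in_itv /= => /andP[h1 h2]; apply/andP; split; lra.
  rewrite -Ih; apply: le_trans s2; apply: le_trans s1.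
  rewrite Rint_cst; last by lra.
  by rewrite le_eqVlt; apply/orP; left; apply/eqP; field.
pose n := (Num.truncn (M * L / (eps * rho * d))).+1.
have := main n; have : M * L / (eps * rho * d) < n%:R by exact: truncnS_gt.
rewrite ltr_pdivrMr ?mulr_gt0//; have : 0 < eps * d by rewrite mulr_gt0.
move: (n%:R) => x; nra.
Qed.

(** Subtracting the mean c makes psi - c orthogonal to the zero frequency too; [conc] applied to psi
    - c and to c - psi gives both inequalities. *)
Lemma fourier_unique (psi : R -> R) : continuous psi ->
  (forall j, j != 0 -> \int[lebesgue_measure]_(t in `[0, L]) (psi t * cos (2 * pi * (j%:~R * t / L))) = 0) ->
  (forall j, j != 0 -> \int[lebesgue_measure]_(t in `[0, L]) (psi t * sin (2 * pi * (j%:~R * t / L))) = 0) ->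
  exists c, forall t, 0 < t < L -> psi t = c.
Proof.
move=> cpsi hc hs; pose c := I psi / L; exists c.
have Ic (x : R) : I (fun _ => x) = x * L.
  by rewrite /I Rint_cst ?ltW// subr0.
have hc' j (j0 : j != 0) : I (fun t => psi t * cos (ang j t)) = 0 := hc j j0.
have hs' j (j0 : j != 0) : I (fun t => psi t * sin (ang j t)) = 0 := hs j j0.
have ang0 t : ang 0 t = 0 by rewrite /ang mulr0z !mul0r mulr0.
have zero (e : R) (t : R) : 0 < t < L -> e * (psi t - c) <= 0.
  apply: (@conc (fun t => e * (psi t - c))).
  - by apply: contM; [exact: contC|apply: contD => //; exact: contC].
  - move=> j; transitivity (e * (I (fun t => psi t * cos (ang j t)) +
        - c * I (fun t => cos (ang j t)))).
      have cc := @cont_cos j.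
      rewrite -IZ// -ID; [|exact: contM|by apply: contM => //; exact: contC].
      rewrite -IZ; last by apply: contD; apply: contM => //; exact: contC.
      by apply: eq_Rintegral => t' _; rewrite -mulrA mulrBl mulNr.
    have [->|j0] := eqVneq j 0; last by rewrite (hc' _ j0) (I_cos_sin j0).1 mulr0 addr0 mulr0.
    have -> : I (fun t => cos (ang 0 t)) = L.
      by rewrite -[RHS]mul1r -Ic; apply: eq_Rintegral => t' _; rewrite ang0 cos0.
    have -> : I (fun t => psi t * cos (ang 0 t)) = I psi.
      by apply: eq_Rintegral => t' _; rewrite ang0 cos0 mulr1.
    by rewrite /c mulNr divfK ?subrr ?mulr0// gt_eqF.
  - move=> j; transitivity (e * (I (fun t => psi t * sin (ang j t)) +
        - c * I (fun t => sin (ang j t)))).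
      have cc := @cont_sin j.
      rewrite -IZ// -ID; [|exact: contM|by apply: contM => //; exact: contC].
      rewrite -IZ; last by apply: contD; apply: contM => //; exact: contC.
      by apply: eq_Rintegral => t' _; rewrite -mulrA mulrBl mulNr.
    have [->|j0] := eqVneq j 0; last by rewrite (hs' _ j0) (I_cos_sin j0).2 mulr0 addr0 mulr0.
    have -> : I (fun t => sin (ang 0 t)) = 0.
      by rewrite -[RHS](mul0r L) -Ic; apply: eq_Rintegral => t' _; rewrite ang0 sin0.
    have -> : I (fun t => psi t * sin (ang 0 t)) = 0.
      by rewrite -[RHS](mul0r L) -Ic; apply: eq_Rintegral => t' _; rewrite ang0 sin0 mulr0.
    by rewrite mulr0 addr0 mulr0.
move=> t tL; have := zero 1 t tL; have := zero (- 1) t tL; lra.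
Qed.
End FourierUniqueness.

Local Open Scope complex_scope.

(** * Complex-valued functions of a real variable *)

Section ComplexFunctions.
Variable R : realType.
Implicit Types (F G : R -> R[i]) (a b : R[i]).

(** Componentwise, to match the componentwise integrals of [whittaker] and [cintegral]. *)
Definition ccontinuous F :=
  continuous (fun t => complex.Re (F t)) /\ continuous (fun t => complex.Im (F t)).

Lemma ReM (x y : R[i]) : complex.Re (x * y) =
  complex.Re x * complex.Re y - complex.Im x * complex.Im y.
Proof. by case: x; case: y. Qed.

Lemma ImM (x y : R[i]) : complex.Im (x * y) =
  complex.Re x * complex.Im y + complex.Im x * complex.Re y.
Proof. by case: x; case: y. Qed.

Lemma ReD (x y : R[i]) : complex.Re (x + y) = complex.Re x + complex.Re y.
Proof. by case: x; case: y. Qed.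

Lemma ImD (x y : R[i]) : complex.Im (x + y) = complex.Im x + complex.Im y.
Proof. by case: x; case: y. Qed.

Lemma complex_ext (x y : R[i]) :
  complex.Re x = complex.Re y -> complex.Im x = complex.Im y -> x = y.
Proof. by case: x y => [a b] [c d] /= -> ->. Qed.

Lemma continuous_cst_fun (c : R) : continuous (fun _ : R => c).
Proof. by move=> t; exact: cvg_cst. Qed.

Lemma continuousD_fun (f g : R -> R) : continuous f -> continuous g ->
  continuous (fun t => f t + g t).
Proof. by move=> cf cg t; apply: cvgD; [exact: cf|exact: cg]. Qed.

Lemma continuousM_fun (f g : R -> R) : continuous f -> continuous g ->
  continuous (fun t => f t * g t).
Proof. by move=> cf cg t; apply: cvgM; [exact: cf|exact: cg]. Qed.

Lemma continuousN_fun (f : R -> R) : continuous f -> continuous (fun t => - f t).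
Proof. by move=> cf t; apply: cvgN; exact: cf. Qed.

Lemma ccontinuous_cst a : ccontinuous (fun _ => a).
Proof. by split; exact: continuous_cst_fun. Qed.

Lemma ccontinuousD F G : ccontinuous F -> ccontinuous G ->
  ccontinuous (fun t => F t + G t).
Proof.
move=> [F1 F2] [G1 G2]; split.
  by under eq_fun do rewrite ReD; exact: continuousD_fun.
by under eq_fun do rewrite ImD; exact: continuousD_fun.
Qed.

Lemma ccontinuousM F G : ccontinuous F -> ccontinuous G ->
  ccontinuous (fun t => F t * G t).
Proof.
move=> [F1 F2] [G1 G2]; split.
  under eq_fun do rewrite ReM; apply: continuousD_fun; first exact: continuousM_fun.
  by apply: continuousN_fun; exact: continuousM_fun.
by under eq_fun do rewrite ImM; apply: continuousD_fun; exact: continuousM_fun.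
Qed.

Lemma ccontinuous_real (f : R -> R) : continuous f -> ccontinuous (fun t => (f t)%:C).
Proof. by move=> cf; split => //=; exact: continuous_cst_fun. Qed.

Lemma continuous_sqnorm F : ccontinuous F ->
  continuous (fun t => complex.Re (F t) ^+ 2 + complex.Im (F t) ^+ 2).
Proof.
move=> [F1 F2]; under eq_fun do rewrite !expr2.
by apply: continuousD_fun; exact: continuousM_fun.
Qed.

Lemma ccontinuous_inv F : ccontinuous F -> (forall t, F t != 0) ->
  ccontinuous (fun t => (F t)^-1).
Proof.
move=> cF F0; have cs := continuous_sqnorm cF; case: cF => F1 F2.
have n0 t : complex.Re (F t) ^+ 2 + complex.Im (F t) ^+ 2 != 0.
  apply: contraNneq (F0 t) => /eqP; rewrite paddr_eq0 ?sqr_ge0// !sqrf_eq0 => /andP[/eqP h1 /eqP h2].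
  by apply/eqP/complex_ext.
have cn : continuous (fun t => (complex.Re (F t) ^+ 2 + complex.Im (F t) ^+ 2)^-1).
  by move=> t; apply: cvgV => //; exact: cs.
split.
  rewrite (_ : (fun t => _) = fun t => complex.Re (F t) *
      (complex.Re (F t) ^+ 2 + complex.Im (F t) ^+ 2)^-1); first exact: continuousM_fun.
  by apply/funext => t; case: (F t).
rewrite (_ : (fun t => _) = fun t => - (complex.Im (F t) *
    (complex.Re (F t) ^+ 2 + complex.Im (F t) ^+ 2)^-1)).
  by apply: continuousN_fun; exact: continuousM_fun.
by apply/funext => t; case: (F t) => x y /=; rewrite ?mulNr.
Qed.

Lemma ccontinuousX F n : ccontinuous F -> ccontinuous (fun t => F t ^+ n).
Proof.
move=> cF; elim: n => [|n IH]; first by under eq_fun do rewrite expr0; exact: ccontinuous_cst.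
by under eq_fun do rewrite exprS; exact: ccontinuousM.
Qed.

Lemma ccontinuous_norm F : ccontinuous F -> ccontinuous (fun t => `|F t|).
Proof.
move=> /continuous_sqnorm cs.
rewrite (_ : (fun t => _) = fun t => (Num.sqrt (complex.Re (F t) ^+ 2 + complex.Im (F t) ^+ 2))%:C).
  apply: ccontinuous_real => t.
  exact: (continuous_comp (cs t) (@sqrt_continuous R _)).
by apply/funext => t; case: (F t).
Qed.

Lemma ccontinuous_exprz F (n : int) : ccontinuous F -> (forall t, F t != 0) ->
  ccontinuous (fun t => F t ^ n).
Proof.
move=> cF F0; case: n => n; first exact: ccontinuousX.
under eq_fun do rewrite NegzE -exprnN; apply: ccontinuous_inv; first exact: ccontinuousX.
by move=> t; rewrite expf_neq0.
Qed.

Variable N : nat.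
Hypothesis N0 : (0 < N)%N.

Definition cintegral F : R[i] :=
  (\int[lebesgue_measure]_(t in `[0, N%:R]) complex.Re (F t)) +i*
  (\int[lebesgue_measure]_(t in `[0, N%:R]) complex.Im (F t)).

Lemma cintegral_lin a b F G : ccontinuous F -> ccontinuous G ->
  cintegral (fun t => a * F t + b * G t) = a * cintegral F + b * cintegral G.
Proof.
move=> [F1 F2] [G1 G2].
have D (f g : R -> R) : continuous f -> continuous g ->
    \int[lebesgue_measure]_(t in `[0, N%:R]) (f t + g t) =
    \int[lebesgue_measure]_(t in `[0, N%:R]) f t + \int[lebesgue_measure]_(t in `[0, N%:R]) g t.
  by move=> cf cg; apply: RintegralD => //; exact: continuous_itv_integrable.
have Z (c : R) (f : R -> R) : continuous f ->
    continuous (fun t => c * f t) /\ \int[lebesgue_measure]_(t in `[0, N%:R]) (c * f t) =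
    c * \int[lebesgue_measure]_(t in `[0, N%:R]) f t.
  move=> cf; split; first by apply: continuousM_fun => //; exact: continuous_cst_fun.
  by apply: RintegralZl => //; exact: continuous_itv_integrable.
have L4 (c1 c2 c3 c4 : R) : 
    \int[lebesgue_measure]_(t in `[0, N%:R]) ((c1 * complex.Re (F t) + c2 * complex.Im (F t)) +
     (c3 * complex.Re (G t) + c4 * complex.Im (G t))) =
    c1 * complex.Re (cintegral F) + c2 * complex.Im (cintegral F) +
    (c3 * complex.Re (cintegral G) + c4 * complex.Im (cintegral G)).
  have [z1 e1] := Z c1 _ F1; have [z2 e2] := Z c2 _ F2.
  have [z3 e3] := Z c3 _ G1; have [z4 e4] := Z c4 _ G2.
  rewrite D; [|exact: continuousD_fun|exact: continuousD_fun].
  by rewrite !D// e1 e2 e3 e4.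
apply: complex_ext.
  rewrite ReD !ReM -!mulNr -L4; apply: eq_Rintegral => t _.
  by rewrite ReD !ReM -!mulNr.
rewrite ImD !ImM ![complex.Re _ * _ + _]addrC -L4; apply: eq_Rintegral => t _.
by rewrite ImD !ImM ![complex.Re _ * _ + _]addrC.
Qed.

(** [fourier_unique] says nothing at the end points of the period; continuity at 0 and periodicity
    fill in the multiples of N. *)
Lemma periodic_constant (g : R -> R) c : continuous g ->
  (forall t, g (t + N%:R) = g t) -> (forall t, 0 < t < N%:R -> g t = c) -> forall t, g t = c.
Proof.
move=> cg per gc; have Nr : 0 < N%:R :> R by rewrite ltr0n.
have g0 : g 0 = c.
  apply/eqP; apply/negPn/negP => ne; have e0 : 0 < `|g 0 - c| by rewrite normr_gt0 subr_eq0.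
  have /cvgrPdist_lt/(_ _ e0) := cg 0.
  rewrite -nbhs_ballE => -[r /= r0 hr].
  pose t := Num.min (r / 2) (N%:R / 2).
  have t0 : 0 < t by rewrite lt_min !divr_gt0.
  have tr : t <= r / 2 by rewrite ge_min lexx.
  have tN : t <= N%:R / 2 by rewrite ge_min lexx orbT.
  have /hr : ball 0 r t by rewrite /ball /= sub0r normrN gtr0_norm//; lra.
  have -> : g t = c by apply: gc; rewrite t0 /=; lra.
  by rewrite ltxx.
have pern (n : nat) t : g (t + n%:R * N%:R) = g t.
  elim: n t => [|n IH] t; first by rewrite mul0r addr0.
  by rewrite -(natr1 n) mulrDl mul1r addrA per IH.
have perz (k : int) t : g (t + k%:~R * N%:R) = g t.
  case: k => n; first by rewrite -pmulrn pern.
  by rewrite NegzE mulrNz -pmulrn -(pern n.+1) mulNr subrK.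
move=> t; pose k := Num.floor (t / N%:R).
have k1 : k%:~R * N%:R <= t by rewrite -ler_pdivlMr// floor_le.
have k2 : t < k%:~R * N%:R + N%:R.
  by rewrite -[X in _ + X]mul1r -mulrDl -ltr_pdivrMr// -[1]/(1%:~R) -intrD floorD1_gt.
rewrite -(perz (- k)) mulrNz mulNr.
have [e|ne] := eqVneq (t - k%:~R * N%:R) 0; first by rewrite e.
by apply: gc; rewrite lt_neqAle eq_sym ne; apply/andP; split; lra.
Qed.

Lemma fourier_unique_complex F : ccontinuous F -> (forall t, F (t + N%:R) = F t) ->
  (forall j : int, j != 0 -> cintegral (fun t => F t * cexp (- (j%:~R * t / N%:R))) = 0) ->
  forall t, F t = F 0.
Proof.
move=> [F1 F2] per hF; have Nr : 0 < N%:R :> R by rewrite ltr0n.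
pose x j t : R := 2 * pi * (j%:~R * t / N%:R).
have cx j : continuous (x j).
  by move=> t; apply: continuousM_fun; [exact: continuous_cst_fun|move=> {}t; apply: continuousM_fun;
    [apply: continuousM_fun; [exact: continuous_cst_fun|move=> {}t; exact: cvg_id]|exact: continuous_cst_fun]].
pose I (f : R -> R) := \int[lebesgue_measure]_(t in `[0, N%:R]) f t.
have ID (f g : R -> R) : continuous f -> continuous g -> I (fun t => f t + g t) = I f + I g.
  by move=> cf cg; apply: RintegralD => //; exact: continuous_itv_integrable.
have IN (f : R -> R) : continuous f -> I (fun t => - f t) = - I f.
  move=> cf; rewrite -mulN1r -RintegralZl//; last exact: continuous_itv_integrable.
  by apply: eq_Rintegral => t _; rewrite mulN1r.
pose C (f : R -> R) j := I (fun t => f t * cos (x j t)).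
pose S (f : R -> R) j := I (fun t => f t * sin (x j t)).
have cC (f : R -> R) j : continuous f -> continuous (fun t => f t * cos (x j t)).
  move=> cf; apply: continuousM_fun => // t.
  by apply: continuous_comp; [exact: cx|exact: continuous_cos].
have cS (f : R -> R) j : continuous f -> continuous (fun t => f t * sin (x j t)).
  move=> cf; apply: continuousM_fun => // t.
  by apply: continuous_comp; [exact: cx|exact: continuous_sin].
pose Fr t := complex.Re (F t); pose Fi t := complex.Im (F t).
have eq1 j : j != 0 -> C Fr j + S Fi j = 0 /\ C Fi j - S Fr j = 0.
  move=> /hF h; split.
    rewrite -[RHS](congr1 (@complex.Re R) h) /= -ID; [|exact: cC|exact: cS].
    apply: eq_Rintegral => t _; rewrite ReM /cexp /= mulrN cosN sinN.
    by rewrite mulrN opprK.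
  rewrite -[RHS](congr1 (@complex.Im R) h) /= -IN; last exact: cS.
  rewrite -ID; [|exact: cC|by apply: continuousN_fun; exact: cS].
  apply: eq_Rintegral => t _; rewrite ImM /cexp /= mulrN cosN sinN.
  by rewrite mulrN addrC.
have xN j t : x (- j) t = - x j t by rewrite /x mulrNz !mulNr mulrN.
have CN f j : C f (- j) = C f j by apply: eq_Rintegral => t _; rewrite xN cosN.
have SN (f : R -> R) j : continuous f -> S f (- j) = - S f j.
  move=> cf; rewrite -IN; last exact: cS.
  by apply: eq_Rintegral => t _; rewrite xN sinN mulrN.
(* The coefficients of index j and -j give four real equations, which separate the real from the
   imaginary part of F. *)
have eq2 j : j != 0 -> [/\ C Fr j = 0, S Fr j = 0, C Fi j = 0 & S Fi j = 0].
  move=> j0; have [a1 a2] := eq1 j j0; have := eq1 (- j); rewrite oppr_eq0 => /(_ j0)[].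
  rewrite !CN !SN// => a3 a4; split; lra.
have [cr hr] := @fourier_unique R N%:R Nr Fr F1 (fun j j0 => let: And4 h _ _ _ := eq2 j j0 in h)
  (fun j j0 => let: And4 _ h _ _ := eq2 j j0 in h).
have [ci hi] := @fourier_unique R N%:R Nr Fi F2 (fun j j0 => let: And4 _ _ h _ := eq2 j j0 in h)
  (fun j j0 => let: And4 _ _ _ h := eq2 j j0 in h).
have r t : Fr t = cr by apply: periodic_constant => // u; rewrite /Fr per.
have i t : Fi t = ci by apply: periodic_constant => // u; rewrite /Fi per.
by move=> t; apply: complex_ext; [exact: etrans (r t) (esym (r 0))|exact: etrans (i t) (esym (i 0))].
Qed.

End ComplexFunctions.

(** * The slash action *)

Lemma ord2P (P : 'I_2 -> Prop) : P 0 -> P 1 -> forall i, P i.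
Proof.
move=> P0 P1 [[|[|i]] hi] //.
  by rewrite (_ : Ordinal hi = 0) //; exact/val_inj.
by rewrite (_ : Ordinal hi = 1) //; exact/val_inj.
Qed.

Section Mx2.
Variable A : comNzRingType.
Implicit Types (a b c d : A) (M K : 'M[A]_2).

Lemma mx2E a b c d : (mx2 a b c d 0 0 = a) * (mx2 a b c d 0 1 = b) *
  (mx2 a b c d 1 0 = c) * (mx2 a b c d 1 1 = d).
Proof. by rewrite !mxE. Qed.

Lemma mx2_ext M K : M 0 0 = K 0 0 -> M 0 1 = K 0 1 -> M 1 0 = K 1 0 ->
  M 1 1 = K 1 1 -> M = K.
Proof. by move=> *; apply/matrixP; apply: ord2P; apply: ord2P. Qed.

Lemma mx2_eta M : M = mx2 (M 0 0) (M 0 1) (M 1 0) (M 1 1).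
Proof. by apply: mx2_ext; rewrite mx2E. Qed.

Lemma mulmx2E M K i j : (M *m K) i j = M i 0 * K 0 j + M i 1 * K 1 j.
Proof. by rewrite mxE big_ord_recl big_ord1; congr (_ + M i _ * K _ _); exact/val_inj. Qed.

Lemma mul_mx2 a b c d a' b' c' d' : mx2 a b c d *m mx2 a' b' c' d' =
  mx2 (a * a' + b * c') (a * b' + b * d') (c * a' + d * c') (c * b' + d * d').
Proof. by apply: mx2_ext; rewrite mulmx2E !mx2E. Qed.

Lemma det_mx2 M : \det M = M 0 0 * M 1 1 - M 0 1 * M 1 0.
Proof.
rewrite (expand_det_row _ 0) big_ord_recl big_ord1 /cofactor !det_mx11 !mxE /=.
rewrite expr0 mul1r expr1 mulN1r mulrN; congr (_ * M _ _ - M _ _ * M _ _); exact/val_inj.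
Qed.

Lemma mx2_scalar1 : mx2 1 0 0 1 = 1%:M :> 'M[A]_2.
Proof. by apply: mx2_ext; rewrite !mxE. Qed.
End Mx2.

Lemma map_mx2 (A B : comNzRingType) (f : A -> B) (a b c d : A) :
  map_mx f (mx2 a b c d) = mx2 (f a) (f b) (f c) (f d).
Proof. by apply: mx2_ext; rewrite !mxE. Qed.

Lemma invmx2 (A : comUnitRingType) (M : 'M[A]_2) : \det M = 1 ->
  invmx M = mx2 (M 1 1) (- M 0 1) (- M 1 0) (M 0 0).
Proof.
move=> d1; have uM : M \in unitmx by rewrite unitmxE d1 unitr1.
rewrite -[RHS]mul1mx -(mulVmx uM) -mulmxA [X in _ *m (X *m _)]mx2_eta mul_mx2.
rewrite det_mx2 in d1; rewrite -[LHS]mulmx1; congr (_ *m _).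
by rewrite -mx2_scalar1; apply: mx2_ext; rewrite !mx2E -?d1; ring.
Qed.

Section Slash.
Variables (R : realType) (k : int).
Implicit Types (f h : R[i] -> R[i]) (z : R[i]) (M K : 'M[R]_2).

(** Functions are total on R[i], but only their values on the upper half-plane carry meaning. *)
Definition eqH f h := forall z, 0 < complex.Im z -> f z = h z.

Definition autj M z : R[i] := (M 1 0)%:C * z + (M 1 1)%:C.
Definition mobius M z : R[i] := ((M 0 0)%:C * z + (M 0 1)%:C) / autj M z.

Lemma slashE f M z : slash k f M z =
  (autj M z / `|autj M z|) ^ (- k) * f (mobius M z).
Proof. by []. Qed.

Lemma det_gt0_row M : 0 < \det M -> ~ (M 1 0 = 0 /\ M 1 1 = 0).
Proof. by move=> h [c0 d0]; move: h; rewrite det_mx2 c0 d0 !mulr0 subrr ltxx. Qed.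

Lemma autj_neq0 M z : 0 < \det M -> 0 < complex.Im z -> autj M z != 0.
Proof.
move=> /det_gt0_row dM z0; apply/eqP => e; apply: dM.
have := congr1 (@complex.Im R) e; have := congr1 (@complex.Re R) e.
case: z z0 e => x y /= y0 e; rewrite !mul0r subr0 !addr0 => h1 h2.
have c0 : M 1 0 = 0.
  by move/eqP: h2; rewrite mulf_eq0 (gt_eqF y0) orbF => /eqP.
by split=> //; rewrite -h1 c0 mul0r add0r.
Qed.

Lemma mobius_im M z : 0 < \det M -> 0 < complex.Im z -> 0 < complex.Im (mobius M z).
Proof.
move=> dM z0; have := autj_neq0 dM z0; rewrite /mobius; move: dM; rewrite det_mx2.
rewrite /autj; case: z z0 => x y /= y0.
set a := M 0 0; set b := M 0 1; set c := M 1 0; set d := M 1 1 => dM.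
rewrite !mul0r !subr0 !addr0 => j0.
set s := _ ^+ 2 + _ ^+ 2.
have s0 : 0 < s.
  rewrite lt_neqAle addr_ge0 ?sqr_ge0// andbT eq_sym paddr_eq0 ?sqr_ge0// !sqrf_eq0.
  apply: contra j0 => /andP[h1 h2].
  by rewrite eq_complex /= !mul0r subr0 !addr0 h1 h2.
rewrite (_ : _ + _ = (a * d - b * c) * y / s); last by ring.
by rewrite divr_gt0// mulr_gt0.
Qed.

(** The cocycle relation, which makes [slash] an action. *)
Lemma autjM M K z : autj K z != 0 ->
  autj (M *m K) z = autj M (mobius K z) * autj K z.
Proof.
move=> j0; have e : mobius K z * autj K z = (K 0 0)%:C * z + (K 0 1)%:C by exact: divfK.
rewrite [autj M _]/autj mulrDl -mulrA e /autj !mulmx2E !rmorphD !rmorphM /=; ring.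
Qed.

Lemma mobiusM M K z : 0 < \det M -> 0 < \det K -> 0 < complex.Im z ->
  mobius (M *m K) z = mobius M (mobius K z).
Proof.
move=> dM dK z0; have j0 := autj_neq0 dK z0.
have j1 := autj_neq0 dM (mobius_im dK z0).
have e : mobius K z * autj K z = (K 0 0)%:C * z + (K 0 1)%:C by exact: divfK.
rewrite {1}/mobius autjM// [RHS]/mobius; apply: (mulIf (mulf_neq0 j1 j0)).
rewrite divfK ?mulf_neq0// mulrA divfK// mulrDl -mulrA e /autj.
rewrite !mulmx2E !rmorphD !rmorphM /=; ring.
Qed.

Lemma slashM f M K z : 0 < \det M -> 0 < \det K -> 0 < complex.Im z ->
  slash k f (M *m K) z = slash k (slash k f M) K z.
Proof.
move=> dM dK z0; have j0 := autj_neq0 dK z0.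
by rewrite !slashE mobiusM// autjM// normrM invfM mulrACA expfzMl -mulrA mulrCA.
Qed.
End Slash.

Section SlashAction.
Variables (R : realType) (k : int).
Implicit Types (f h F C : R[i] -> R[i]) (z : R[i]) (M K : 'M[R]_2) (g : 'M[int]_2).

Lemma eqH_sym f h : eqH f h -> eqH h f. Proof. by move=> e z z0; rewrite e. Qed.
Lemma eqH_trans f h F : eqH f h -> eqH h F -> eqH f F.
Proof. by move=> e1 e2 z z0; rewrite e1 ?e2. Qed.

Lemma slash_ext f h M : 0 < \det M -> eqH f h -> eqH (slash k f M) (slash k h M).
Proof. by move=> dM e z z0; rewrite !slashE e// mobius_im. Qed.

Lemma slash_lin (a b : R[i]) f h M z :
  slash k (fun w => a * f w + b * h w) M z = a * slash k f M z + b * slash k h M z.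
Proof. by rewrite !slashE mulrDr; congr (_ + _); rewrite mulrCA. Qed.

Lemma slash_upper f (Y t : R) z : slash k f (mx2 Y t 0 1) z = f (Y%:C * z + t%:C).
Proof.
have j1 : autj (mx2 Y t 0 1) z = 1 by rewrite /autj !mx2E mul0r add0r.
by rewrite slashE /mobius j1 !mx2E normr1 !divr1 exp1rz mul1r.
Qed.

Lemma slash1 f z : slash k f 1%:M z = f z.
Proof. by rewrite -mx2_scalar1 slash_upper mul1r addr0. Qed.

(* Every element of SL(2, R) with lower left entry N is n(a) n'(N) n(b), and
   these generate SL(2, R). *)
Lemma SL2_invariant F (N : R) : N != 0 ->
  (forall t, eqH (slash k F (mx2 1 t 0 1)) F) -> eqH (slash k F (mx2 1 0 N 1)) F ->
  forall M, \det M = 1 -> eqH (slash k F M) F.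
Proof.
move=> N0 Fn FN; pose P M := \det M = 1 /\ eqH (slash k F M) F.
have PM M K : P M -> P K -> P (M *m K).
  move=> [d1 e1] [d2 e2]; split; first by rewrite det_mulmx d1 d2 mulr1.
  move=> z z0; rewrite slashM ?d1 ?d2//.
  by rewrite (slash_ext _ e1) ?d2// e2.
have Pn t : P (mx2 1 t 0 1).
  by split; [rewrite det_mx2 !mx2E mulr1 mulr0 subr0|exact: Fn].
have PN : P (mx2 1 0 N 1) by split; [rewrite det_mx2 !mx2E mulr1 mul0r subr0|].
have P1 a b c d : a * d - b * c = 1 -> c = N -> P (mx2 a b c d).
  move=> dt cN; rewrite (_ : mx2 a b c d =
      mx2 1 ((a - 1) / N) 0 1 *m mx2 1 0 N 1 *m mx2 1 ((d - 1) / N) 0 1).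
    by exact: PM (PM _ _ (Pn _) PN) (Pn _).
  have -> : b = (a * d - 1) / N by rewrite -dt cN; field.
  by rewrite !mul_mx2 cN; congr mx2; field.
have P2 a b c d : a * d - b * c = 1 -> c != 0 -> P (mx2 a b c d).
  (* Multiplying by the inverse of (1, (e - 1) / N; N, e) on the right gives lower left entry c e -
     d N, which is N for this e. *)
  move=> dt c0; pose e := N * (1 + d) / c.
  have -> : mx2 a b c d = mx2 (a * e - b * N) (b - a * ((e - 1) / N)) N (d - c * ((e - 1) / N))
      *m mx2 1 ((e - 1) / N) N e.
    by rewrite mul_mx2 /e; congr mx2; field; rewrite ?N0 ?c0.
  apply: PM; apply: P1 => //; last by field.
  by transitivity (a * d - b * c) => //; rewrite /e; field; rewrite N0 c0.
move=> M d1; suff [] : P M by [].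
have [c0|c0] := eqVneq (M 1 0) 0; last first.
  by rewrite (mx2_eta M); apply: P2 => //; rewrite -det_mx2.
have d0 : M 1 1 != 0.
  by apply/eqP => d0; move: d1; rewrite det_mx2 c0 d0 !mulr0 subrr => /eqP; rewrite eq_sym oner_eq0.
(* An upper triangular M is split off the Weyl element, so that both factors have nonzero lower left
   entry. *)
rewrite (_ : M = mx2 (M 0 1) (- M 0 0) (M 1 1) (- M 1 0) *m mx2 0 1 (-1) 0).
  apply: PM; apply: P2; rewrite ?oppr_eq0 ?oner_eq0//.
    by rewrite -d1 det_mx2 c0; ring.
  by ring.
by rewrite mul_mx2 {1}(mx2_eta M); congr mx2; ring.
Qed.

End SlashAction.

(** * Invariance and the level *)

Section IntegralSlash.
Variables (R : realType) (k : int).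
Implicit Types (f h F C : R[i] -> R[i]) (z : R[i]) (g : 'M[int]_2).

Lemma det_intr g : \det (map_mx intr g : 'M[R]_2) = (\det g)%:~R.
Proof. by rewrite det_map_mx. Qed.

Lemma det_intr_gt0 g : \det g = 1 -> 0 < \det (map_mx intr g : 'M[R]_2).
Proof. by move=> d1; rewrite det_intr d1 ltr01. Qed.

Lemma slashZM f (g1 g2 : 'M[int]_2) : \det g1 = 1 -> \det g2 = 1 ->
  eqH (slashZ k f (g1 *m g2)) (slashZ k (slashZ k f g1) g2).
Proof. by move=> d1 d2 z z0; rewrite /slashZ map_mxM slashM// det_intr_gt0. Qed.

Lemma slashZ_ext f h g : \det g = 1 -> eqH f h -> eqH (slashZ k f g) (slashZ k h g).
Proof. by move=> d1 e; apply: slash_ext => //; exact: det_intr_gt0. Qed.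

Lemma slashZ_lin (a b : R[i]) f h g z :
  slashZ k (fun w => a * f w + b * h w) g z = a * slashZ k f g z + b * slashZ k h g z.
Proof. exact: slash_lin. Qed.

Lemma slashZ_inverse f h g : \det g = 1 -> eqH (slashZ k f g) h -> eqH f (slashZ k h (invmx g)).
Proof.
move=> d1 e z z0; have ug : g \in unitmx by rewrite unitmxE d1 unitr1.
have di : \det (invmx g) = 1 by rewrite det_inv d1 invr1.
rewrite -(slashZ_ext di e)// -slashZM// mulmxV//.
by rewrite /slashZ map_mx1 slash1.
Qed.

Arguments slashZ_ext {f h g}.

Definition lower (y : int) : 'M[int]_2 := mx2 1 0 y 1.
Definition upper (x : int) : 'M[int]_2 := mx2 1 x 0 1.

Lemma det_lower y : \det (lower y) = 1.
Proof. by rewrite det_mx2 !mx2E mulr1 mul0r subr0. Qed.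

Lemma det_upper x : \det (upper x) = 1.
Proof. by rewrite det_mx2 !mx2E mulr1 mulr0 subr0. Qed.

Lemma lowerD y1 y2 : lower y1 *m lower y2 = lower (y1 + y2).
Proof. by rewrite mul_mx2; congr mx2; ring. Qed.

Lemma lower_inv y : invmx (lower y) = lower (- y).
Proof. by rewrite invmx2 ?det_lower// !mx2E oppr0. Qed.

Definition SL2Z_invariant F := forall g, \det g = 1 -> eqH (slashZ k F g) F.

Lemma SL2Z_invariant_lin a b f h : SL2Z_invariant f -> SL2Z_invariant h ->
  SL2Z_invariant (fun z => a * f z + b * h z).
Proof. by move=> ef eh g d1 z z0; rewrite slashZ_lin ef// eh. Qed.

Lemma SL2Z_invariantZ a f : SL2Z_invariant f -> SL2Z_invariant (fun z => a * f z).
Proof.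
move=> ef g d1 z z0; have := slashZ_lin a 0 f f g z; rewrite ef// mul0r addr0 => <-.
by congr (slashZ k _ g z); apply/funext => w; rewrite mul0r addr0.
Qed.

Lemma SL2Z_invariant_ext f h : eqH f h -> SL2Z_invariant f -> SL2Z_invariant h.
Proof.
by move=> e ef g d1 z z0; rewrite -(slashZ_ext d1 e)// ef// e.
Qed.

Lemma SL2Z_invariant0 : SL2Z_invariant (fun=> 0).
Proof. by move=> g d1 z z0; rewrite /slashZ slashE mulr0. Qed.

End IntegralSlash.

Arguments slashZ_ext {R k f h g}.

Section Level.
Variables (R : realType) (k : int) (N : nat) (chi : int -> R[i]) (f : R[i] -> R[i]).
Hypothesis N0 : (0 < N)%N.
Hypothesis hchi : dirichlet_character N chi.
Hypothesis hf : forall (g : 'M[int]_2) (z : R[i]), Gamma0 N g -> 0 < complex.Im z ->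
  slashZ k f g z = chi (g 1 1) * f z.
Local Notation inv := (@SL2Z_invariant R k).
Local Notation "F |[ g ]" := (slashZ k F g) (at level 9, g at level 200).

Lemma chi_mod (a b : int) : (a = b %[mod N])%Z -> chi a = chi b.
Proof.
case: hchi => _ _ hp _.
have hn (n : nat) (x : int) : chi (x + n%:Z * N%:Z) = chi x.
  elim: n x => [|n IH] x; first by rewrite mul0r addr0.
  by rewrite -addn1 PoszD mulrDl mul1r addrA hp IH.
have hz (m : int) x : chi (x + m * N%:Z) = chi x.
  case: m => n; first exact: hn.
  by rewrite NegzE -(hn n.+1) mulNr subrK.
by move=> e; rewrite (divz_eq a N) (divz_eq b N) e ![_ * _ + _]addrC !hz.
Qed.

Lemma chi_cong1 (a : int) : (N%:Z %| a - 1)%Z -> chi a = 1.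
Proof.
by rewrite -eqz_mod_dvd => /eqP/chi_mod ->; case: hchi.
Qed.

Lemma slash_Gamma0_1 g : \det g = 1 -> (N%:Z %| g 1%R 0%R)%Z -> (N%:Z %| g 1%R 1%R - 1)%Z ->
  eqH (f|[g]) f.
Proof. by move=> d1 c0 e z z0; rewrite hf// chi_cong1// mul1r. Qed.

Lemma slash_lower_nat y psi C (m : nat) : inv C ->
  eqH (f|[lower y]) (fun z => psi * f z + C z) ->
  exists2 C', inv C' & eqH (f|[lower (m%:Z * y)]) (fun z => psi ^+ m * f z + C' z).
Proof.
move=> iC h; elim: m => [|m [C' iC' IH]].
  exists (fun=> 0); first exact: SL2Z_invariant0.
  by move=> z z0; rewrite mul0r expr0 mul1r addr0 /slashZ map_mx2 mx2_scalar1 slash1.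
exists (fun z => psi ^+ m * C z + 1 * C' z); first exact: SL2Z_invariant_lin.
have eS : lower (m.+1%:Z * y) = lower (m%:Z * y) *m lower y.
  by rewrite lowerD; congr lower; rewrite -addn1 PoszD mulrDl mul1r.
move=> z z0; rewrite eS.
rewrite slashZM ?det_lower// (slashZ_ext (det_lower y) IH)//.
have -> : (fun z => psi ^+ m * f z + C' z) = (fun z => psi ^+ m * f z + 1 * C' z).
  by apply/funext => w; rewrite mul1r.
by rewrite slashZ_lin h// iC' ?det_lower// exprSr mulrDr mulrA addrA.
Qed.

(* Conjugation by an element of Gamma_0(N) with lower right entry u multiplies y by
   u^2, up to an element of Gamma_1(N). *)
Lemma slash_lower_square y (u : int) psi C : coprimez u N -> inv C ->
  eqH (f|[lower y]) (fun z => psi * f z + C z) ->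
  exists2 C', inv C' & eqH (f|[lower (u ^+ 2 * y)]) (fun z => psi * f z + C' z).
Proof.
move=> cuN iC h.
(* The upper right entry of [sg] is taken to be N, so that modulo N conjugation by [sg] only
   rescales y; coprimality of u to N^2 provides the remaining entries. *)
have [s [c1 e]] : exists s c1 : int, s * u - N%:Z * (N%:Z * c1) = 1.
  have : coprimez u (N%:Z ^+ 2) by rewrite coprimezXr.
  move=> /coprimezP[[a b] /= e]; exists a, (- b); rewrite -e; ring.
pose sg : 'M[int]_2 := mx2 s N%:Z (N%:Z * c1) u.
have dsg : \det sg = 1 by rewrite det_mx2 !mx2E.
have di : invmx sg = mx2 u (- N%:Z) (- (N%:Z * c1)) s by rewrite invmx2// !mx2E.
have dL := det_lower.
pose X := lower (u ^+ 2 * y) *m sg *m lower (- y) *m invmx sg.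
have dX : \det X = 1 by rewrite !det_mulmx det_inv dsg !dL invr1 !mulr1.
have x10 : X 1 0 = - (u ^+ 3 * y ^+ 2) * N%:Z.
  transitivity (u ^+ 2 * y * (s * u - N%:Z * (N%:Z * c1) - 1) - u ^+ 3 * y ^+ 2 * N%:Z).
    by rewrite /X di !mul_mx2 !mx2E; ring.
  by rewrite e; ring.
have x11 : X 1 1 - 1 = (u ^+ 2 * y ^+ 2 * N%:Z + y * u) * N%:Z.
  transitivity ((s * u - N%:Z * (N%:Z * c1)) + u ^+ 2 * y ^+ 2 * N%:Z ^+ 2 + y * u * N%:Z - 1).
    by rewrite /X di !mul_mx2 !mx2E; ring.
  by rewrite e; ring.
have fX : eqH (f|[X]) f.
  by apply: slash_Gamma0_1 => //; rewrite ?x10 ?x11 dvdz_mull.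
have us1 : chi u * chi s = 1.
  case: hchi => chi1 chiM _ _; rewrite -chiM; apply: chi_cong1.
  by apply/dvdzP; exists (N%:Z * c1); rewrite -e; ring.
have fsg : eqH (f|[sg]) (fun z => chi u * f z).
  by move=> z z0; rewrite hf ?mx2E//; split => //; rewrite mx2E dvdz_mulr.
have dsgi : \det (invmx sg) = 1 by rewrite det_inv dsg invr1.
have fsgi : eqH (f|[invmx sg]) (fun z => chi s * f z).
  move=> z z0; rewrite hf//; first by rewrite di mx2E.
  by split => //; rewrite di mx2E -mulrN dvdz_mulr.
have eX : lower (u ^+ 2 * y) = X *m sg *m lower y *m invmx sg.
  have usg : sg \in unitmx by rewrite unitmxE dsg unitr1.
  rewrite /X mulmxKV// -[_ *m _ *m lower y]mulmxA lowerD addNr.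
  rewrite (_ : lower 0 = 1%:M) ?mulmx1 ?mulmxK//.
  exact: mx2_scalar1.
exists (fun z => chi u * C z).
  exact: SL2Z_invariantZ.
have d2 : \det (X *m sg) = 1 by rewrite det_mulmx dX dsg mulr1.
have d3 : \det (X *m sg *m lower y) = 1 by rewrite det_mulmx d2 dL mulr1.
move=> z z0; rewrite eX slashZM//.
have h2 : eqH (f|[X *m sg *m lower y]) (fun z => (chi u * psi) * f z + chi u * C z).
  move=> w w0; rewrite slashZM//.
  have h3 : eqH (f|[X *m sg]) (fun z => chi u * f z + 0 * f z).
    move=> v v0; rewrite slashZM// (slashZ_ext dsg fX)// fsg//.
    by rewrite mul0r addr0.
  rewrite (slashZ_ext (dL _) h3)// slashZ_lin mul0r addr0 h//.
  by rewrite mulrDr mulrA.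
rewrite (slashZ_ext dsgi h2)// slashZ_lin fsgi// iC//.
by congr (_ + _); rewrite mulrACA us1 mul1r.
Qed.

Hypothesis f_ninv : ~ inv f.

(* Comparison with the (u^2)-th power of lower y gives psi^(u^2 - 1) = 1. *)
Lemma slash_lower_unipotent y (u : nat) psi C : (1 < u)%N -> coprime u N -> inv C ->
  eqH (f|[lower y]) (fun z => psi * f z + C z) ->
  eqH (f|[lower ((u%:Z ^+ 2 - 1) * y)]) f.
Proof.
move=> u1 cuN iC h.
have psi0 : psi != 0.
  apply/eqP => psi0; apply: f_ninv.
  have hC : eqH (f|[lower y]) C by move=> z z0; rewrite h// psi0 mul0r add0r.
  apply: (SL2Z_invariant_ext (eqH_sym (slashZ_inverse (det_lower y) hC))).
  have di : \det (invmx (lower y)) = 1 by rewrite det_inv det_lower invr1.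
  by apply: (SL2Z_invariant_ext _ iC) => z z0; rewrite iC.
(* As f is not SL(2, Z)-invariant, scalars can be compared modulo invariant functions. *)
have prop a D : inv D -> eqH (fun z => a * f z) D -> a = 0.
  move=> iD e; apply/eqP; apply/negPn/negP => a0; apply: f_ninv.
  have : inv (fun z => a^-1 * D z) by exact: SL2Z_invariantZ.
  by apply: SL2Z_invariant_ext => z z0; rewrite -e// mulKf.
have [C1 iC1 h1] := @slash_lower_square y u%:Z psi C cuN iC h.
have [C2 iC2 h2] := slash_lower_nat (u ^ 2) iC h.
have u2 : (u ^ 2)%N%:Z = u%:Z ^+ 2 by rewrite !expr2 -PoszM.
have upos : (0 < u ^ 2)%N by rewrite expn_gt0 (ltnW u1).
have psiE : psi ^+ (u ^ 2) - psi = 0.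
  apply: (prop _ (fun z => 1 * C1 z + -1 * C2 z)); first exact: SL2Z_invariant_lin.
  move=> z z0; have := h1 z z0; rewrite -u2 h2// => e.
  by rewrite mulrBl -[psi ^+ _ * f z](addrK (C2 z)) e; ring.
have psi1 : psi ^+ (u ^ 2).-1 = 1.
  apply: (mulfI psi0); rewrite mulr1 -exprS prednK//.
  by apply/eqP; rewrite -subr_eq0 psiE.
have [C3 iC3] := slash_lower_nat (u ^ 2).-1 iC h.
rewrite psi1 (_ : (u ^ 2).-1%:Z = u%:Z ^+ 2 - 1); last first.
  by rewrite -u2; case: (u ^ 2)%N upos => // n _ /=; rewrite -addn1 PoszD addrK.
set Y := _ * y => h3.
(* The invariant remainder C3 accumulates linearly, but lower (N Y) lies in Gamma_1(N) and fixes f;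
   hence N C3 = 0. *)
have mulC (m : nat) : eqH (f|[lower (m%:Z * Y)]) (fun z => f z + m%:R * C3 z).
  elim: m => [|m IH] z z0.
    by rewrite mul0r /slashZ map_mx2 mx2_scalar1 slash1 mul0r addr0.
  have eS : lower (m.+1%:Z * Y) = lower (m%:Z * Y) *m lower Y.
    by rewrite lowerD; congr lower; rewrite -addn1 PoszD mulrDl mul1r.
  rewrite eS slashZM ?det_lower//.
  have {}IH : eqH (f|[lower (m%:Z * Y)]) (fun z => 1 * f z + m%:R * C3 z).
    by move=> w w0; rewrite mul1r IH.
  rewrite (slashZ_ext (det_lower _) IH)// slashZ_lin h3// iC3 ?det_lower//.
  by rewrite -(natr1 m); ring.
have C30 z : 0 < complex.Im z -> C3 z = 0.
  move=> z0; have := mulC N z z0; rewrite slash_Gamma0_1 ?det_lower ?mx2E ?dvdz_mulr ?subrr//.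
  rewrite -[X in X = _]addr0 => /addrI/esym/eqP; rewrite mulf_eq0 pnatr_eq0.
  by rewrite eqn0Ngt N0 => /eqP.
by move=> z z0; rewrite h3// C30// mul1r addr0.
Qed.

Lemma slash_lower_add y1 y2 : eqH (f|[lower y1]) f -> eqH (f|[lower y2]) f ->
  eqH (f|[lower (y1 + y2)]) f.
Proof.
move=> h1 h2 z z0; rewrite -lowerD slashZM ?det_lower//.
by rewrite (slashZ_ext (det_lower _) h1)// h2.
Qed.

Lemma slash_lower_mul y (m : int) : eqH (f|[lower y]) f -> eqH (f|[lower (m * y)]) f.
Proof.
move=> h; have hn (n : nat) : eqH (f|[lower (n%:Z * y)]) f.
  elim: n => [|n IH]; first by move=> z z0; rewrite mul0r /slashZ map_mx2 mx2_scalar1 slash1.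
  by rewrite -addn1 PoszD mulrDl mul1r; exact: slash_lower_add.
case: m => n; first exact: hn.
rewrite NegzE mulNr -lower_inv => z z0.
by rewrite -(slashZ_inverse (det_lower _) (hn n.+1)).
Qed.

Lemma slash_upper_int x : eqH (f|[upper x]) f.
Proof. by apply: slash_Gamma0_1; rewrite ?det_upper ?mx2E ?subrr. Qed.

(** * Descent from level N to level N / q *)

Section Descent.
Variable q : nat.
Hypothesis pq : prime q.
Hypothesis qN : (q %| N)%N.
Let e := (N %/ q)%N.
Hypothesis fe : forall m : int, eqH (f|[lower (m * e%:Z)]) f.

Let NE : N = (e * q)%N. Proof. by rewrite /e divnK. Qed.

(** Left multiplication by some lower (w e) moves g into Gamma_0(N) when its upper left entry is
    prime to q. Otherwise upper 1 is applied first, which replaces a by a + c: q cannot divide both,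
    as the determinant is 1. *)
Lemma Gamma0_descent (g : 'M[int]_2) : Gamma0 e g ->
  exists d, [/\ coprimez d N, (d = g 1%R 1%R %[mod e])%Z & eqH (f|[g]) (fun z => chi d * f z)].
Proof.
have key (h : 'M[int]_2) : Gamma0 e h -> coprimez (h 0 0) q ->
    exists d, [/\ coprimez d N, (d = h 1%R 1%R %[mod e])%Z & eqH (f|[h]) (fun z => chi d * f z)].
  move=> [dh /dvdzP[c ec]] /coprimezP[[x y] /= exy].
  (* x inverts the upper left entry modulo q, so that w h00 + c is divisible by q. *)
  pose w := - c * x.
  have dl := det_lower (w * e%:Z).
  pose h' := lower (w * e%:Z) *m h.
  have dh' : \det h' = 1 by rewrite det_mulmx dl dh.
  have h'10 : h' 1 0 = y * c * N%:Z.
    rewrite /h' mulmx2E !mx2E ec mul1r NE PoszM -[c in X in _ + X]mulr1 -exy /w; ring.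
  have h'11 : h' 1 1 = h 1 1 + w * h 0 1 * e%:Z.
    by rewrite /h' mulmx2E !mx2E mul1r addrC; congr (_ + _); ring.
  exists (h' 1 1); split.
  - apply/coprimezP; exists (h' 0 0, - (h' 0 1 * y * c)) => /=.
    by rewrite -dh' [in RHS]det_mx2 h'10; ring.
  - by apply/eqP; rewrite h'11 addrC modzMDl.
  - move=> z z0; rewrite -hf//; last by split=> //; rewrite h'10 dvdz_mull.
    by rewrite /h' slashZM// (slashZ_ext dh (fe w)).
move=> [dg eg]; have [cp|ncp] := boolP (coprimez (g 0 0) q); first exact: key.
have du := det_upper 1.
have dg' : \det (upper 1 *m g) = 1 by rewrite det_mulmx du dg.
have g'10 : (upper 1 *m g) 1 0 = g 1 0 by rewrite mulmx2E !mx2E mul0r add0r mul1r.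
have g'11 : (upper 1 *m g) 1 1 = g 1 1 by rewrite mulmx2E !mx2E mul0r add0r mul1r.
have [||d [d1 d2 d3]] := key (upper 1 *m g).
- by split=> //; rewrite g'10.
- rewrite mulmx2E !mx2E !mul1r.
  have qa : (q%:Z %| g 0%R 0%R)%Z.
    by move: ncp; rewrite coprimez_sym coprimezE prime_coprime// negbK.
  rewrite coprimez_sym coprimezE prime_coprime//.
  apply/negP => h; have {}h : (q%:Z %| (g 0 0 + g 1 0)%R)%Z by [].
  have qc : (q%:Z %| g 1%R 0%R)%Z.
    by rewrite (_ : g 1%R 0%R = g 0 0 + g 1 0 - g 0 0)%R ?rpredB//; ring.
  have : (q%:Z %| 1%R)%Z by rewrite -dg det_mx2; apply: rpredB; [exact: dvdz_mulr|exact: dvdz_mull].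
  by rewrite dvdz1 /= => /eqP q1; move: pq; rewrite q1.
exists d; split=> //; first by rewrite d2 g'11.
move=> z z0; rewrite -d3// slashZM// (slashZ_ext dg (slash_upper_int 1))//.
Qed.

(** With a = 1 + t e an inverse of d modulo N, the word lower (- d e) upper t lower e lies in
    Gamma_0(N) with lower right entry d modulo N. Each of its factors fixes f, so chi d = 1. *)
Lemma chi_descent d : (exists z, 0 < complex.Im z /\ f z != 0) ->
  coprimez d N -> (d = 1 %[mod e])%Z -> chi d = 1.
Proof.
move=> [z [z0 fz]] cd /eqP; rewrite eqz_mod_dvd => /dvdzP[t0 et0].
have [a [b eab]] : exists a b : int, a * d = 1 + b * N%:Z.
  by move/coprimezP: cd => [[x y] /= exy]; exists x, (- y); rewrite -exy; ring.
have [t et] : exists t, a = 1 + t * e%:Z.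
  exists (b * q%:Z - a * t0).
  apply/eqP; rewrite -subr_eq0; apply/eqP.
  transitivity ((a * d - 1 - b * (e%:Z * q%:Z)) - a * (d - 1 - t0 * e%:Z)); first ring.
  by rewrite et0 eab NE PoszM; ring.
pose X := lower (- d * e%:Z) *m upper t *m lower (1 * e%:Z).
have dX : \det X = 1 by rewrite !det_mulmx !det_lower det_upper.
have dX1 : \det (lower (- d * e%:Z) *m upper t) = 1 by rewrite !det_mulmx !det_lower det_upper.
have fX : eqH (f|[X]) f.
  move=> w w0; rewrite slashZM ?det_lower//.
  have h1 : eqH (f|[lower (- d * e%:Z) *m upper t]) f.
    move=> v v0; rewrite slashZM ?det_lower ?det_upper//.
    by rewrite (slashZ_ext (det_upper _) (fe _))// slash_upper_int.
  by rewrite (slashZ_ext (det_lower _) h1)// fe.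
have X10 : X 1 0 = - (e%:Z * b) * N%:Z.
  rewrite /X !mul_mx2 !mx2E; transitivity (e%:Z * (1 - (1 + t * e%:Z) * d)); first ring.
  by rewrite -et eab; ring.
have X11 : X 1 1 = d - b * N%:Z.
  rewrite /X !mul_mx2 !mx2E; transitivity (1 + d - (1 + t * e%:Z) * d); first ring.
  by rewrite -et eab; ring.
have : chi (X 1 1) * f z = f z.
  by rewrite -hf ?fX//; split=> //; rewrite X10 dvdz_mull.
rewrite X11 (@chi_mod _ d); last by rewrite -mulNr addrC modzMDl.
by rewrite -[RHS]mul1r => /(mulIf fz).
Qed.

Lemma transforms_descent : transforms_under_Gamma0 k f e.
Proof.
have [z0 [z00 fz0]] : exists z, 0 < complex.Im z /\ f z != 0.
  apply: contrapT => /forallNP h; apply: f_ninv.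
  apply: (SL2Z_invariant_ext _ (@SL2Z_invariant0 R k)) => z z0.
  by apply/esym/eqP/negPn/negP => fz; apply: (h z).
(* Reading the character off at a point where f does not vanish makes it independent of the choice
   of d in [Gamma0_descent]. *)
pose xi g := f|[g] z0 / f z0.
have xiE g d : eqH (f|[g]) (fun z => chi d * f z) -> xi g = chi d.
  by move=> h; rewrite /xi h// mulfK.
have chiN0 d : coprimez d N -> chi d != 0 by case: hchi => _ _ _ ->.
exists xi; last first.
  move=> g z /Gamma0_descent[d [_ _ h]] zp.
  by rewrite (xiE _ _ h) h.
split=> [g h Gg Gh|g /Gamma0_descent[d [cd _ hd]]|g [Gg _ g11]].
- have [d [_ _ hd]] := Gamma0_descent Gg; have [d' [_ _ hd']] := Gamma0_descent Gh.
  rewrite (xiE _ _ hd) (xiE _ _ hd') /xi slashZM//; try by case: Gg; case: Gh.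
  have hd2 : eqH (f|[g]) (fun z => chi d * f z + 0 * f z).
    by move=> z zp; rewrite hd// mul0r addr0.
  rewrite (slashZ_ext _ hd2)//; last by case: Gh.
  by rewrite slashZ_lin hd'// mul0r addr0 mulrA mulfK.
- by rewrite (xiE _ _ hd) chiN0.
- have [d [cd dg hd]] := Gamma0_descent Gg.
  by rewrite (xiE _ _ hd) (@chi_descent d)//; [exists z0|rewrite dg].
Qed.

End Descent.

(** The cofactor N / gcd(Y, N) must be divisible by q, since otherwise the gcd would contain the
    full power of q in N. *)
Lemma gcdn_proper_dvd q Y : prime q -> (q %| N)%N ->
  ~~ (q ^ logn q N %| Y)%N -> (gcdn Y N %| N %/ q)%N.
Proof.
move=> pq qN nY; have /dvdnP[m Nm] := dvdn_gcdr Y N.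
have g0 : (0 < gcdn Y N)%N by rewrite gcdn_gt0 N0 orbT.
have m0 : (0 < m)%N by move: N0; rewrite Nm muln_gt0 => /andP[].
have qm : (q %| m)%N.
  apply: contraNT nY => qm.
  have -> : logn q N = logn q (gcdn Y N).
    by rewrite [in LHS]Nm lognM// lognE pq m0 (negbTE qm).
  exact: dvdn_trans (pfactor_dvdnn q _) (dvdn_gcdl Y N).
have /dvdnP[m' em] := qm; have {2}-> : N = (m' * gcdn Y N * q)%N by rewrite mulnAC -em.
by rewrite mulnK ?prime_gt0// dvdn_mull.
Qed.

Hypothesis hlevel : has_level k f N.

(** The integers m for which lower m fixes f form a group. It contains N and (u^2 - 1) y, hence
    their gcd, hence N / q. *)
Lemma level_contradiction q (y : int) (u : nat) (c1 c2 : R[i]) : prime q ->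
  (1 < u)%N -> coprime u N ->
  ~~ (q ^ logn q N %| `|((u%:Z ^+ 2 - 1) * y)%R|)%N ->
  (c1 != 0) || (c2 != 0) ->
  inv (fun z => c1 * f|[lower y] z + c2 * f z) -> False.
Proof.
move=> pq u1 cuN nY c12 iH.
have qN : (q %| N)%N.
  by apply: contraNT nY => qN; rewrite lognE pq N0 (negbTE qN).
have c10 : c1 != 0.
  apply/eqP => c10; move: c12; rewrite c10 eqxx /= => c20; apply: f_ninv.
  apply: SL2Z_invariant_ext (SL2Z_invariantZ c2^-1 iH) => z z0.
  by rewrite c10 mul0r add0r mulKf.
have h : eqH (f|[lower y]) (fun z => - (c1^-1 * c2) * f z +
    c1^-1 * (c1 * f|[lower y] z + c2 * f z)).
  by move=> z z0; rewrite mulrDr mulKf// mulNr mulrA addrCA addNr addr0.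
have fY := slash_lower_unipotent u1 cuN (SL2Z_invariantZ c1^-1 iH) h.
set Y := _ * y in fY nY.
have fN : eqH (f|[lower N%:Z]) f.
  by apply: slash_Gamma0_1; rewrite ?det_lower ?mx2E ?subrr.
have [r [s ers]] : exists r s : int, r * Y + s * N%:Z = (gcdn `|Y| N)%:Z.
  by have [r [s e]] := Bezoutz Y N%:Z; exists r, s.
have /dvdnP[m em] := gcdn_proper_dvd pq qN nY.
have fe (n : int) : eqH (f|[lower (n * (N %/ q)%N%:Z)]) f.
  apply: slash_lower_mul; rewrite em PoszM -ers.
  by apply: slash_lower_mul; apply: slash_lower_add; exact: slash_lower_mul.
have tr := transforms_descent pq qN fe.
have [_ _ /(_ (N %/ q)%N _ tr)] := hlevel.
have q0 := prime_gt0 pq.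
rewrite divn_gt0// dvdn_leq// => /(_ isT).
by rewrite leqNgt ltn_Pdiv// prime_gt1.
Qed.

End Level.

(** The trivial character makes level 1 admissible; for N > 1 this supplies the non-invariance of f
    assumed in the descent. *)
Lemma level_invariant (R : realType) (k : int) (N : nat) (f : R[i] -> R[i]) :
  has_level k f N -> SL2Z_invariant k f -> N = 1%N.
Proof.
move=> [N0 _ hl] fi; apply/eqP; rewrite eqn_leq N0 andbT; apply: hl => //.
exists (fun=> 1).
  by split=> *; rewrite ?mul1r// oner_neq0.
by move=> g z [dg _] z0; rewrite mul1r fi.
Qed.

(** * Whittaker functions as Fourier coefficients *)

Section PadicCongruence.
Variables (p : prime_num) (N : nat).
Implicit Types (x y : padic p) (A B : 'M[padic p]_2).

Definition padic_cong x y := exists2 z, Zint p z & x - y = N%:R * z.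
Definition Zint_mx A := forall i j, Zint p (A i j).
Definition padic_cong_mx A B := forall i j, padic_cong (A i j) (B i j).

Lemma padic_cong_refl x : padic_cong x x.
Proof. by exists 0; [exact: Zint0|rewrite subrr mulr0]. Qed.

Lemma padic_congD x y x' y' : padic_cong x x' -> padic_cong y y' ->
  padic_cong (x + y) (x' + y').
Proof.
move=> [a Za ea] [b Zb eb]; exists (a + b); first exact: ZintD.
by rewrite mulrDr -ea -eb; ring.
Qed.

Lemma padic_congM x y x' y' : Zint p x -> Zint p y' ->
  padic_cong x x' -> padic_cong y y' -> padic_cong (x * y) (x' * y').
Proof.
move=> Zx Zy [a Za ea] [b Zb eb]; exists (x * b + a * y').
  by apply: ZintD; exact: ZintM.
by rewrite mulrDr mulrCA -eb mulrA -ea; ring.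
Qed.

Lemma padic_cong_mulmx A B A' B' : Zint_mx A -> Zint_mx B' ->
  padic_cong_mx A A' -> padic_cong_mx B B' -> padic_cong_mx (A *m B) (A' *m B').
Proof.
by move=> ZA ZB cA cB i j; rewrite !mulmx2E; apply: padic_congD; apply: padic_congM.
Qed.

Lemma Zint_mulmx A B : Zint_mx A -> Zint_mx B -> Zint_mx (A *m B).
Proof. by move=> ZA ZB i j; rewrite mulmx2E; apply: ZintD; exact: ZintM. Qed.

Lemma Zint_map_intr (M : 'M[int]_2) : Zint_mx (map_mx intr M).
Proof. by move=> i j; rewrite mxE; exact: Zint_int. Qed.

Lemma Zint_mx2 x y x' y' : Zint p x -> Zint p y -> Zint p x' -> Zint p y' ->
  Zint_mx (mx2 x y x' y').
Proof. by move=> *; apply: ord2P; apply: ord2P; rewrite mx2E. Qed.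

Lemma padic_cong_mx2 x y x' y' a b a' b' : padic_cong x a -> padic_cong y b ->
  padic_cong x' a' -> padic_cong y' b' -> padic_cong_mx (mx2 x y x' y') (mx2 a b a' b').
Proof. by move=> *; apply: ord2P; apply: ord2P; rewrite !mx2E. Qed.

Lemma padic_cong_mx_refl A : padic_cong_mx A A.
Proof. by move=> i j; exact: padic_cong_refl. Qed.

Lemma padic_cong_trans x y y' : padic_cong x y -> padic_cong y y' -> padic_cong x y'.
Proof.
move=> [a Za ea] [b Zb eb]; exists (a + b); first exact: ZintD.
by rewrite mulrDr -ea -eb; ring.
Qed.

End PadicCongruence.

Lemma cexpDz (R : realType) (x : R) (m : int) : cexp (x + m%:~R) = cexp x.
Proof.
have e : 2 * pi = pi *+ 2 :> R by rewrite mulr_natl.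
have c1 (y : R) : cexp (y + 1) = cexp y.
  by rewrite /cexp mulrDr mulr1 e (cosD (_ * y)) (sinD (_ * y)) cos2pi sin2pi !mulr0 !mulr1 subr0 addr0.
have cn (n : nat) (y : R) : cexp (y + n%:R) = cexp y.
  elim: n y => [|n IH] y; first by rewrite addr0.
  by rewrite -(natr1 n) addrA c1 IH.
case: m => n; first by rewrite -pmulrn cn.
by rewrite NegzE mulrNz -pmulrn -(cn n.+1) subrK.
Qed.

Lemma ccontinuous_cexp (R : realType) (j : int) (N : nat) :
  ccontinuous (fun x : R => cexp (- (j%:~R * x / N%:R))).
Proof.
have ca : continuous (fun x : R => 2 * pi * (- (j%:~R * x / N%:R))).
  apply: continuousM_fun; first exact: continuous_cst_fun.
  apply: continuousN_fun; apply: continuousM_fun; last exact: continuous_cst_fun.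
  by apply: continuousM_fun; [exact: continuous_cst_fun|move=> x; exact: cvg_id].
by split=> x; apply: (continuous_comp (ca x)); [exact: continuous_cos|exact: continuous_sin].
Qed.

Lemma ratr_padic_neq0 (p : prime_num) (e : rat) : e != 0 -> (ratr e : padic p) != 0.
Proof.
by move=> e0; rewrite /ratr mulf_neq0 ?invr_eq0 ?padic_intr_eq0 ?numq_eq0 ?denq_neq0.
Qed.

Section AdelicPoints.
Variables (R : realType) (n : nat) (g : 'M[int]_2).
Hypothesis n0 : (0 < n)%N.
Hypothesis dg : \det g = 1.

(** Specified by components, because [adele_of] only asserts the existence of an adele with given
    components. *)
Definition adelic_point (e : rat) (Y : R) (X : 'M[adele R]_2) :=
  [/\ X \in unitmx, mx_inf X = mx2 Y 0 0 1 &
    forall p : prime_num, mx_fin X p =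
      mx2 (if (p %| n)%N then ratr e else 1) 0 0 1 *m map_mx intr (invmx g)].

Lemma mx_infM (A B : 'M[adele R]_2) : mx_inf (A *m B) = mx_inf A *m mx_inf B.
Proof. exact: (map_mxM (@adele_inf R)). Qed.

Lemma mx_finM (A B : 'M[adele R]_2) p : mx_fin (A *m B) p = mx_fin A p *m mx_fin B p.
Proof. exact: (map_mxM (@adele_at R p)). Qed.

Lemma mx_inf2 (a b c d : adele R) :
  mx_inf (mx2 a b c d) = mx2 (adele_inf a) (adele_inf b) (adele_inf c) (adele_inf d).
Proof. exact: map_mx2. Qed.

Lemma mx_fin2 (a b c d : adele R) p :
  mx_fin (mx2 a b c d) p = mx2 (adele_at p a) (adele_at p b) (adele_at p c) (adele_at p d).
Proof. exact: (map_mx2 (@adele_at R p)). Qed.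

Lemma mx_inf_intr (M : 'M[int]_2) : mx_inf (map_mx intr M : 'M[adele R]_2) = map_mx intr M.
Proof. by apply/matrixP => i j; rewrite !mxE (rmorph_int (@adele_inf R)). Qed.

Lemma mx_fin_intr (M : 'M[int]_2) p :
  mx_fin (map_mx intr M : 'M[adele R]_2) p = map_mx intr M.
Proof. by apply/matrixP => i j; rewrite !mxE; exact: (rmorph_int (@adele_at R p)). Qed.

Lemma adelic_point_exists e Y : e != 0 -> Y != 0 -> exists X, adelic_point e Y X.
Proof.
move=> e0 Y0.
have ratr0 p : (ratr e : padic p) != 0 by exact: ratr_padic_neq0.
pose x (p : prime_num) : padic p := if (p %| n)%N then ratr e else 1.
have fin (y : forall p : prime_num, padic p) :
    (forall p : prime_num, ~~ (p %| n)%N -> Zint p (y p)) ->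
    finite_set [set p : prime_num | ~ Zint p (y p)].
  move=> h; apply: (@finite_prime_num _ n) => p np; apply: dvdn_leq => //.
  by apply: contrapT => /negP /h.
have [|a [aY ax]] := @adele_of R Y x.
  by apply: fin => p /negbTE; rewrite /x => ->; exact: Zint1.
have ua : a \is a GRing.unit.
  apply: adele_unit; first by rewrite aY.
    by move=> p; rewrite ax /x; case: ifP => _; [exact: ratr0|exact: oner_neq0].
  apply: fin => p /negbTE pn; rewrite ax /x pn invr1; exact: Zint1.
have entry (r : R) (m : int) : exists b : adele R, adele_inf b = r /\ forall p, adele_at p b = m%:~R.
  exact: adele_const.
pose h := invmx g.
have dh : \det h = 1 by rewrite det_inv dg invr1.
have [b00 [i00 p00]] := entry 1 (h 0 0).
have [b01 [i01 p01]] := entry 0 (h 0 1).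
have [b10 [i10 p10]] := entry 0 (h 1 0).
have [b11 [i11 p11]] := entry 1 (h 1 1).
pose H := mx2 b00 b01 b10 b11.
have dH : \det H = 1.
  rewrite det_mx2 !mx2E; apply: adele_ext => [|p].
    rewrite (rmorphB (@adele_inf R)) !(rmorphM (@adele_inf R)) /= i00 i01 i10 i11.
    by rewrite mulr1 mul0r subr0.
  rewrite (rmorphB (@adele_at R p)) !(rmorphM (@adele_at R p)) /= p00 p01 p10 p11.
  by rewrite -!intrM -intrB -det_mx2 dh (rmorph1 (@adele_at R p)).
have HE p : mx_fin H p = map_mx intr h.
  by rewrite mx_fin2 p00 p01 p10 p11; apply: mx2_ext; rewrite !mxE.
exists (mx2 a 0 0 1 *m H); split.
- by rewrite unitmxE det_mulmx dH mulr1 det_mx2 !mx2E mulr1 mulr0 subr0.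
- rewrite mx_infM !mx_inf2 i00 i01 i10 i11 aY rmorph0 rmorph1 mx2_scalar1 mulmx1//.
- by move=> p; rewrite mx_finM mx_fin2 HE ax (rmorph0 (@adele_at R p)) (rmorph1 (@adele_at R p)).
Qed.

End AdelicPoints.

(** * The Whittaker function at these points *)

Section WhittakerValue.
Variables (R : realType) (k : int) (N : nat) (chi : int -> R[i]) (f : R[i] -> R[i]).
Variables (mu : {measure set (adeleB R) -> \bar R}) (phi : 'M[adele R]_2 -> R[i]).
Hypothesis N0 : (0 < N)%N.
Hypothesis hmu : haar_measure mu.
Hypothesis hphi : adelic_lift k N chi f phi.
Variables (n : nat) (g : 'M[int]_2).
Hypothesis dg : \det g = 1.

(** For integral v the fractional part is a rational integer, so only the real component matters.
    The free m will be the residue class i of v. *)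
Lemma adele_char_int (v : adele R) (m : int) : (forall p, Zint p (adele_at p v)) ->
  adele_char (- v) = cexp (- (adele_inf v - m%:~R)).
Proof.
move=> Zv; rewrite /adele_char.
have /rat_Zint[m' ->] : forall p, Zint p (ratr (adele_frac (- v))).
  move=> p; have : forall p, Zint p (adele_fin (- v) p - ratr (adele_frac (- v))).
    rewrite /adele_frac; apply: (xgetPex 0
      (P := [set r : rat | forall p, Zint p (adele_fin (- v) p - ratr r)])).
    exists 0 => q; rewrite (ratr_int _ 0) subr0 -[adele_fin _ _]/(adele_at q (- v)).
    by rewrite (rmorphN (@adele_at R q)); apply: ZintN; exact: Zv.
  move=> /(_ p) h; have := ZintB (ZintN (Zv p)) h.
  rewrite -[adele_fin _ _]/(adele_at p (- v)) (rmorphN (@adele_at R p)) /=.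
  by rewrite opprB addrCA subrr addr0.
rewrite ratr_int (rmorphN (@adele_inf R)) /= -(cexpDz _ (m + m')) intrD.
by congr cexp; ring.
Qed.

(** All that [whittaker_value] uses of e is its class e0 modulo N; this allows e to be replaced by t
    e with t congruent to 1. *)
Definition level_residue (e : rat) (e0 : int) := forall p : prime_num, (p %| n)%N ->
  padic_cong N (ratr e : padic p) e0%:~R /\ Zint p (ratr e)^-1.

(* At every p, the component of t g X, for an adelic point X, lies in K_0(N) and has
   lower right entry d modulo N. *)
Definition cusp_twist (e0 d : int) (t : 'M[int]_2) := forall p : prime_num,
  let h := if (p %| n)%N then t *m g *m mx2 e0 0 0 1 *m invmx g else t in
  padic_cong N ((h 1 0)%:~R : padic p) 0 /\ padic_cong N ((h 1 1)%:~R : padic p) d%:~R.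

Lemma map_intrK (A : comUnitRingType) (M : 'M[int]_2) : \det M = 1 ->
  map_mx intr (invmx M) *m map_mx intr M = 1%:M :> 'M[A]_2.
Proof. by move=> d1; rewrite -map_mxM mulVmx ?map_mx1// unitmxE d1 unitr1. Qed.

(* The rational factor of n(v) diag(j / N, 1) X in GL(2, Q) GL(2, R)^+ prod_p K_0(N)_p
   is n(i) diag(j / N, 1) (t g)^-1. *)
Lemma phi_value (e : rat) (e0 d : int) (t : 'M[int]_2) (Y : R) X (j : int) v (i : int) :
  e != 0 -> 0 < Y -> \det t = 1 -> j != 0 -> level_residue e e0 -> cusp_twist e0 d t ->
  adelic_point n g e Y X -> residue_class `|j| i v ->
  phi (mx2 1 v 0 1 *m (map_mx ratr (mx2 (j%:~R / N%:R) 0 0 1) *m X)) =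
  slashZ k f (t *m g) (((adele_inf v - i%:~R) * (N%:R / j%:~R)) +i* Y) * (chi d)^-1.
Proof.
move=> e_neq0 Y0 dt j0 he ht [uX Xinf Xfin] vi.
have au := @adele_intr_unit R.
pose T := t *m g; have dT : \det T = 1 by rewrite det_mulmx dt dg mulr1.
pose al : rat := j%:~R / N%:R.
have al0 : al != 0 by rewrite mulf_neq0 ?invr_eq0 ?intr_eq0// pnatr_eq0 -lt0n.
(* Moving diag(j / N, 1) to the left of n(v - i) turns v - i into w. At p it lies in N Z_p, since v
   - i is in j Z_p; its real component is the abscissa of the point in the upper half-plane. *)
pose w : adele R := (v - i%:~R) * ratr al^-1.
have wE : ratr al * w = v - i%:~R.
  by rewrite /w mulrCA -(ratrM_unit au) mulfV// (ratr_int _ 1) mulr1.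
pose gQ : 'M[rat]_2 := mx2 al i%:~R 0 1 *m map_mx intr (invmx T).
pose G : 'M[adele R]_2 := map_mx intr T *m (mx2 1 w 0 1 *m X).
have r0 : ratr 0 = 0 :> adele R by rewrite (ratr_int _ 0).
have r1 : ratr 1 = 1 :> adele R by rewrite (ratr_int _ 1).
have ratr_intr (M : 'M[int]_2) : map_mx ratr (map_mx intr M : 'M[rat]_2) = map_mx intr M :> 'M[adele R]_2.
  by apply/matrixP => a b; rewrite !mxE ratr_int.
have eG : mx2 1 v 0 1 *m (map_mx ratr (mx2 al 0 0 1) *m X) = map_mx ratr gQ *m G.
  rewrite /gQ /G (map_ratr_mulmx au) ratr_intr -mulmxA (mulmxA _ _ (mx2 1 w 0 1 *m X)).
  rewrite map_intrK// mul1mx !mulmxA; congr (_ *m X).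
  have mr (a b c d' : rat) : map_mx ratr (mx2 a b c d') = mx2 (ratr a) (ratr b) (ratr c) (ratr d') :> 'M[adele R]_2.
    by apply: mx2_ext; rewrite !mxE.
  rewrite !mr !mul_mx2 !r0 !r1 ratr_int !(mul0r, mulr0, mul1r, mulr1, addr0, add0r) wE.
  by rewrite subrK.
have ugQ : gQ \in unitmx.
  rewrite unitmxE !det_mulmx det_map_mx det_inv dT invr1 !det_mx2 !mx2E.
  by rewrite !(mulr1, mulr0, subr0, mul1r) unitfE.
have uG : G \in unitmx.
  rewrite unitmxE !det_mulmx det_map_mx dT mul1r det_mx2 !mx2E mulr1 mulr0 subr0 mul1r.
  by rewrite -unitmxE.
have winf : adele_inf w = (adele_inf v - i%:~R) * (N%:R / j%:~R).
  rewrite /w (rmorphM (@adele_inf R)) (rmorphB (@adele_inf R)) /= (rmorph_int (@adele_inf R)).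
  rewrite (rmorph_ratr au (@adele_inf R)) /al invf_div; congr (_ * _).
  by rewrite pmulrn (ratr_div (A := R)) ?pmulrn// => d' d'0; rewrite unitfE intr_eq0.
have Ginf : mx_inf G = map_mx intr T *m mx2 Y (adele_inf w) 0 1.
  rewrite /G !mx_infM mx_inf_intr Xinf mx_inf2 mul_mx2.
  rewrite (rmorph0 (@adele_inf R)) (rmorph1 (@adele_inf R)).
  by rewrite !(mul0r, mulr0, mul1r, mulr1, addr0, add0r).
have dTR : \det (map_mx intr T : 'M[R]_2) = 1 by rewrite det_map_mx dT.
have dY : \det (mx2 Y (adele_inf w) 0 1) = Y by rewrite det_mx2 !mx2E mulr1 mulr0 subr0.
have wp p : exists2 z, Zint p z & adele_at p w = N%:R * z.
  have [z Zz ez] := vi p.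
  have au' := @padic_intr_unit p.
  have : ratr al * adele_at p w = `|j|%:R * z.
    rewrite -ez -(rmorph_ratr au (@adele_at R p)) -(rmorphM (@adele_at R p)) wE.
    by rewrite (rmorphB (@adele_at R p)) /= (rmorph_int (@adele_at R p)).
  have jp : (j%:~R : padic p) != 0 by rewrite padic_intr_eq0.
  have Np : (N%:R : padic p) != 0 by rewrite padic_natr_eq0 -lt0n.
  have -> : ratr al = j%:~R / N%:R :> padic p.
    by rewrite /al pmulrn (ratr_div au') -?pmulrn// eqz_nat -lt0n.
  move=> h.
  have [s Zs js] : exists2 s, Zint p s & `|j|%:R = j%:~R * s.
    case: (j) => m; first by exists 1; [exact: Zint1|rewrite mulr1].
    exists (- 1); first by apply: ZintN; exact: Zint1.
    by rewrite NegzE mulrNz mulrN1 opprK.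
  exists (s * z); first exact: ZintM.
  by apply: (mulfI (mulf_neq0 jp (invr_neq0 Np))); rewrite h js [RHS]mulrA divfK// mulrA.
have Gfin p : mx_fin G p = map_mx intr T *m (mx2 1 (adele_at p w) 0 1 *m
    (mx2 (if (p %| n)%N then ratr e else 1) 0 0 1 *m map_mx intr (invmx g))).
  by rewrite /G !mx_finM mx_fin_intr Xfin mx_fin2 (rmorph0 (@adele_at R p)) (rmorph1 (@adele_at R p)).
have Ze p : Zint p (if (p %| n)%N then ratr e else 1).
  case: ifP => [/he[[z Zz ez] _]|_]; last exact: Zint1.
  by rewrite -[ratr e](subrK e0%:~R) ez; apply: ZintD; [apply: ZintM => //; exact: Zint_nat|exact: Zint_int].
have Zw p : Zint p (adele_at p w).
  by have [z Zz ->] := wp p; apply: ZintM => //; exact: Zint_nat.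
(* Modulo N the factor n(w) disappears and e becomes e0, which leaves the matrix of [cusp_twist]. *)
have Gcong p : padic_cong_mx N (mx_fin G p)
    (map_mx intr (if (p %| n)%N then t *m g *m mx2 e0 0 0 1 *m invmx g else t)).
  have -> : map_mx intr (if (p %| n)%N then t *m g *m mx2 e0 0 0 1 *m invmx g else t) =
     map_mx intr T *m (1%:M *m (mx2 (if (p %| n)%N then e0%:~R else 1) 0 0 1 *m
       map_mx intr (invmx g))) :> 'M[padic p]_2.
    case: ifP => _.
      rewrite -/T -mulmxA map_mxM [map_mx intr (mx2 _ _ _ _ *m _)]map_mxM mul1mx.
      by congr (_ *m (_ *m _)); apply: mx2_ext; rewrite !mxE.
    by rewrite mx2_scalar1 !mul1mx -map_mxM /T -mulmxA mulmxV ?mulmx1// unitmxE dg unitr1.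
  rewrite Gfin; have Zi := @Zint_map_intr p.
  have Z2 (x : padic p) : Zint p x -> Zint_mx (mx2 x 0 0 1) by move=> Zx; exact: Zint_mx2 Zx (Zint0 p) (Zint0 p) (Zint1 p).
  have cE : padic_cong_mx N (mx2 (if (p %| n)%N then ratr e else 1) 0 0 1)
      (mx2 (if (p %| n)%N then e0%:~R else 1) 0 0 1 : 'M[padic p]_2).
    apply: padic_cong_mx2; try exact: padic_cong_refl.
    by case: ifP => [pn|_]; [exact: (he p pn).1|exact: padic_cong_refl].
  have ZE' : Zint_mx (mx2 (if (p %| n)%N then e0%:~R else 1) 0 0 1 : 'M[padic p]_2).
    by apply: Z2; case: ifP => _; [exact: Zint_int|exact: Zint1].
  have cw : padic_cong_mx N (mx2 1 (adele_at p w) 0 1) (1%:M : 'M[padic p]_2).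
    rewrite -mx2_scalar1; apply: padic_cong_mx2; try exact: padic_cong_refl.
    by have [z Zz ez] := wp p; exists z => //; rewrite subr0.
  have c3 := padic_cong_mulmx (Z2 _ (Ze p)) (Zi (invmx g)) cE (padic_cong_mx_refl N _).
  have c2 := padic_cong_mulmx (Zint_mx2 (Zint1 p) (Zw p) (Zint0 p) (Zint1 p))
    (Zint_mulmx ZE' (Zi (invmx g))) cw c3.
  apply: (padic_cong_mulmx (Zi T) _ (padic_cong_mx_refl N _) c2).
  by rewrite mul1mx; exact: Zint_mulmx ZE' (Zi (invmx g)).
have val : slash k f (mx_inf G) (0 +i* 1) =
    slashZ k f T (((adele_inf v - i%:~R) * (N%:R / j%:~R)) +i* Y).
  have T0 : 0 < \det (map_mx intr T : 'M[R]_2) by rewrite dTR ltr01.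
  have Y0' : 0 < \det (mx2 Y (adele_inf w) 0 1) by rewrite dY.
  have i0 : 0 < complex.Im (0 +i* 1 : R[i]) by exact: ltr01.
  have ei : Y%:C * (0 +i* 1) + (adele_inf w)%:C = adele_inf w +i* Y.
    by apply: complex_ext; rewrite /= !(mulr0, mul0r, mulr1, add0r, addr0, subr0, oppr0).
  by rewrite Ginf (slashM k f T0 Y0' i0) slash_upper ei winf.
rewrite eG (hphi (d := d) ugQ uG).
- by rewrite val.
- by rewrite Ginf det_mulmx dTR dY mul1r.
- move=> p; split.
  + move=> a b; rewrite Gfin; apply: Zint_mulmx; first exact: Zint_map_intr.
    apply: Zint_mulmx; first exact: Zint_mx2 (Zint1 p) (Zw p) (Zint0 p) (Zint1 p).
    apply: Zint_mulmx; last exact: Zint_map_intr.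
    exact: Zint_mx2 (Ze p) (Zint0 p) (Zint0 p) (Zint1 p).
  + exists (if (p %| n)%N then (ratr e)^-1 else 1).
      by case: ifP => [/he[]|_] //; exact: Zint1.
    rewrite Gfin !det_mulmx !det_map_mx dT det_inv dg invr1 !det_mx2 !mx2E.
    rewrite !(mulr0, mul0r, mulr1, mul1r, subr0).
    case: ifP => [/he[[z Zz ez] _]|_]; last by rewrite mulr1.
    by rewrite mulfV// ratr_padic_neq0.
  + have [h0 _] := ht p; have := padic_cong_trans (Gcong p 1 0); rewrite mxE => /(_ _ h0).
    by case=> z Zz; rewrite subr0 => ez; exists z.
- move=> p; have [_ h1] := ht p; have := padic_cong_trans (Gcong p 1 1); rewrite mxE.
  exact.
Qed.

Hypothesis fcont : forall (h : 'M[int]_2) (Y : R), \det h = 1 -> 0 < Y ->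
  ccontinuous (fun t => slashZ k f h (t +i* Y)).

(** By [phi_value] and [adele_char_int] the integrand on the class i modulo |j| depends only on
    (v_inf - i) N / j, as [integral_adele_fdom] requires; the result is the j-th Fourier coefficient
    of f|t g for the period N. *)
Lemma whittaker_value (e : rat) (e0 d : int) (t : 'M[int]_2) (Y : R) X (j : int) :
  e != 0 -> 0 < Y -> \det t = 1 -> j != 0 -> level_residue e e0 -> cusp_twist e0 d t ->
  adelic_point n g e Y X ->
  whittaker mu phi (map_mx ratr (mx2 (j%:~R / N%:R) 0 0 1) *m X) =
  (chi d)^-1 * (N%:R^-1)%:C *
    cintegral N (fun x => slashZ k f (t *m g) (x +i* Y) * cexp (- (j%:~R * x / N%:R))).
Proof.
move=> e0' Y0 dt j0 he ht hX.
have Nr : (N%:R : R) != 0 by rewrite pnatr_eq0 -lt0n.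
have jr : (j%:~R : R) != 0 by rewrite intr_eq0.
pose P x := slashZ k f (t *m g) (x +i* Y) * cexp (- (j%:~R * x / N%:R)).
have cP : ccontinuous P.
  apply: ccontinuousM; last exact: ccontinuous_cexp.
  by apply: fcont => //; rewrite det_mulmx dt dg mulr1.
(* The zero summand gives Q the shape of [cintegral_lin]. *)
pose Q x := (chi d)^-1 * P x + 0 * P x.
have cQ : ccontinuous Q.
  by apply: ccontinuousD; apply: ccontinuousM => //; exact: ccontinuous_cst.
have FE v i : 0 <= adele_inf v < 1 -> residue_class `|j| i v ->
    phi (mx2 1 v 0 1 *m (map_mx ratr (mx2 (j%:~R / N%:R) 0 0 1) *m X)) * adele_char (- v) =
    Q ((adele_inf v - i%:~R) * (N%:R / j%:~R)).
  move=> _ vi; rewrite (phi_value e0' Y0 dt j0 he ht hX vi).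
  rewrite (@adele_char_int v i); last first.
    move=> p; have [z Zz ez] := vi p; rewrite -[adele_at p v](subrK i%:~R) ez.
    by apply: ZintD; [apply: ZintM => //; exact: Zint_nat|exact: Zint_int].
  rewrite /Q mul0r addr0 /P mulrAC [RHS]mulrC; congr (_ * cexp _ * _).
  by field; rewrite Nr jr.
have -> : whittaker mu phi (map_mx ratr (mx2 (j%:~R / N%:R) 0 0 1) *m X) =
    (N%:R^-1)%:C * cintegral N Q.
  rewrite /whittaker (@integral_adele_fdom R mu hmu N j _ (fun x => complex.Re (Q x)) N0 j0 cQ.1); last first.
    by move=> v i v01 vi; rewrite (FE v i v01 vi).
  rewrite (@integral_adele_fdom R mu hmu N j _ (fun x => complex.Im (Q x)) N0 j0 cQ.2); last first.
    by move=> v i v01 vi; rewrite (FE v i v01 vi).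
  by apply: complex_ext; rewrite /cintegral /= ?mul0r ?subr0 ?addr0.
by rewrite cintegral_lin// mul0r addr0 mulrA [_%:C * _]mulrC.
Qed.

End WhittakerValue.

(** * Multiplicativity *)

Section SlashContinuity.
Variables (R : realType) (k : int) (f : R[i] -> R[i]).
Hypothesis fsmooth : smooth_upper f.

Lemma smooth_comp_ccontinuous (w : R -> R[i]) : ccontinuous w ->
  (forall t, 0 < complex.Im (w t)) -> ccontinuous (fun t => f (w t)).
Proof.
move=> [w1 w2] w0; have [[fr _] [fi _]] := fsmooth 0.
have cw (t : R) : {for t, continuous (fun t => (complex.Re (w t), complex.Im (w t)))}.
  exact: (cvg_pair (w1 t) (w2 t)).
have e t : f (w t) = in_coords f (complex.Re (w t), complex.Im (w t)).
  by rewrite /in_coords /=; case: (w t).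
split=> t.
  rewrite (_ : (fun t => _) = (fun p => complex.Re (in_coords f p)) \o
      (fun t => (complex.Re (w t), complex.Im (w t)))); last by apply/funext => x; rewrite /= -e.
  exact: (continuous_comp (cw t) (fr (complex.Re (w t), complex.Im (w t)) (w0 t))).
rewrite (_ : (fun t => _) = (fun p => complex.Im (in_coords f p)) \o
    (fun t => (complex.Re (w t), complex.Im (w t)))); last by apply/funext => x; rewrite /= -e.
exact: (continuous_comp (cw t) (fi (complex.Re (w t), complex.Im (w t)) (w0 t))).
Qed.

Lemma slash_ccontinuous (h : 'M[int]_2) (Y : R) : \det h = 1 -> 0 < Y ->
  ccontinuous (fun t => slashZ k f h (t +i* Y)).
Proof.
move=> dh Y0; have dM := det_intr_gt0 R dh; set M := map_mx intr h in dM.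
have cz : ccontinuous (fun t : R => t +i* Y).
  by split=> [t|]; [exact: cvg_id|exact: continuous_cst_fun].
have cl (a b : R) : ccontinuous (fun t => a%:C * (t +i* Y) + b%:C).
  apply: ccontinuousD; last exact: ccontinuous_cst.
  by apply: ccontinuousM => //; exact: ccontinuous_cst.
have jn0 t : autj M (t +i* Y) != 0 by exact: autj_neq0.
have cj : ccontinuous (fun t => autj M (t +i* Y)) by exact: cl.
apply: (ccontinuousM (F := fun t => (autj M (t +i* Y) / `|autj M (t +i* Y)|) ^ (- k))
  (G := fun t => f (mobius M (t +i* Y)))).
  apply: ccontinuous_exprz => [|t].
    apply: ccontinuousM => //; apply: ccontinuous_inv; first exact: ccontinuous_norm.
    by move=> t; rewrite normr_eq0.
  by rewrite mulf_neq0 ?invr_eq0 ?normr_eq0.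
apply: smooth_comp_ccontinuous => [|t]; last exact: mobius_im.
by apply: ccontinuousM => //; exact: ccontinuous_inv.
Qed.

End SlashContinuity.

(** * Valuations and multiplicative functions on the rationals *)

Section RatVal.
Variable p : nat.
Hypothesis pp : prime p.

Lemma rat_val_div (a b : int) : a != 0 -> b != 0 ->
  rat_val p (a%:~R / b%:~R) = (logn p `|a|)%:Z - (logn p `|b|)%:Z.
Proof.
move=> a0 b0; set r : rat := _ / _.
have r0 : r != 0 by rewrite mulf_neq0 ?invr_eq0 ?intr_eq0.
have e : numq r * b = a * denq r.
  by apply: (@intr_inj rat); rewrite !intrM numqE mulrAC divfK // intr_eq0.
have := congr1 (fun x : int => logn p `|x|) e; rewrite /= !abszM.
rewrite !lognM ?absz_gt0 ?numq_eq0 ?denq_neq0// /rat_val.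
by move=> h; lia.
Qed.

Lemma rat_valM (r s : rat) : r != 0 -> s != 0 -> rat_val p (r * s) = rat_val p r + rat_val p s.
Proof.
have [a [b [b0 ->]]] := rat_intP r; have [c [d [d0 ->]]] := rat_intP s.
rewrite !mulf_eq0 !invr_eq0 !intr_eq0 (negbTE b0) (negbTE d0) !orbF => a0 c0.
rewrite mulf_div -!intrM !rat_val_div ?mulf_neq0// !abszM !lognM ?absz_gt0//.
rewrite !PoszD; ring.
Qed.

Lemma rat_val_nat (n : nat) : (0 < n)%N -> rat_val p n%:R = (logn p n)%:Z.
Proof.
move=> n0; have := @rat_val_div n%:Z 1; rewrite divr1 -pmulrn => -> //.
  by rewrite /= logn1 subr0.
by rewrite -lt0n in n0 *; case: n n0.
Qed.

End RatVal.

Section FiniteProducts.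
Variable (R : realType).
Implicit Types F G : prime_num -> R[i].
Lemma fsprod_support F (A : set prime_num) : (forall p, ~ A p -> F p = 1) ->
  \big[*%R/1]_(p \in [set: prime_num]) F p = \big[*%R/1]_(p \in A) F p.
Proof. by move=> h; apply/esym/fsbig_widen => // p /= [_ /h]. Qed.

Lemma fsprodM F G (A : set prime_num) : finite_set A ->
  (forall p, ~ A p -> F p = 1) -> (forall p, ~ A p -> G p = 1) ->
  \big[*%R/1]_(p \in [set: prime_num]) (F p * G p) =
  (\big[*%R/1]_(p \in [set: prime_num]) F p) * (\big[*%R/1]_(p \in [set: prime_num]) G p).
Proof.
move=> fA hF hG; rewrite (fsprod_support hF) (fsprod_support hG).
rewrite (@fsprod_support (fun p => F p * G p) A) => [|p Ap].
  exact: fsbig_split.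
by rewrite hF// hG// mulr1.
Qed.

(** The local factors agree prime by prime: where p divides u both x and y have valuation 0, so the
    two sides differ by a swap; at the other primes u changes nothing. The signs agree because u >
    0. *)
Lemma multiplicative_cross (h : rat -> R[i]) (x y : rat) (u : nat) :
  multiplicative_rat h -> x != 0 -> y != 0 -> (0 < u)%N ->
  (forall p : prime_num, (p %| u)%N -> rat_val p x = 0 /\ rat_val p y = 0) ->
  h (x * u%:R) * h y = h x * h (y * u%:R).
Proof.
move=> [hinf [hp [fin hE]]] x0 y0 u0 hxy.
have ur : u%:R != 0 :> rat by rewrite pnatr_eq0 -lt0n.
have up : 0 < u%:R :> rat by rewrite ltr0n.
have finz (z : rat) : z != 0 -> finite_set [set p : prime_num | rat_val p z != 0].
  move=> z0; apply: (@finite_prime_num _ (`|numq z| + `|denq z|)%N) => p pz.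
  have [pn|pn] := boolP (p %| `|numq z|)%N.
    by apply: leq_trans (leq_addr _ _); apply: dvdn_leq => //; rewrite absz_gt0 numq_eq0.
  have [pd|pd] := boolP (p %| `|denq z|)%N.
    by apply: leq_trans (leq_addl _ _); apply: dvdn_leq => //; rewrite absz_gt0 denq_neq0.
  move: pz; rewrite /rat_val (lognE p `|numq z|) (lognE p `|denq z|) (negbTE pn) (negbTE pd) !andbF subr0 eqxx //.
pose A : set prime_num := [set p | hp p 0 != 1] `|` ([set p : prime_num | rat_val p x != 0] `|`
  ([set p : prime_num | rat_val p y != 0] `|` [set p : prime_num | rat_val p u%:R != 0])).
have fA : finite_set A by rewrite !finite_setU; do !split => //; exact: finz.
have offA p : ~ A p -> [/\ hp p 0 = 1, rat_val p x = 0, rat_val p y = 0 & rat_val p u%:R = 0].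
  by move=> nA; split; apply/eqP/negPn/negP => h1; apply: nA; [left|right; left|right; right; left|right; right; right].
have vM z p : z != 0 -> rat_val (prime_val p) (z * u%:R) = rat_val p z + rat_val p u%:R.
  by move=> z0; rewrite rat_valM// prime_numP.
rewrite !hE ?mulf_neq0// !pmulr_lgt0//.
rewrite mulrACA [RHS]mulrACA; congr (_ * _).
rewrite -!(fsprodM fA).
- apply: eq_fsbigr => p _; rewrite !vM//.
  have [pu|pu] := boolP (prime_val p %| u)%N; first by have [-> ->] := hxy p pu; rewrite mulrC.
  by rewrite (rat_val_nat (prime_numP p) u0) lognE (negbTE pu) !andbF !addr0.
- by move=> p /offA[h0 -> _ _].
- by move=> p /offA[h0 _ h1 h2]; rewrite vM// h1 h2.
- by move=> p /offA[h0 h1 _ h2]; rewrite vM// h1 h2.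
- by move=> p /offA[h0 _ -> _].
Qed.

End FiniteProducts.

Lemma Zint_coprime_inv (p : prime_num) (N m : nat) : (p %| N)%N -> coprime m N ->
  Zint p (m%:R)^-1.
Proof. by move=> pN mN; apply: Zint_nat_inv; exact: coprime_dvdr pN mN. Qed.

(* Scaling by t makes j / N prime to u, so that multiplicativity applies to the product
   with u. *)
Lemma coprime_scaling (N u n : nat) (j : int) : (0 < N)%N -> (0 < u)%N -> coprime u N -> j != 0 ->
  (forall p : prime_num, (p %| n)%N -> (p %| N)%N) ->
  exists t : rat, [/\ t != 0, level_residue N n t 1, level_residue N n (t * u%:R) u%:Z &
    forall p : prime_num, (p %| u)%N -> rat_val p (j%:~R / N%:R * t) = 0].
Proof.
(* t is s / r, where r is the part of j supported on the primes of u, s = r modulo N and s = 1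
   modulo u: t is 1 modulo N and cancels exactly the primes of u from j. *)
move=> N0 u0 cuN j0 nN; pose r := ((absz j)`_(\pi(u)))%N.
have j0' : (0 < `|j|)%N by rewrite absz_gt0.
have r0 : (0 < r)%N by exact: part_gt0.
have crN : coprime r N.
  apply: pnat_coprime (part_pnat _ _) _; rewrite -coprime_pi'//.
have cNu : coprime N u by rewrite coprime_sym.
pose s := chinese N u r 1.
have sN : s = r %[mod N] by exact: chinese_modl.
have su : s = 1 %[mod u] by exact: chinese_modr.
have csN : coprime s N by rewrite -coprime_modl sN coprime_modl.
have csu : coprime s u by rewrite -coprime_modl su coprime_modl coprime1n.
(* Coprimality of s and u forces s > 0 only for u > 1, so u = 1 is treated apart, with t = 1. *)
have [u1|u1] := eqVneq u 1%N.
  exists 1; rewrite u1; split; rewrite ?mulr1 ?oner_neq0//.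
  - move=> p _; rewrite (ratr_int _ 1); split; first exact: padic_cong_refl.
    by rewrite invr1; exact: Zint1.
  - move=> p _; rewrite (ratr_int _ 1); split; first exact: padic_cong_refl.
    by rewrite invr1; exact: Zint1.
  - by move=> p; rewrite dvdn1 => /eqP p1; have := prime_numP p; rewrite p1.
have s0 : (0 < s)%N.
  by rewrite lt0n; apply: contraNneq u1 => s0; move: csu; rewrite s0 /coprime gcd0n.
have tE (p : prime_num) : ratr (s%:R / r%:R) = s%:R / r%:R :> padic p.
  have := @ratr_div _ (@padic_intr_unit p) s%:Z r%:Z; rewrite -!pmulrn; apply.
  by rewrite eqz_nat -lt0n.
have tuE (p : prime_num) : ratr (s%:R / r%:R * u%:R) = s%:R / r%:R * u%:R :> padic p.
  by rewrite (ratrM_unit (@padic_intr_unit p)) tE ratr_nat.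
have [m em] : exists m : int, s%:Z - r%:Z = m * N%:Z.
  by apply/dvdzP; rewrite -eqz_mod_dvd !modz_nat sN.
have Znat (p : prime_num) := @Zint_nat p.
have cong (p : prime_num) : (p %| N)%N -> padic_cong N (s%:R / r%:R : padic p) 1.
  move=> pN; have rp : (r%:R : padic p) != 0 by rewrite padic_natr_eq0 -lt0n.
  exists (m%:~R / r%:R).
    by apply: ZintM; [exact: Zint_int|exact: Zint_coprime_inv pN crN].
  have := congr1 (fun x : int => x%:~R : padic p) em; rewrite intrB intrM -!pmulrn => e.
  by rewrite mulrA [N%:R * _]mulrC -e mulrBl mulfV.
have cpN (p : prime_num) : (p %| n)%N -> [/\ coprime s N, coprime r N & (p %| N)%N] by move=> /nN.
exists (s%:R / r%:R); split.
- by rewrite mulf_neq0 ?invr_eq0 ?pnatr_eq0 -?lt0n.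
- move=> p /nN pN; rewrite tE; split; first exact: cong.
  by rewrite invf_div; apply: ZintM => //; exact: Zint_coprime_inv pN csN.
- move=> p /nN pN; rewrite tuE; split.
    rewrite -pmulrn -[X in padic_cong _ _ X]mul1r; apply: padic_congM.
    + by apply: ZintM => //; exact: Zint_coprime_inv pN crN.
    + exact: Znat.
    + exact: cong.
    + exact: padic_cong_refl.
  rewrite invfM invf_div; apply: ZintM; last exact: Zint_coprime_inv pN cuN.
  by apply: ZintM => //; exact: Zint_coprime_inv pN csN.
move=> p pu; have pp := prime_numP p.
have NZ : (N * r)%N%:Z != 0 by rewrite eqz_nat muln_eq0 negb_or -!lt0n N0.
have jsZ : j * s%:Z != 0 by rewrite mulf_neq0// eqz_nat -lt0n.
have -> : j%:~R / N%:R * (s%:R / r%:R) = (j * s%:Z)%:~R / (N * r)%N%:Z%:~R :> rat.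
  by rewrite mulf_div intrM -!pmulrn natrM.
rewrite rat_val_div// abszM /= !lognM//.
have nc (x : nat) : coprime x u -> logn p x = 0%N.
  by move=> cx; apply: logn_coprime; rewrite coprime_sym; exact: coprime_dvdr pu cx.
have pr : logn p r = logn p `|j|.
  rewrite -[LHS]logn_part /r partn_part ?logn_part// => q /eqnP ->.
  by rewrite mem_primes pp u0 pu.
by rewrite (nc N)// (nc s)// pr add0n addn0 subrr.
Qed.

(** Where om vanishes nothing has to be shown. Elsewhere [cross] says that the pairs (B(al), B(al
    u)) are proportional, so one nonzero pair supplies c1 and c2; if there is none, (1, 0) works. *)
Lemma proportional_values (R : realType) (N u n : nat) (B : rat -> R[i]) (om : int -> R -> R[i]) :
  (0 < N)%N -> (0 < u)%N -> coprime u N ->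
  (forall p : prime_num, (p %| n)%N -> (p %| N)%N) -> multiplicative_rat B ->
  (forall j Y t, j != 0 -> 0 < Y -> t != 0 -> level_residue N n t 1 -> om j Y != 0 ->
     B (j%:~R / N%:R * t) = B (j%:~R / N%:R)) ->
  (forall j Y t, j != 0 -> 0 < Y -> t != 0 -> level_residue N n (t * u%:R) u%:Z -> om j Y != 0 ->
     B (j%:~R / N%:R * (t * u%:R)) = B (j%:~R / N%:R * u%:R)) ->
  exists c1 c2 : R[i], (c1 != 0) || (c2 != 0) /\ forall j Y, j != 0 -> 0 < Y ->
    c1 * (om j Y * B (j%:~R / N%:R * u%:R)) = c2 * (om j Y * B (j%:~R / N%:R)).
Proof.
move=> N0 u0 cuN nN hB B1 Bu; pose al (j : int) : rat := j%:~R / N%:R.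
have al0 j : j != 0 -> al j != 0.
  by move=> j0; rewrite mulf_neq0 ?invr_eq0 ?intr_eq0// pnatr_eq0 -lt0n.
have cross j j' Y Y' : j != 0 -> j' != 0 -> 0 < Y -> 0 < Y' -> om j Y != 0 -> om j' Y' != 0 ->
    B (al j * u%:R) * B (al j') = B (al j) * B (al j' * u%:R).
  move=> j0 j'0 Y0 Y'0 o o'.
  have [t [t0 r1 r2 r3]] := coprime_scaling N0 u0 cuN j0 nN.
  have [t' [t'0 r1' r2' r3']] := coprime_scaling N0 u0 cuN j'0 nN.
  rewrite -(Bu j Y t)// -(Bu j' Y' t')// -(B1 j Y t)// -(B1 j' Y' t')// !mulrA.
  apply: (multiplicative_cross hB (mulf_neq0 (al0 _ j0) t0) (mulf_neq0 (al0 _ j'0) t'0) u0).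
  by move=> p pu; split; [exact: r3|exact: r3'].
have [[j' [Y' [j'0 Y'0 o' nz]]]|none] := pselect (exists j' Y', [/\ j' != 0, 0 < Y',
    om j' Y' != 0 & (B (al j') != 0) || (B (al j' * u%:R) != 0)]).
  exists (B (al j')), (B (al j' * u%:R)); split=> // j Y j0 Y0.
  have [om0|om0] := eqVneq (om j Y) 0; first by rewrite om0 !mul0r !mulr0.
  rewrite mulrCA [RHS]mulrCA; congr (_ * _).
  by rewrite mulrC (cross j j' Y Y')// mulrC.
exists 1, 0; split=> [|j Y j0 Y0]; first by rewrite oner_neq0.
rewrite mul1r mul0r; have [om0|om0] := eqVneq (om j Y) 0; first by rewrite om0 mul0r.
have [b|b] := eqVneq (B (al j * u%:R)) 0; first by rewrite b mulr0.
by exfalso; apply: none; exists j, Y; split=> //; rewrite b orbT.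
Qed.

(** * Proportionality of the two sequences of Whittaker values *)

Section Relation.
Variables (R : realType) (k : int) (N : nat) (chi : int -> R[i]) (f : R[i] -> R[i]).
Variables (mu : {measure set (adeleB R) -> \bar R}) (phi : 'M[adele R]_2 -> R[i]).
Variables (Winf : 'M[R]_2 -> R[i]) (Wp : forall p : prime_num, 'M[padic p]_2 -> R[i]).
Hypothesis N0 : (0 < N)%N.
Hypothesis hmu : haar_measure mu.
Hypothesis hphi : adelic_lift k N chi f phi.
Hypothesis hW : factors_as (whittaker mu phi) Winf Wp.
Hypothesis fcont : forall (h : 'M[int]_2) (Y : R), \det h = 1 -> 0 < Y ->
  ccontinuous (fun t => slashZ k f h (t +i* Y)).
Variables (n : nat) (g : 'M[int]_2).
Hypothesis n0 : (0 < n)%N.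
Hypothesis nN : forall p : prime_num, (p %| n)%N -> (p %| N)%N.
Hypothesis dg : \det g = 1.
Local Notation B := (cuspB Wp n g).

(** The local factors at infinity and at the primes not dividing n, which do not involve e. *)
Definition away_factor (al : rat) (Y : R) : R[i] := Winf (mx2 (ratr al * Y) 0 0 1) *
  \big[*%R/1]_(p \in [set: prime_num])
    (if (prime_val p %| n)%N then 1 else @Wp p (mx2 (ratr al) 0 0 1 *m map_mx intr (invmx g))).

(** At the primes dividing n, diag(al, 1) and diag(e, 1) merge into diag(al e, 1), and these factors
    make up B. *)
Lemma whittaker_factor (al e : rat) (Y : R) X : al != 0 -> adelic_point n g e Y X ->
  whittaker mu phi (map_mx ratr (mx2 al 0 0 1) *m X) = away_factor al Y * B (al * e).
Proof.
move=> al0 [uX Xinf Xfin]; have au := @adele_intr_unit R.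
have mr : map_mx ratr (mx2 al 0 0 1) = mx2 (ratr al) 0 0 1 :> 'M[adele R]_2.
  by apply: mx2_ext; rewrite !mxE ?(ratr_int _ 0) ?(ratr_int _ 1).
have u1 : ratr al \is a @GRing.unit (adele R).
  by apply/unitrPr; exists (ratr al^-1); rewrite -(ratrM_unit au) mulfV// (ratr_int _ 1).
have ug : map_mx ratr (mx2 al 0 0 1) *m X \in unitmx.
  rewrite unitmxE det_mulmx unitrM -[X in _ && X]unitmxE uX andbT mr det_mx2 !mx2E.
  by rewrite mulr1 mulr0 subr0.
have [fin ->] := hW ug.
have infE : mx_inf (map_mx ratr (mx2 al 0 0 1) *m X) = mx2 (ratr al * Y) 0 0 1.
  rewrite mx_infM Xinf mr mx_inf2 (rmorph_ratr au (@adele_inf R)) (rmorph0 (@adele_inf R)) (rmorph1 (@adele_inf R)).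
  by rewrite mul_mx2 !(mul0r, mulr0, mul1r, mulr1, addr0, add0r).
have finE p : mx_fin (map_mx ratr (mx2 al 0 0 1) *m X) p =
    mx2 (ratr al) 0 0 1 *m (mx2 (if (p %| n)%N then ratr e else 1) 0 0 1 *m map_mx intr (invmx g)).
  rewrite mx_finM Xfin mr mx_fin2 (rmorph_ratr au (@adele_at R p)).
  by rewrite (rmorph0 (@adele_at R p)) (rmorph1 (@adele_at R p)).
move: fin; rewrite infE /away_factor -mulrA => fin; congr (_ * _).
pose F p := @Wp p (mx_fin (map_mx ratr (mx2 al 0 0 1) *m X) p).
pose F1 (p : prime_num) := if (p %| n)%N then 1 else F p.
pose F2 (p : prime_num) := if (p %| n)%N then F p else 1.
pose A : set prime_num := [set p | F p != 1].
have offA p : ~ A p -> F p = 1 by move=> h; apply/eqP/negPn/negP.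
transitivity ((\big[*%R/1]_(p \in [set: prime_num]) F1 p) * \big[*%R/1]_(p \in [set: prime_num]) F2 p).
  rewrite -(@fsprodM _ _ _ A) => [|||].
  - apply: eq_fsbigr => p _; rewrite /F1 /F2 -/(F p).
    by case: ifP => _; rewrite ?mul1r ?mulr1.
  - exact: fin.
  - by move=> p /offA; rewrite /F1 => ->; case: ifP.
  - by move=> p /offA; rewrite /F2 => ->; case: ifP.
congr (_ * _).
  apply: eq_fsbigr => p _; rewrite /F1.
  case pn: (prime_val p %| n)%N; first by [].
  by rewrite /F finE pn mx2_scalar1 mul1mx.
rewrite (@fsprod_support _ F2 [set p : prime_num | (p %| n)%N]) => [|p /negP/negbTE]; last first.
  by rewrite /F2 => ->.
apply: eq_fsbigr => p; rewrite inE /= => pn; rewrite /F2 pn /F finE pn mulmxA mul_mx2.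
rewrite !(mul0r, mulr0, mul1r, mulr1, addr0, add0r).
by rewrite (ratrM_unit (@padic_intr_unit p)).
Qed.

Lemma cusp_twist1 : cusp_twist N n g 1 1 1%:M.
Proof.
move=> p /=; have -> : (if (p %| n)%N then 1%:M *m g *m mx2 1 0 0 1 *m invmx g else 1%:M) = 1%:M :> 'M[int]_2.
  by case: ifP => _ //; rewrite mx2_scalar1 mul1mx mulmx1 mulmxV// unitmxE dg unitr1.
by rewrite !mxE; split; exact: padic_cong_refl.
Qed.

Variables (u : nat) (d : int) (tau : 'M[int]_2).
Hypothesis u0 : (0 < u)%N.
Hypothesis cuN : coprime u N.
Hypothesis dtau : \det tau = 1.
Hypothesis htau : cusp_twist N n g u%:Z d tau.
Hypothesis hB : multiplicative_rat B.

Lemma whittaker_relation : exists c1 c2 : R[i], (c1 != 0) || (c2 != 0) /\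
  forall (j : int) (Y : R) X1 Xu, j != 0 -> 0 < Y ->
    adelic_point n g 1 Y X1 -> adelic_point n g u%:R Y Xu ->
    c1 * whittaker mu phi (map_mx ratr (mx2 (j%:~R / N%:R) 0 0 1) *m Xu) =
    c2 * whittaker mu phi (map_mx ratr (mx2 (j%:~R / N%:R) 0 0 1) *m X1).
Proof.
have al0 (j : int) : j != 0 -> (j%:~R / N%:R : rat) != 0.
  by move=> j0; rewrite mulf_neq0 ?invr_eq0 ?intr_eq0// pnatr_eq0 -lt0n.
have ur : u%:R != 0 :> rat by rewrite pnatr_eq0 -lt0n.
pose W j Z := whittaker mu phi (map_mx ratr (mx2 (j%:~R / N%:R) 0 0 1) *m Z).
pose om (j : int) Y := away_factor (j%:~R / N%:R) Y.
have WE j (e : rat) Y X : j != 0 -> adelic_point n g e Y X ->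
    W j X = om j Y * B (j%:~R / N%:R * e).
  by move=> j0 hX; exact: (whittaker_factor (al0 j j0) hX).
(* Scalings in the same class modulo N give the same Fourier coefficient; a nonzero [om] can then be
   cancelled. *)
have Winv j Y (e e' : rat) (e0 d0 : int) (t0 : 'M[int]_2) : j != 0 -> 0 < Y -> e != 0 -> e' != 0 ->
    \det t0 = 1 -> cusp_twist N n g e0 d0 t0 ->
    level_residue N n e e0 -> level_residue N n e' e0 ->
    om j Y != 0 -> B (j%:~R / N%:R * e) = B (j%:~R / N%:R * e').
  move=> j0 Y0 en0 en0' dt ht he he' o.
  have [X hX] := adelic_point_exists n0 dg en0 (lt0r_neq0 Y0).
  have [X' hX'] := adelic_point_exists n0 dg en0' (lt0r_neq0 Y0).
  have v : W j X = _ := whittaker_value N0 hmu hphi dg fcont en0 Y0 dt j0 he ht hX.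
  have v' : W j X' = _ := whittaker_value N0 hmu hphi dg fcont en0' Y0 dt j0 he' ht hX'.
  have vv : W j X = W j X' := etrans v (esym v').
  exact: (mulfI o (etrans (esym (WE _ _ _ _ j0 hX)) (etrans vv (WE _ _ _ _ j0 hX')))).
have res1 : level_residue N n 1 1.
  move=> p _; rewrite (ratr_int _ 1); split; first exact: padic_cong_refl.
  by rewrite invr1; exact: Zint1.
have resu : level_residue N n u%:R u%:Z.
  move=> p /nN pN; rewrite ratr_nat; split; first exact: padic_cong_refl.
  exact: Zint_coprime_inv pN cuN.
have B1 j Y t : j != 0 -> 0 < Y -> t != 0 -> level_residue N n t 1 -> om j Y != 0 ->
     B (j%:~R / N%:R * t) = B (j%:~R / N%:R).
  move=> j0 Y0 t0 r o; rewrite -[X in _ = B X]mulr1.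
  exact: (Winv j Y t 1 1 1 1%:M j0 Y0 t0 (oner_neq0 _) (det1 _ _) cusp_twist1 r res1 o).
have Bu j Y t : j != 0 -> 0 < Y -> t != 0 -> level_residue N n (t * u%:R) u%:Z -> om j Y != 0 ->
     B (j%:~R / N%:R * (t * u%:R)) = B (j%:~R / N%:R * u%:R).
  move=> j0 Y0 t0 r o.
  exact: (Winv j Y _ _ u%:Z d tau j0 Y0 (mulf_neq0 t0 ur) ur dtau htau r resu o).
have [c1 [c2 [c12 h]]] := proportional_values N0 u0 cuN nN hB B1 Bu.
exists c1, c2; split; first exact: c12.
move=> j Y X1 Xu j0 Y0 h1 hu.
have e1 : W j X1 = om j Y * B (j%:~R / N%:R).
  by rewrite -[in RHS](mulr1 (j%:~R / N%:R)); exact: (WE j 1 Y X1 j0 h1).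
have eu := WE j u%:R Y Xu j0 hu.
have ew : c1 * W j Xu = c2 * W j X1.
  apply: etrans (congr1 (fun x => c1 * x) eu) _.
  exact: etrans (h j Y j0 Y0) (esym (congr1 (fun x => c2 * x) e1)).
exact: ew.
Qed.

End Relation.

(** * From Fourier coefficients to invariance *)

Section Invariance.
Variables (R : realType) (k : int) (N : nat) (chi : int -> R[i]) (f : R[i] -> R[i]).
Hypothesis N0 : (0 < N)%N.
Hypothesis hchi : dirichlet_character N chi.
Hypothesis hf : forall (g : 'M[int]_2) (z : R[i]), Gamma0 N g -> 0 < complex.Im z ->
  slashZ k f g z = chi (g 1 1) * f z.

(** The principal congruence subgroup of level N is normal in SL(2, Z) and fixes f, so it fixes
    every f|S. *)
Lemma slash_conj_level (S h : 'M[int]_2) : \det S = 1 -> \det h = 1 ->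
  (forall i j, (N%:Z %| (h - 1%:M) i j)%Z) ->
  eqH (slashZ k (slashZ k f S) h) (slashZ k f S).
Proof.
move=> dS dh hN z z0; have uS : S \in unitmx by rewrite unitmxE dS unitr1.
pose X := S *m h *m invmx S.
have dX : \det X = 1 by rewrite !det_mulmx det_inv dS dh invr1 !mulr1.
have XE : X = 1%:M + S *m (h - 1%:M) *m invmx S.
  by rewrite mulmxBr mulmx1 mulmxBl mulmxV// addrC subrK.
have XN i j : (N%:Z %| (S *m (h - 1%:M) *m invmx S) i j)%Z.
  by rewrite mulmx2E; apply: rpredD; apply: dvdz_mulr; rewrite mulmx2E; apply: rpredD; apply: dvdz_mull.
have fX : eqH (slashZ k f X) f.
  apply: (slash_Gamma0_1 hchi hf dX).
    by rewrite XE mxE mxE add0r; exact: XN.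
  by rewrite XE mxE mxE addrAC subrr add0r; exact: XN.
have e : S *m h = X *m S by rewrite /X mulmxKV.
by rewrite -slashZM// e slashZM// (slashZ_ext dS fX).
Qed.

Lemma level_upper i j : (N%:Z %| (upper N%:Z - 1%:M) i j)%Z.
Proof. by move: i j; apply: ord2P; apply: ord2P; rewrite !mxE /= ?subrr ?subr0 ?dvdz0 ?dvdzz. Qed.

Lemma level_lower i j : (N%:Z %| (lower N%:Z - 1%:M) i j)%Z.
Proof. by move: i j; apply: ord2P; apply: ord2P; rewrite !mxE /= ?subrr ?subr0 ?dvdz0 ?dvdzz. Qed.

Variables (g tau : 'M[int]_2) (a b : R[i]).
Hypothesis dg : \det g = 1.
Hypothesis dtau : \det tau = 1.
Hypothesis fcont : forall (h : 'M[int]_2) (Y : R), \det h = 1 -> 0 < Y ->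
  ccontinuous (fun t => slashZ k f h (t +i* Y)).

Lemma fourier_invariant :
  (forall (j : int) (Y : R), j != 0 -> 0 < Y ->
    a * cintegral N (fun x => slashZ k f (tau *m g) (x +i* Y) * cexp (- (j%:~R * x / N%:R))) +
    b * cintegral N (fun x => slashZ k f g (x +i* Y) * cexp (- (j%:~R * x / N%:R))) = 0) ->
  SL2Z_invariant k (fun z => a * slashZ k f tau z + b * f z).
Proof.
move=> hI; have dT : \det (tau *m g) = 1 by rewrite det_mulmx dtau dg mulr1.
have Nr : (N%:R : R) != 0 by rewrite pnatr_eq0 -lt0n.
pose D z := a * slashZ k f (tau *m g) z + b * slashZ k f g z.
have map_upper (x : int) : map_mx intr (upper x) = mx2 1 x%:~R 0 1 :> 'M[R]_2 by exact: map_mx2.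
have DM (h : 'M[int]_2) : \det h = 1 -> (forall i j, (N%:Z %| (h - 1%:M) i j)%Z) ->
    eqH (slash k D (map_mx intr h)) D.
  move=> dh hN z z0; rewrite /D slash_lin.
  by congr (a * _ + b * _); exact: slash_conj_level.
have DN z : 0 < complex.Im z -> D (z + (N%:R)%:C) = D z.
  move=> z0; have := DM _ (det_upper N%:Z) level_upper z z0.
  by rewrite map_upper slash_upper mul1r -pmulrn.
have DY (x Y : R) : 0 < Y -> D (x +i* Y) = D (0 +i* Y).
  move=> Y0; apply: (@fourier_unique_complex R N N0 (fun x => D (x +i* Y))) => [||j j0].
  - by apply: ccontinuousD; apply: ccontinuousM; [exact: ccontinuous_cst|exact: fcont|exact: ccontinuous_cst|exact: fcont].
  - move=> t; rewrite -(DN (t +i* Y))//; congr D.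
    by apply: complex_ext; rewrite /= ?addr0.
  - rewrite -[RHS](hI j Y j0 Y0) -cintegral_lin.
    + by congr cintegral; apply/funext => t; rewrite /D mulrDl !mulrA.
    + by apply: ccontinuousM; [exact: fcont|exact: ccontinuous_cexp].
    + by apply: ccontinuousM; [exact: fcont|exact: ccontinuous_cexp].
have Dt (t : R) : eqH (slash k D (mx2 1 t 0 1)) D.
  move=> [x Y] /= Y0; rewrite slash_upper mul1r.
  have -> : x +i* Y + t%:C = (x + t) +i* Y by apply: complex_ext; rewrite /= ?addr0.
  exact: etrans (DY (x + t) Y Y0) (esym (DY x Y Y0)).
have DL : eqH (slash k D (mx2 1 0 N%:R 1)) D.
  by have := DM _ (det_lower N%:Z) level_lower; rewrite map_mx2 -pmulrn.
have Dinv := SL2_invariant Nr Dt DL.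
(* H|g = D, and D is fixed by g^-1, so H equals D and inherits its invariance. *)
pose H z := a * slashZ k f tau z + b * f z.
have HD : eqH H D.
  have HgD : eqH (slashZ k H g) D.
    by move=> z z0; rewrite /H slashZ_lin /D slashZM.
  apply: eqH_trans (slashZ_inverse dg HgD) _.
  by apply: Dinv; rewrite det_map_mx det_inv dg invr1.
move=> h dh; apply: eqH_trans (slashZ_ext dh HD) _; apply: eqH_trans (eqH_sym HD).
by apply: Dinv; rewrite det_map_mx dh.
Qed.

End Invariance.

(** * The twisting matrix *)

(** If q divides c, then a d = 1 modulo q and x = 0 gives u. Otherwise x is chosen with a + x c = 0
    modulo q, which gives 1. *)
Lemma coprimez_shift (g : 'M[int]_2) (q : nat) (u : int) : \det g = 1 -> prime q ->
  coprimez u q -> exists x : int, coprimez (1 + (u - 1) * (g 0 0 + x * g 1 0) * g 1 1) q.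
Proof.
move=> dg pq cuq.
have cq (z : int) : coprimez z q = ~~ (q %| z)%Z.
  by rewrite coprimez_sym /coprimez /= -[(_ == _)]/(coprime q `|z|) prime_coprime.
have [qc|qc] := boolP (q%:Z %| g 1%R 0%R)%Z.
  exists 0; rewrite mul0r addr0 cq.
  have -> : 1 + (u - 1) * g 0 0 * g 1 1 = u + (u - 1) * g 0 1 * g 1 0.
    apply/eqP; rewrite -subr_eq0; apply/eqP.
    transitivity ((u - 1) * (g 0 0 * g 1 1 - g 0 1 * g 1 0 - 1)); first by ring.
    by rewrite -det_mx2 dg subrr mulr0.
  by rewrite rpredDr ?dvdz_mull// -cq.
have [[s t] /= st] : {st : int * int | st.1 * g 1 0 + st.2 * q%:Z = 1}.
  have /coprimezP : coprimez (g 1 0) q by rewrite cq.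
  by move=> h; apply/cid; have [s e] := h; exists s.
exists (- (g 0 0 * s)); rewrite cq rpredDr; last first.
  apply: dvdz_mulr; apply: dvdz_mull.
  have -> : g 0 0 + - (g 0 0 * s) * g 1 0 = g 0 0 * t * q%:Z.
    by rewrite -{1}[g 0 0]mulr1 -st; ring.
  exact: dvdz_mull.
by rewrite dvdz1 absz_nat neq_ltn prime_gt1// orbT.
Qed.

Lemma padic_cong_away (p : prime_num) (P Q : nat) (a b : int) : coprime Q p -> (0 < Q)%N ->
  (P%:Z %| a - b)%Z -> padic_cong (P * Q) (a%:~R : padic p) b%:~R.
Proof.
move=> cQ Q0 /dvdzP[m e]; exists (m%:~R * (Q%:R)^-1).
  by apply: ZintM; [exact: Zint_int|exact: Zint_nat_inv].
rewrite -intrB e intrM natrM -pmulrn mulrACA mulfV ?mulr1 1?mulrC//.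
by rewrite padic_natr_eq0 -lt0n.
Qed.

Lemma padic_cong_intr (p : prime_num) (N : nat) (a b : int) :
  (N%:Z %| a - b)%Z -> padic_cong N (a%:~R : padic p) b%:~R.
Proof.
move=> /dvdzP[m e]; exists m%:~R; first exact: Zint_int.
by rewrite -intrB e intrM -pmulrn mulrC.
Qed.

Lemma coprimez_cong (a b m : int) : (m %| a - b)%Z -> coprimez b m -> coprimez a m.
Proof.
move=> /dvdzP[s /eqP]; rewrite subr_eq => /eqP -> /coprimezP[[x y] /= e].
by apply/coprimezP; exists (x, y - x * s) => /=; rewrite -e; ring.
Qed.

Lemma twist_scale (N q : nat) : (0 < N)%N -> prime q -> exists u : nat,
  [/\ (1 < u)%N, coprime u N, ((N %/ q ^ logn q N)%N%:Z %| u%:Z - 1)%Z &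
    exists2 w : int, (w %| 48)%Z &
      ((q ^ logn q N)%N%:Z %| (u%:Z ^+ 2 - 1) * (u%:Z - 1) - w)%Z].
Proof.
move=> N0 pq; set v := logn q N; set Q := (q ^ v)%N; set P := (N %/ Q)%N.
have NE : N = (Q * P)%N by rewrite /Q /P mulnC divnK// pfactor_dvdnn.
have cQP : coprime Q P.
  have [m qm e] := pfactor_coprime pq N0.
  rewrite /P {1}e -/v -/Q mulnK ?expn_gt0 ?prime_gt0//.
  exact: coprimeXl.
pose u0 := if q == 2%N then 3%N else 2%N.
have u0q : coprime u0 q.
  rewrite /u0; case: ifP => [/eqP ->//|q2].
  by rewrite prime_coprime// dvdn_prime2// eq_sym q2.
(* Adding 2 N keeps both congruences and ensures u > 1. *)
pose c := chinese Q P u0 1; pose u := (c + N.*2)%N.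
have uQ : (Q%:Z %| u%:Z - u0%:Z)%Z.
  rewrite -eqz_mod_dvd; apply/eqP; rewrite !modz_nat; congr (_%:Z).
  by rewrite /u -modnDmr NE -muln2 -mulnA modnMr addn0 chinese_modl.
have uP : (P%:Z %| u%:Z - 1)%Z.
  rewrite -eqz_mod_dvd; apply/eqP; rewrite -[1]/(1%N%:Z) !modz_nat; congr (_%:Z).
  by rewrite /u -modnDmr NE -muln2 mulnC mulnA modnMl addn0 chinese_modr.
exists u; split=> //.
- by rewrite (@leq_trans N.*2)// ?leq_addl// -addnn (@leq_add 1 1).
- have : coprimez u%:Z (Q%:Z * P%:Z).
    rewrite coprimezMr; apply/andP; split.
      by apply: coprimez_cong uQ _; exact: coprimeXr.
    by apply: coprimez_cong uP _; exact: coprime1n.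
  by rewrite -PoszM -NE.
(* This is 16 for u0 = 3 and 3 for u0 = 2, whence the divisor 48. *)
exists ((u0%:Z ^+ 2 - 1) * (u0%:Z - 1)); first by rewrite /u0; case: ifP.
have /dvdzP[m /eqP] := uQ; rewrite subr_eq => /eqP ->.
apply/dvdzP; exists (m * ((m * Q%:Z + u0%:Z) ^+ 2 + (m * Q%:Z + u0%:Z) * u0%:Z +
  u0%:Z ^+ 2 - (m * Q%:Z + u0%:Z) - u0%:Z - 1)).
by ring.
Qed.

(** With K = g diag(u, 1) g^-1, the lower left entry of lower y upper x K is (u - 1) c d + y e. The
    choice of x makes e a unit at q, and y = - (u - 1) c d s, with s inverse to e modulo Q, cancels
    this entry modulo Q. Modulo P the number u is 1, so K is trivial and y vanishes. *)
Lemma choose_twist (N n q : nat) (g : 'M[int]_2) : (0 < N)%N -> \det g = 1 -> prime q ->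
  (q %| n)%N -> (forall p, prime p -> (p %| n)%N -> (p %| N)%N) ->
  g 1 0 * g 1 1 != 0 -> (logn q 24 + logn q `|(2 * g 1 0 * g 1 1)%R| < logn q N)%N ->
  exists (u : nat) (d x y : int), [/\ (1 < u)%N, coprime u N, coprimez d N,
    ~~ (q ^ logn q N %| `|((u%:Z ^+ 2 - 1) * y)%R|)%N &
    cusp_twist N n g u%:Z d (lower y *m upper x)].
Proof.
move=> N0 dg pq qn nN cd0 hv; have qN := nN q pq qn.
have [u [u1 cuN uP [w w48 wQ]]] := twist_scale N0 pq.
set Q := (q ^ logn q N)%N in uP wQ *; set P := (N %/ Q)%N in uP.
have NE : N = (P * Q)%N by rewrite /P divnK// pfactor_dvdnn.
have [x cx] : exists x : int, coprimez (1 + (u%:Z - 1) * (g 0 0 + x * g 1 0) * g 1 1) q.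
  by apply: coprimez_shift => //; exact: coprime_dvdr qN cuN.
set e := 1 + _ in cx; set K10 := (u%:Z - 1) * (g 1 0 * g 1 1).
have /coprimezP[[s r] /= sr] : coprimez e Q by exact: coprimeXr.
pose y := - (K10 * s).
pose K := g *m mx2 u%:Z 0 0 1 *m invmx g.
have KE : K = mx2 (1 + (u%:Z - 1) * (g 0 0 * g 1 1)) (- ((u%:Z - 1) * (g 0 0 * g 0 1)))
    K10 (1 - (u%:Z - 1) * (g 0 1 * g 1 0)).
  have dg1 : g 0 0 * g 1 1 = 1 + g 0 1 * g 1 0 by rewrite -dg det_mx2 subrK.
  rewrite /K invmx2//; apply: mx2_ext; rewrite !(mulmx2E, mx2E) /K10.
  - transitivity (u%:Z * (g 0 0 * g 1 1) - g 0 1 * g 1 0); first by ring.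
    by rewrite dg1; ring.
  - by ring.
  - by ring.
  - transitivity (g 0 0 * g 1 1 - u%:Z * (g 0 1 * g 1 0)); first by ring.
    by rewrite dg1; ring.
pose t := lower y *m upper x.
have tE : t = mx2 1 x y (1 + y * x).
  by rewrite /t mul_mx2; apply: mx2_ext; rewrite !mx2E; ring.
pose d := (t *m K) 1 1.
have yP : (P%:Z %| y)%Z by rewrite rpredN dvdz_mulr// dvdz_mulr.
have tK10 : (N%:Z %| (t *m K) 1%R 0%R)%Z.
  have -> : (t *m K) 1 0 = (u%:Z - 1) * ((g 1 0 * g 1 1) * r) * Q%:Z.
    rewrite mulmx2E tE KE !mx2E.
    transitivity (K10 + y * e); first by rewrite /e /K10; ring.
    transitivity (K10 * (s * e + r * Q%:Z) + y * e); first by rewrite sr mulr1.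
    by rewrite /y /K10; ring.
  by rewrite NE PoszM dvdz_mul// dvdz_mulr.
have dtK : \det (t *m K) = u%:Z.
  by rewrite /K !det_mulmx det_inv dg det_lower det_upper !det_mx2 !mx2E; ring.
exists u, d, x, y; split=> //.
(* The determinant u is prime to N and the lower left entry vanishes modulo N, so the product of the
   diagonal entries is prime to N. *)
- have /dvdzP[m em] := tK10.
  have : coprimez ((t *m K) 0 0 * d) N.
    apply: (@coprimez_cong _ u%:Z); last exact: cuN.
    by rewrite -dtK det_mx2 opprB addrC subrK em mulrA dvdz_mull.
  by rewrite coprimezMl => /andP[].
- have cd2 : (0 < `|(2 * (g 1 0 * g 1 1))%R|)%N by rewrite absz_gt0 mulf_neq0.
  (* If Q divided (u^2 - 1) y, cancelling the unit s would leave Q dividing w c d, hence 48 c d = 24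
     (2 c d). *)
  apply: contraTN hv => hy; rewrite -mulrA -leqNgt -lognM// -pfactor_dvdn ?muln_gt0//.
  have cs : coprimez Q s by rewrite coprimez_sym; apply/coprimezP; exists (e, r); rewrite /= mulrC.
  have {}hy : (Q%:Z %| (u%:Z ^+ 2 - 1) * (u%:Z - 1) * (g 1%R 0%R * g 1%R 1%R) * s)%Z.
    rewrite -rpredN; have -> : - ((u%:Z ^+ 2 - 1) * (u%:Z - 1) * (g 1 0 * g 1 1) * s) = (u%:Z ^+ 2 - 1) * y.
      by rewrite /y /K10; ring.
    exact: hy.
  move: hy; rewrite Gauss_dvdzl// => hy.
  have {hy} : (Q%:Z %| w * (g 1%R 0%R * g 1%R 1%R))%Z.
    rewrite -(subKr ((u%:Z ^+ 2 - 1) * (u%:Z - 1)) w) mulrBl rpredB//.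
    by rewrite dvdz_mulr.
  move=> hy; have {}hy := dvdz_trans hy (dvdz_mul w48 (dvdzz (g 1 0 * g 1 1))).
  have e48 : 24 * (2 * (g 1 0 * g 1 1)) = 48 * (g 1 0 * g 1 1) by rewrite mulrA.
  by rewrite -[24%N]/`|24%:Z|%N -abszM e48; exact: hy.
- move=> p /=; rewrite -/t; case: ifP => [pn|/negbT pn].
    rewrite (_ : t *m g *m _ *m _ = t *m K); last by rewrite /K !mulmxA.
    split; last exact: padic_cong_refl.
    by apply: (@padic_cong_intr p N _ 0); rewrite subr0.
  (* A prime p not dividing n differs from q, so Q is a unit at p and congruences modulo P
     suffice. *)
  have cQp : coprime Q p.
    apply: coprimeXl; rewrite prime_coprime// dvdn_prime2// ?prime_numP//.
    by apply: contraNneq pn => <-.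
  have Q0 : (0 < Q)%N by rewrite expn_gt0 prime_gt0.
  split.
    rewrite NE; apply: (@padic_cong_away p P Q _ 0) => //.
    by rewrite subr0 tE mx2E.
  rewrite NE; apply: padic_cong_away => //.
  have -> : t 1 1 - d = y * ((u%:Z - 1) * (g 0 0 * g 0 1) +
      x * ((u%:Z - 1) * (g 0 1 * g 1 0))) + (u%:Z - 1) * (g 0 1 * g 1 0).
    by rewrite /d KE tE mulmx2E !mx2E; ring.
  by rewrite rpredD// dvdz_mulr.
Qed.

(** * Prime factors of N1 *)

Section TwistLevel.
Variables (N : nat) (g : 'M[int]_2).
Hypothesis N0 : (0 < N)%N.
Hypothesis dg : \det g = 1.

Lemma N1_gt0 : (0 < N1 N g)%N.
Proof.
rewrite /N1 big_seq_cond; apply: (big_ind (fun m : nat => (0 < m)%N)) => // [m n m0 n0|q /andP[]].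
  by rewrite muln_gt0 m0.
by rewrite mem_primes expn_gt0 => /and3P[/prime_gt0 ->].
Qed.

Lemma prime_N1 q : prime q -> (q %| N1 N g)%N =
  [&& (q %| N)%N, ~~ excluded_prime N g q & (valN N q (g 1%R 0%R) < logn q N)%N].
Proof.
move=> pq; rewrite /N1.
have h (r : nat) : prime r ->
    (q %| r ^ (logn r N - valN N r (g 1%R 0%R)))%N = (q == r) && (valN N q (g 1%R 0%R) < logn q N)%N.
  move=> pr; case: (eqVneq q r) => [<-|qr] /=.
    by rewrite Euclid_dvdX// dvdnn subn_gt0.
  by rewrite Euclid_dvdX// dvdn_prime2// (negbTE qr).
rewrite Euclid_dvd_prod// big_has_cond.
apply/hasP/and3P => [[r]|[qN ex lt]].
  rewrite mem_primes => /and3P[pr _ rN] /= /andP[ex]; rewrite h// => /andP[/eqP e lt].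
  by rewrite e in lt *; rewrite rN ex lt.
by exists q; rewrite ?mem_primes ?pq ?N0//= ex h// eqxx.
Qed.

Lemma logn_valN q (x : int) : prime q -> x != 0 -> valN N q x = minn (logn q N) (logn q `|x|%N).
Proof. by move=> pq x0; rewrite /valN logn_gcd// absz_gt0. Qed.

Lemma valN_lt q (x : int) : prime q -> valN N q x != logn q N ->
  x != 0 /\ (logn q `|x|%N < logn q N)%N.
Proof.
move=> pq h; have x0 : x != 0.
  by apply: contraNneq h => ->; rewrite /valN absz0 gcdn0.
split=> //; move: h; rewrite logn_valN//; case: (leqP (logn q N)); last by [].
by rewrite eqxx.
Qed.

Hypothesis twistless : forall q, prime q -> (q %| N1 N g)%N -> g 1%R 0%R * g 1%R 1%R != 0 ->
  ~~ (logn q 24 + logn q `|(2 * g 1%R 0%R * g 1%R 1%R)%R| < logn q N)%N.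

(** Such a q divides neither 24 nor 2 and at most one of the coprime entries c and d; since q is not
    excluded, the valuation of c d stays below that of N, against [twistless]. *)
Lemma N1_prime_le3 q : prime q -> (3 < q)%N -> ~~ (q %| N1 N g)%N.
Proof.
move=> pq q3; apply/negP => qN1; have := qN1; rewrite prime_N1// => /and3P[qN].
rewrite /excluded_prime !negb_or => /and3P[vc vd _] _.
have [c0 cv] := valN_lt pq vc; have [d0 dv] := valN_lt pq vd.
have /negP := twistless pq qN1 (mulf_neq0 c0 d0); apply.
have l24 : logn q 24 = 0%N.
  by rewrite (_ : 24%N = 2 ^ 3 * 3)%N// lognM// lognX !logn_prime// !gtn_eqF// (ltn_trans _ q3).
rewrite l24 add0n !abszM !lognM ?muln_gt0 ?absz_gt0//.
rewrite [logn q `|2|%N]logn_prime// gtn_eqF ?(ltn_trans _ q3)// add0n.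
have : coprime `|g 1%R 0%R|%N `|g 1%R 1%R|%N.
  rewrite -[coprime _ _]/(coprimez (g 1%R 0%R) (g 1%R 1%R)); apply/coprimezP.
  by exists (- g 0%R 1%R, g 0%R 0%R) => /=; rewrite -dg det_mx2 mulNr addrC.
move=> cop; have [qc|qc] := boolP (q %| `|g 1%R 0%R|)%N.
  have qd : ~~ (q %| `|g 1%R 1%R|)%N.
    apply/negP => qd; have := dvdn_gcd q `|g 1%R 0%R|%N `|g 1%R 1%R|%N.
    by rewrite qc qd (eqP cop) dvdn1 => /eqP q1; move: q3; rewrite q1.
  by rewrite [X in (_ + X)%N]lognE (negbTE qd) !andbF addn0.
by rewrite [X in (X + _)%N]lognE (negbTE qc) !andbF.
Qed.

(** A prime q violating the divisibility has v_q(24) + v_q(2 c d) < v_q(N). It is then not excluded,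
    as c and d have valuation below v_q(N), for q = 2 by at least 5; so q divides N1 and [twistless]
    applies. *)
Lemma quotient_dvd24 : (N %/ gcdn N `|(2 * g 1%R 0%R * g 1%R 1%R)%R|%N %| 24)%N.
Proof.
set cd := (2 * g 1%R 0%R * g 1%R 1%R)%R; have [cd0|cd0] := eqVneq cd 0.
  by rewrite cd0 absz0 gcdn0 divnn N0.
have [c0 d0] : g 1%R 0%R != 0 /\ g 1%R 1%R != 0.
  by move: cd0; rewrite /cd -mulrA !mulf_eq0 !negb_or => /and3P[].
have cdp : (0 < `|cd|)%N by rewrite absz_gt0.
set M := gcdn N _; have MN : (M %| N)%N by exact: dvdn_gcdl.
have M0 : (0 < M)%N by rewrite gcdn_gt0 N0.
have NM0 : (0 < N %/ M)%N by rewrite divn_gt0// dvdn_leq.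
apply/dvdn_partP => // q; rewrite mem_primes => /and3P[pq _ _].
rewrite p_part pfactor_dvdn// leqNgt; apply/negP.
rewrite logn_div// logn_gcd// => lt.
have hv : (logn q 24 + logn q `|cd| < logn q N)%N.
  by move: lt; move: (logn q 24) (logn q N) (logn q `|cd|) => x y z; lia.
have lcd : logn q `|cd| = (logn q 2 + logn q `|g 1%R 0%R| + logn q `|g 1%R 1%R|)%N.
  by rewrite /cd !abszM !lognM// ?muln_gt0 ?absz_gt0 ?c0.
have qN1 : (q %| N1 N g)%N.
  rewrite prime_N1//; apply/and3P; split.
  - by have := leq_ltn_trans (leq0n _) hv; rewrite logn_gt0 mem_primes => /and3P[].
  - rewrite /excluded_prime !logn_valN// !negb_or; apply/and3P; split.
    + by lia.
    + by lia.
    + rewrite negb_and; case: eqVneq => //= q2; subst q.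
      have e24 : logn 2 24 = 3%N by [].
      have e2 : logn 2 2 = 1%N by [].
      by rewrite e24 in hv; rewrite e2 in lcd; lia.
  - by rewrite logn_valN//; lia.
have /negP := twistless pq qN1 (mulf_neq0 c0 d0); exact.
Qed.

End TwistLevel.

(** * The twist against the minimality of the level *)

Lemma level_residue_nat (N n u : nat) : (forall p : prime_num, (p %| n)%N -> (p %| N)%N) ->
  coprime u N -> level_residue N n u%:R u%:Z.
Proof.
move=> nN cuN p pn; rewrite ratr_nat; split; first exact: padic_cong_refl.
exact: Zint_coprime_inv (nN p pn) cuN.
Qed.

Lemma twist_impossible (R : realType) (k : int) (N : nat) (chi : int -> R[i])
  (f : R[i] -> R[i]) (mu : {measure set (adeleB R) -> \bar R})
  (phi : 'M[adele R]_2 -> R[i]) (Winf : 'M[R]_2 -> R[i])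
  (Wp : forall p : prime_num, 'M[padic p]_2 -> R[i]) (n q u : nat) (g : 'M[int]_2) (d x y : int) :
  dirichlet_character N chi -> maass_form k N chi f -> has_level k f N ->
  haar_measure mu -> adelic_lift k N chi f phi -> factors_as (whittaker mu phi) Winf Wp ->
  \det g = 1 -> (0 < n)%N -> (forall p : prime_num, (p %| n)%N -> (p %| N)%N) ->
  multiplicative_rat (cuspB Wp n g) -> prime q -> (1 < u)%N -> coprime u N -> coprimez d N ->
  cusp_twist N n g u%:Z d (lower y *m upper x) ->
  (q ^ logn q N %| `|((u%:Z ^+ 2 - 1) * y)%R|)%N.
Proof.
move=> hchi hf hlevel hmu hphi hW dg n0 nN hB pq u1 cuN cdN htau.
have [N0 _ _] := hlevel; have [fsm fG _] := hf.
(* For N = 1 the form may be SL(2, Z)-invariant, but then the divisor is 1. *)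
have [N_1|N_1] := eqVneq N 1%N; first by rewrite N_1 logn1 expn0 dvd1n.
have fninv : ~ SL2Z_invariant k f by move=> /(level_invariant hlevel) e; rewrite e in N_1.
apply: contraPT isT => nY _.
have u0 : (0 < u)%N by exact: ltnW.
have dtau : \det (lower y *m upper x) = 1 by rewrite det_mulmx det_lower det_upper mulr1.
have fcont (h : 'M[int]_2) (Y : R) := @slash_ccontinuous R k f fsm h Y.
have [chi1 _ _ chi_n0] := hchi.
have chid : chi d != 0 by rewrite chi_n0.
have [c1 [c2 [c12 rel]]] := whittaker_relation N0 hmu hphi hW fcont n0 nN dg u0 cuN dtau htau hB.
have ur : (u%:R : rat) != 0 by rewrite pnatr_eq0 -lt0n.
have inv : SL2Z_invariant k (fun z => c1 * (chi d)^-1 * slashZ k f (lower y *m upper x) z + - c2 * f z).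
  apply: (fourier_invariant N0 hchi fG dg dtau fcont) => j Y j0 Y0.
  have [X1 hX1] := @adelic_point_exists R n g n0 dg 1 Y (oner_neq0 _) (lt0r_neq0 Y0).
  have [Xu hXu] := @adelic_point_exists R n g n0 dg u%:R Y ur (lt0r_neq0 Y0).
  have := rel j Y X1 Xu j0 Y0 hX1 hXu.
  have res1 : level_residue N n 1 1 by exact: (level_residue_nat nN (coprime1n N)).
  rewrite (whittaker_value N0 hmu hphi dg fcont ur Y0 dtau j0 (level_residue_nat nN cuN) htau hXu).
  rewrite (whittaker_value N0 hmu hphi dg fcont (oner_neq0 _) Y0 (det1 _ _) j0 res1
    (cusp_twist1 N n dg) hX1).
  rewrite mul1mx chi1 invr1; set I1 := cintegral _ _; set I2 := cintegral _ _ => e.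
  have Nr : (N%:R^-1)%:C != 0 :> R[i].
    by rewrite eq_complex /= eqxx andbT invr_eq0 pnatr_eq0 -lt0n.
  apply: (mulfI Nr); rewrite mulr0 -[RHS](subrr (c2 * (1 * (N%:R^-1)%:C * I2))) -{1}e.
  by ring.
apply: (level_contradiction N0 hchi fG fninv hlevel pq u1 cuN nY (c1 := c1 * (chi d)^-1) (c2 := - c2)).
  by rewrite mulf_eq0 invr_eq0 (negbTE chid) orbF oppr_eq0.
(* Acting by upper (- x) removes the factor upper x of tau; it fixes both f and the invariant
   combination. *)
apply: (SL2Z_invariant_ext _ inv); apply: eqH_trans (eqH_sym (inv _ (det_upper (- x)))) _ => z z0.
rewrite slashZ_lin -slashZM ?det_upper// (slash_upper_int hchi fG)//.
by rewrite -mulmxA mul_mx2 !(mulr1, mul1r, mulr0, mul0r, addr0, add0r) addNr mx2_scalar1 mulmx1.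
Qed.

Theorem theorem19 (R : realType) (k : int) (N : nat) (hN : (1 <= N)%N)
  (chi : int -> R[i]) (hchi : dirichlet_character N chi)
  (f : R[i] -> R[i]) (hf : maass_form k N chi f) (hlevel : has_level k f N)
  (mu : {measure set (adeleB R) -> \bar R}) (hmu : haar_measure mu)
  (phi : 'M[adele R]_2 -> R[i]) (hphi : adelic_lift k N chi f phi)
  (Winf : 'M[R]_2 -> R[i]) (Wp : forall p : prime_num, 'M[padic p]_2 -> R[i])
  (hW : factors_as (whittaker mu phi) Winf Wp)
  (g : 'M[int]_2) (hg : \det g = 1)
  (hB : multiplicative_rat (cuspB Wp (N1 N g) g)) :
  (N %/ gcdn N `|(2 * g 1 0 * g 1 1)%R|%N %| 24)%N /\
  (forall q : nat, prime q -> (3 < q)%N -> ~~ (q %| N1 N g)%N).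
Proof.
have twistless q : prime q -> (q %| N1 N g)%N -> g 1 0 * g 1 1 != 0 ->
    ~~ (logn q 24 + logn q `|(2 * g 1 0 * g 1 1)%R| < logn q N)%N.
  move=> pq qn cd0; apply/negP => hv.
  have nN p : prime p -> (p %| N1 N g)%N -> (p %| N)%N.
    by move=> pp; rewrite prime_N1// => /and3P[].
  have [u [d [x [y [u1 cuN cdN nY htau]]]]] := choose_twist hN hg pq qn nN cd0 hv.
  move/negP: nY; apply; apply: (twist_impossible hchi hf hlevel hmu hphi hW hg) htau => //.
    exact: N1_gt0.
  by move=> p; apply: nN; exact: prime_numP.
by split=> [|q]; [exact: quotient_dvd24|exact: N1_prime_le3].
Qed.
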